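(* Consider the latent space network model, the projected gradient descent algorithm with adaptive line search, and the error $\mathrm{dist}$ described in the context; in particular assume (T1)--(T3), (E1)--(E2) and (I1)--(I3). Let $M$ be a constant with $M\geqslant2M_1$, with $M_1$ as in (T2), and let $\hat Y=[\hat Z,\hat\alpha]$ be any representative element in the equivalence class (up to replacing $\hat Z$ by $\hat ZQ$, $Q\in\mathcal{O}(k)$) of the constrained maximum likelihood estimator, i.e. of the solution of $$\min_{Z\in\mathbb{R}^{n\times k},\ \alpha\in\mathbb{R}^n} L(Z,\alpha)\quad\text{subject to}\quad \|Z\|_{2\to\infty}\leqslant M,\ \ \|\alpha\|_\infty\leqslant M,\ \ 1_n^\top Z=0.$$ Let $Y^0,Y^1,\dots,Y^R$ be the iterates of the algorithm. Then for any constant $\varepsilon>0$ there exist constants $C>0$, $c_0\in(0,1)$ and $N_\varepsilon\in\mathbb{N}$ such that when $n\geqslant N_\varepsilon$, $$\mathrm{dist}^2(Y^r,\hat Y)\leqslant C(1-c_0)^r\,\mathrm{dist}^2(Y^0,\hat Y)$$ holds for any $0\leqslant r\leqslant R$ with probability $1-O(n^{-\varepsilon})$.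
   Context: Model. $k\geqslant 1$ is a fixed integer. For each $n$ we observe a symmetric matrix $A=(A_{ij})\in\mathbb{R}^{n\times n}$ with $A_{ii}=0$ and, independently for $1\leqslant i<j\leqslant n$, $A_{ij}=A_{ji}\sim p(\cdot\mid\Theta^\star_{ij})$ with $\Theta^\star_{ij}=\alpha^\star_i+\alpha^\star_j+\langle z^\star_i,z^\star_j\rangle$, where $p(\cdot\mid\theta)$ is a probability density/mass function with a one-dimensional parameter $\theta\in\mathbb{R}$. The true parameters $Z^\star=[z_1^\star,\dots,z_n^\star]^\top\in\mathbb{R}^{n\times k}$ and $\alpha^\star\in\mathbb{R}^n$ are nonrandom (they may depend on $n$); $Y^\star=[Z^\star,\alpha^\star]$. All quantities called constants do not depend on $n$. Write $\ell(\theta;x)=\log p(x\mid\theta)$, with derivatives $\ell',\ell'',\ell'''$ in $\theta$, and $\mathcal{X}=\{x\in\mathbb{R}:p(x\mid\theta)>0\}$ for the support. For $Y=[Z,\alpha]\in\mathbb{R}^{n\times(k+1)}$ with $i$-th row $(z_i^\top,\alpha_i)$, let $\Theta_{ij}=\alpha_i+\alpha_j+\langle z_i,z_j\rangle$, $L(Y)=L(Z,\alpha)=-\sum_{1\leqslant i<j\leqslant n}\ell(\Theta_{ij};A_{ij})$ and $L_i(Y)=-\sum_{j\in\{1,\dots,n\}\setminus\{i\}}\ell(\Theta_{ij};A_{ij})$. Norms. $\|X\|_{2\to\infty}=\sup_{\|v\|_2=1}\|Xv\|_\infty$ (largest row $\ell_2$ norm), $\|\cdot\|_{\mathrm F}$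 Frobenius norm, $\langle\cdot,\cdot\rangle$ the entrywise (Frobenius) inner product, $\mathcal{O}(k)$ the $k\times k$ orthogonal matrices, $1_n$ the all-ones vector, $\sigma_{\min}$ the smallest singular value. $a_n\lesssim b_n$ means $a_n\leqslant cb_n$ for a constant $c>0$. Error. For $Y=[Z,\alpha]$ and $\hat Y=[\hat Z,\hat\alpha]$: $\mathrm{dist}^2(\hat Y,Y)=\min_{Q\in\mathcal{O}(k)}\|\hat Z-ZQ\|_{\mathrm F}^2+\|\hat\alpha-\alpha\|_2^2$. Algorithm. Inputs: $A$, initial estimate $Y^0\in\mathbb{R}^{n\times(k+1)}$, initial step size $\eta_{\mathrm{init}}>0$, constant backtracking rate $\beta\in(0,1)$, backtracking limit $R'\in\mathbb{N}$, number of iterations $R$, and a constant hyperparameter $C_{\mathrm{ls}}>0$ (which can be set to 1). Let $J_n=\mathrm{I}_n-1_n1_n^\top/n$, $d(Y)=-[J_n\nabla_ZL(Y),\nabla_\alpha L(Y)]$, and $d_i(Y)=-e_ie_i^\top\nabla_YL(Y)$, where $e_i\in\mathbb{R}^n$ is the $i$-th standard basis vector. The line search conditions at $Y$ with step size $\eta$ are (LS1) $L(Y+\eta d(Y))-L(Y)-C_{\mathrm{ls}}n\eta^2\langle\nabla_YL(Y),d(Y)\rangle\leqslant0$, and (LS2) $\max_{1\leqslant i\leqslant n}\{L_i(Y+\eta d_i(Y))-L_i(Y)-C_{\mathrm{ls}}n\eta^2\langle\nabla_YL_i(Y),d_i(Y)\rangle\}\leqslant0$. For $r=0,\dots,R-1$: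 compute $d(Y^r)$; set $\eta=\eta_{\mathrm{init}}$; if (LS1) or (LS2) is violated at $Y^r$ with the current $\eta$, repeat $\eta\leftarrow\beta\eta$ until (LS1) and (LS2) both hold at $Y^r$ or the number of backtracking steps exceeds $R'$; set $\eta_r=\eta$ and $Y^{r+1}=Y^r+\eta_rd(Y^r)$. Conditions on true parameters: (T1) $1_n^\top Z^\star=0$ and $Z^{\star\top}Z^\star$ is diagonal. (T2) There is a constant $M_1>0$ with $\|Z^\star\|_{2\to\infty}\leqslant M_1$ and $\|\alpha^\star\|_\infty\leqslant M_1$. (T3) There is a constant $M_2>0$ with $\sigma_{\min}[Z^{\star\top}Z^\star/n]\geqslant M_2$. Conditions on edgewise distributions: (E1) For any fixed $x\in\mathcal{X}$, $\ell(\theta;x)$ is three times differentiable in $\theta$; and for any constant $b>0$ there are constants $\kappa_1(b),\kappa_2(b),\kappa_3(b)>0$ such that $\kappa_1(b)\leqslant-\ell''(\theta;x)\leqslant\kappa_2(b)$ and $|\ell'''(\theta;x)|\leqslant\kappa_3(b)$ for all $\theta\in[-b,b]$ and $x\in\mathcal{X}$. (E2) There are constants $K,s>0$ such that for any $t\geqslant0$, $\Pr(|\ell'(\Theta^\star_{ij};A_{ij})|>t)\leqslant2\exp(-(t/K)^s)$. Conditions on the inputs: (I1) $Y^0=[Z^0,\alpha^0]$ satisfies (a) $1_n^\top Z^0=0$, (b) $\mathrm{dist}^2(Y^0,Y^\star)\lesssim n^{1-\varsigma_0}$ for a constant $\varsigma_0\in(0,1/2)$, (c) $\|Y^0\|_{2\to\infty}\leqslant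 b_0$ for a constant $b_0>0$. (I2) $1/C_{\mathrm{init}}\leqslant n\eta_{\mathrm{init}}\leqslant C_{\mathrm{init}}$ for a constant $C_{\mathrm{init}}>1$. (I3) $R'\to\infty$ as $n\to\infty$. *)

(* Defs.v *)
From HB Require Import structures.
From mathcomp Require Import all_boot all_order all_algebra.
From mathcomp Require Import all_classical all_reals all_analysis.

Set Implicit Arguments.
Unset Strict Implicit.
Unset Printing Implicit Defensive.

Import Order.TTheory GRing.Theory Num.Theory.
Import numFieldNormedType.Exports.

Local Open Scope classical_set_scope.
Local Open Scope ring_scope.

Section MatrixNotions.
Context {R : realType}.

Definition frob_dot m q (X Y : 'M[R]_(m, q)) : R :=
  \sum_(i < m) \sum_(j < q) X i j * Y i j.

Definition frob_norm m q (X : 'M[R]_(m, q)) : R := Num.sqrt (frob_dot X X).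

(* On column vectors frob_norm is the l2 norm; the library norm `|_| on
   matrices is the largest absolute value of an entry. *)
Definition two_to_inf m q (X : 'M[R]_(m, q)) : R :=
  sup [set `|X *m v| | v in [set v : 'cV[R]_q | frob_norm v = 1]].

Definition orthogonal_mx k : set 'M[R]_k := [set Q | Q^T *m Q = 1%:M].

Definition ones n : 'cV[R]_n := const_mx 1.

(* For square M only: the singular values are the nonnegative square roots of
   the eigenvalues of M^T M. *)
Definition sigma_min k (M : 'M[R]_k) : R :=
  inf [set s : R | 0 <= s /\ eigenvalue (M^T *m M) (s ^+ 2)].

Definition gradient m q (f : 'M[R]_(m, q) -> R) (X : 'M[R]_(m, q)) :
    'M[R]_(m, q) :=
  \matrix_(i < m, j < q) 'D_(delta_mx i j) f X.

End MatrixNotions.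

(* The parameter Y = [Z, alpha] is a single n x (k + 1) matrix. *)
Section LatentCoordinates.
Context {R : realType} {n k : nat}.
Implicit Types Y : 'M[R]_(n, k + 1).

Definition positions Y : 'M[R]_(n, k) := lsubmx Y.
Definition degrees Y : 'cV[R]_n := rsubmx Y.

Definition Theta Y (i j : 'I_n) : R :=
  degrees Y i 0 + degrees Y j 0
  + \sum_(l < k) positions Y i l * positions Y j l.

(* The infimum over the compact group O(k) is a minimum. *)
Definition dist2 (Yhat Y : 'M[R]_(n, k + 1)) : R :=
  inf [set frob_norm (positions Yhat - positions Y *m Q) ^+ 2
           + frob_norm (degrees Yhat - degrees Y) ^+ 2
      | Q in orthogonal_mx (R := R) (k := k)].

End LatentCoordinates.

Section EdgeDistribution.
Context {R : realType}.
(* p theta x stands for p(x | theta). *)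
Implicit Types p : R -> R -> R.

(* mu is the dominating measure: Lebesgue measure for density functions,
   counting measure for mass functions. *)
Definition density_family (mu : {measure set (measurableTypeR R) -> \bar R})
    p : Prop :=
  forall theta,
    [/\ measurable_fun [set: R] (p theta),
        forall x, 0 <= p theta x
      & (\int[mu]_x (p theta x)%:E = 1)%E].

Definition loglik p (theta x : R) : R := ln (p theta x).

Definition dloglik p (m : nat) (theta x : R) : R :=
  derive1n m (fun t => loglik p t x) theta.

Definition loglik_regular p (X : set R) : Prop :=
  (forall x, X x -> forall (m : nat) theta, (m < 3)%N ->
     derivable (fun t => dloglik p m t x) theta 1)
  /\ forall b : R, 0 < b ->
     exists kappa1 kappa2 kappa3 : R,
       [/\ 0 < kappa1, 0 < kappa2, 0 < kappa3 &
           forall theta x, - b <= theta <= b -> X x ->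
             kappa1 <= - dloglik p 2 theta x <= kappa2
             /\ `|dloglik p 3 theta x| <= kappa3].

End EdgeDistribution.

Section NetworkModel.
Context {R : realType} {n k : nat} {d : measure_display}
  {Omega : measurableType d}.

(* Mutual independence of the entries above the diagonal. *)
Definition independent_edges (P : probability Omega R)
    (A : Omega -> 'M[R]_n) : Prop :=
  forall (J : {set 'I_n * 'I_n}) (B : 'I_n * 'I_n -> set R),
    (forall e, e \in J -> (e.1 < e.2)%N) ->
    (forall e, measurable (B e)) ->
    P [set w | forall e, e \in J -> B e (A w e.1 e.2)]
    = (\prod_(e in J) P [set w | B e (A w e.1 e.2)])%E.

Definition latent_space_model
    (mu : {measure set (measurableTypeR R) -> \bar R}) (p : R -> R -> R)
    (P : probability Omega R) (Ystar : 'M[R]_(n, k + 1))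
    (A : Omega -> 'M[R]_n) : Prop :=
  [/\ forall w, (A w)^T = A w /\ (forall i, A w i i = 0),
      forall i j, measurable_fun [set: Omega] (fun w => A w i j),
      independent_edges P A
    & forall i j : 'I_n, (i < j)%N -> forall B : set R, measurable B ->
        P [set w | B (A w i j)]
        = (\int[mu]_(x in B) (p (Theta Ystar i j) x)%:E)%E].

End NetworkModel.

Section Estimation.
Context {R : realType} {n k : nat}.
Variables (p : R -> R -> R) (A : 'M[R]_n).
Implicit Types (Y : 'M[R]_(n, k + 1)) (eta : R).

Definition loss Y : R :=
  - \sum_(i < n) \sum_(j < n | (i < j)%N) loglik p (Theta Y i j) (A i j).

Definition row_loss (i : 'I_n) Y : R :=
  - \sum_(j < n | j != i) loglik p (Theta Y i j) (A i j).

Definition feasible (M : R) Y : Prop :=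
  [/\ two_to_inf (positions Y) <= M,
      `|degrees Y| <= M
    & (ones n)^T *m positions Y = 0].

Definition constrained_mle (M : R) Y : Prop :=
  feasible M Y /\ forall Y', feasible M Y' -> loss Y <= loss Y'.

Definition centering : 'M[R]_n := 1%:M - n%:R^-1 *: (ones n *m (ones n)^T).

Definition direction Y : 'M[R]_(n, k + 1) :=
  - row_mx (centering *m lsubmx (gradient loss Y)) (rsubmx (gradient loss Y)).

Definition row_direction (i : 'I_n) Y : 'M[R]_(n, k + 1) :=
  - (delta_mx i i *m gradient loss Y).

Variable C_ls : R.

Definition global_decrease Y eta : bool :=
  loss (Y + eta *: direction Y) - loss Y
  - C_ls * n%:R * eta ^+ 2 * frob_dot (gradient loss Y) (direction Y) <= 0.

Definition rowwise_decrease Y eta : bool :=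
  [forall i : 'I_n,
    row_loss i (Y + eta *: row_direction i Y) - row_loss i Y
    - C_ls * n%:R * eta ^+ 2
      * frob_dot (gradient (row_loss i) Y) (row_direction i Y) <= 0].

Variable beta : R.

(* [steps] is the number of backtracking steps still allowed. *)
Fixpoint backtrack Y (steps : nat) eta : R :=
  if global_decrease Y eta && rowwise_decrease Y eta then eta
  else if steps is s.+1 then backtrack Y s (beta * eta) else eta.

Variables (Rmax : nat) (eta_init : R).

(* Backtracking is abandoned once the number of steps exceeds Rmax, hence after
   at most Rmax + 1 steps. *)
Definition step_size Y : R := backtrack Y Rmax.+1 eta_init.

Definition pgd_iterate (Y0 : 'M[R]_(n, k + 1)) (r : nat) : 'M[R]_(n, k + 1) :=
  iter r (fun Y => Y + step_size Y *: direction Y) Y0.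

End Estimation.

(* Main.v *)
Require Import Defs.
From HB Require Import structures.
From mathcomp Require Import all_boot all_order all_algebra.
From mathcomp Require Import all_classical all_reals all_analysis.
From mathcomp Require Import measurable_realfun.
From mathcomp Require Import ring lra.
Set Implicit Arguments.
Unset Strict Implicit.
Unset Printing Implicit Defensive.
Import Order.TTheory GRing.Theory Num.Theory.
Import numFieldNormedType.Exports.
Local Open Scope classical_set_scope.
Local Open Scope ring_scope.

(** Randomness and optimisation are separated. On one event of probability 1 - O(n^(-eps)) the score
    matrix E at the truth is small in several norms and every observed edge lies in the support; on
    that event the bound holds deterministically, for every iteration and every constrained
    minimiser.

    Noise. Since -l'' <= K near the true parameters, exp(h l'(theta)) p(x | theta) <= exp(K h^2 / 2)
    p(x | theta + h) for |h| <= 1. Integrating bounds the moment generating function of a score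
    ([score_mgf]), and independence gives Chernoff bounds for linear statistics of E
    ([edge_sum_tail], [noise_event]). A union bound ([noise_bounds]) then controls the sign sums of
    E by n^(3/2), its product with the design matrix by sqrt n log n, and its entries by log n, up
    to constants. Clipping large coordinates ([cut_op_bounded]) turns the first and the last of
    these into an operator norm of order n^(5/6) log n, which is o(n).

    Estimator. Comparing losses at the estimator and at the truth, with strong concavity and the
    Procrustes inequality [gram_lower], gives a Frobenius error o(sqrt n) after rotation
    ([minimizer_consistent]). A row far from its true value would allow a feasible first-order
    improvement: move that row towards the truth and spread the opposite shift of positions over the
    many rows that are strictly inside the constraints ([minimizer_row_close]). Hence all
    constraints on row norms are inactive and the estimator Yh is a stationary point
    ([minimizer_interior]).

    Optimisation. Around a stationary point whose score matrix has small operator norm, the loss gap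
    is comparable to n times the squared distance ([loss_growth], [loss_upper]), and the gradient
    correlates with the displacement ([gradient_lower]), so it is at least of order n times the
    distance. The accepted step sizes are of order 1/n ([backtrack_spec], [good_step_size]), and
    (LS1) then contracts the loss gap by a factor 1 - c0.

    All these constants require bounded rows, which a Frobenius bound of order sqrt n does not give.
    This is the purpose of (LS2): with the other rows frozen at the truth, the loss of one row is
    convex with bounded level sets ([row_level_set]), and (LS2) makes a level set of it invariant
    under the iteration ([row_step]). The displacements are summed by a geometric series, so the
    iterates stay near one fixed rotation of the truth, which closes the induction ([trajectory]).
    [local_convergence] and [deterministic_convergence] choose the constants. *)

(** * The Frobenius inner product and norm *)

Section FrobeniusNorm.
Context {R : realType}.
Local Notation dot := frob_dot.
Local Notation nrm := frob_norm.

Lemma frob_dot_trace m q (X Y : 'M[R]_(m, q)) : dot X Y = \tr (X^T *m Y).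
Proof.
rewrite /frob_dot exchange_big /mxtrace; apply: eq_bigr => j _.
by rewrite mxE; apply: eq_bigr => i _; rewrite mxE.
Qed.

Lemma frob_dotC m q (X Y : 'M[R]_(m, q)) : dot X Y = dot Y X.
Proof. by apply: eq_bigr => i _; apply: eq_bigr => j _; rewrite mulrC. Qed.

Lemma frob_dotDl m q (X Y W : 'M[R]_(m, q)) : dot (X + Y) W = dot X W + dot Y W.
Proof. by rewrite !frob_dot_trace linearD mulmxDl linearD. Qed.

Lemma frob_dotDr m q (X Y W : 'M[R]_(m, q)) : dot W (X + Y) = dot W X + dot W Y.
Proof. by rewrite !frob_dot_trace mulmxDr linearD. Qed.

Lemma frob_dotZl m q a (X Y : 'M[R]_(m, q)) : dot (a *: X) Y = a * dot X Y.
Proof. by rewrite !frob_dot_trace linearZ -scalemxAl linearZ. Qed.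

Lemma frob_dotZr m q a (X Y : 'M[R]_(m, q)) : dot X (a *: Y) = a * dot X Y.
Proof. by rewrite frob_dotC frob_dotZl frob_dotC. Qed.

Lemma frob_dotNl m q (X Y : 'M[R]_(m, q)) : dot (- X) Y = - dot X Y.
Proof. by rewrite -scaleN1r frob_dotZl mulN1r. Qed.

Lemma frob_dotNr m q (X Y : 'M[R]_(m, q)) : dot X (- Y) = - dot X Y.
Proof. by rewrite frob_dotC frob_dotNl frob_dotC. Qed.

Definition frob_dotE := (@frob_dotDl, @frob_dotDr, @frob_dotNl, @frob_dotNr,
  @frob_dotZl, @frob_dotZr).

Lemma frob_dot0l m q (X : 'M[R]_(m, q)) : dot 0 X = 0.
Proof. by rewrite -(scale0r 0) frob_dotZl mul0r. Qed.

Lemma frob_dot0r m q (X : 'M[R]_(m, q)) : dot X 0 = 0.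
Proof. by rewrite frob_dotC frob_dot0l. Qed.

Lemma frob_dot_tr m q (X Y : 'M[R]_(m, q)) : dot X^T Y^T = dot X Y.
Proof.
rewrite /frob_dot exchange_big; apply: eq_bigr => j _.
by apply: eq_bigr => i _; rewrite !mxE.
Qed.

Lemma frob_dot_mulmxl m q s (A : 'M[R]_(m, q)) (X : 'M[R]_(q, s)) Y :
  dot (A *m X) Y = dot X (A^T *m Y).
Proof. by rewrite !frob_dot_trace trmx_mul mulmxA. Qed.

Lemma frob_dot_mulmxr m q s (X : 'M[R]_(m, q)) (B : 'M[R]_(q, s)) Y :
  dot (X *m B) Y = dot X (Y *m B^T).
Proof. by rewrite !frob_dot_trace trmx_mul -mulmxA mxtrace_mulC mulmxA. Qed.

Lemma frob_dot_ge0 m q (X : 'M[R]_(m, q)) : 0 <= dot X X.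
Proof. by do 2![apply: sumr_ge0 => ? _]; rewrite -expr2 sqr_ge0. Qed.

Lemma frob_norm_ge0 m q (X : 'M[R]_(m, q)) : 0 <= nrm X.
Proof. exact: sqrtr_ge0. Qed.

Lemma sqr_frob_norm m q (X : 'M[R]_(m, q)) : nrm X ^+ 2 = dot X X.
Proof. by rewrite sqr_sqrtr // frob_dot_ge0. Qed.

Lemma frob_dot_eq0 m q (X : 'M[R]_(m, q)) : dot X X = 0 -> X = 0.
Proof.
move=> /eqP; rewrite psumr_eq0 => [/allP h|i _]; last first.
  by apply: sumr_ge0 => j _; rewrite -expr2 sqr_ge0.
apply/matrixP => i j; rewrite mxE.
have /= := h i (mem_index_enum i); rewrite psumr_eq0 => [/allP h2|j0 _]; last first.
  by rewrite -expr2 sqr_ge0.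
by have /= := h2 j (mem_index_enum j); rewrite -expr2 sqrf_eq0 => /eqP.
Qed.

Lemma frob_norm_eq0 m q (X : 'M[R]_(m, q)) : nrm X = 0 -> X = 0.
Proof. by move=> h; apply: frob_dot_eq0; rewrite -sqr_frob_norm h expr0n. Qed.

Lemma frob_norm0 m q : nrm (0 : 'M[R]_(m, q)) = 0.
Proof. by rewrite /frob_norm frob_dot0l sqrtr0. Qed.

Lemma frob_norm_le m q (X : 'M[R]_(m, q)) a :
  0 <= a -> dot X X <= a ^+ 2 -> nrm X <= a.
Proof.
by move=> a0 h; rewrite -(ler_pXn2r (_ : 0 < 2)%N) ?nnegrE ?frob_norm_ge0 ?sqr_frob_norm.
Qed.

Lemma frob_norm_sqr_le m q (X : 'M[R]_(m, q)) a :
  nrm X <= a -> dot X X <= a ^+ 2.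
Proof.
move=> h; rewrite -sqr_frob_norm ler_pXn2r ?nnegrE ?frob_norm_ge0 //.
exact: le_trans (frob_norm_ge0 X) h.
Qed.

Lemma frob_cauchy_schwarz m q (X Y : 'M[R]_(m, q)) : `|dot X Y| <= nrm X * nrm Y.
Proof.
have [Y0|Yn0] := eqVneq (dot Y Y) 0.
  by rewrite (frob_dot_eq0 Y0) frob_dot0r normr0 frob_norm0 mulr0.
have cp : 0 < dot Y Y by rewrite lt_neqAle eq_sym Yn0 frob_dot_ge0.
have := frob_dot_ge0 (dot Y Y *: X - dot X Y *: Y).
rewrite !frob_dotE (frob_dotC Y X) => h.
have {}h : dot X Y ^+ 2 <= dot X X * dot Y Y.
  rewrite -subr_ge0 -(pmulr_rge0 _ cp); apply: le_trans h _.
  rewrite le_eqVlt; apply/orP; left; apply/eqP; ring.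
rewrite -(ler_pXn2r (_ : 0 < 2)%N) ?nnegrE ?mulr_ge0 ?frob_norm_ge0 //.
by rewrite exprMn !sqr_frob_norm real_normK ?num_real.
Qed.

Lemma frob_dot_le m q (X Y : 'M[R]_(m, q)) : dot X Y <= nrm X * nrm Y.
Proof. exact: le_trans (ler_norm _) (frob_cauchy_schwarz X Y). Qed.

Lemma frob_normD m q (X Y : 'M[R]_(m, q)) : nrm (X + Y) <= nrm X + nrm Y.
Proof.
apply: frob_norm_le; first by rewrite addr_ge0 ?frob_norm_ge0.
rewrite !frob_dotE (frob_dotC Y X) -!sqr_frob_norm.
by have := frob_dot_le X Y; nra.
Qed.

Lemma frob_normZ m q a (X : 'M[R]_(m, q)) : nrm (a *: X) = `|a| * nrm X.
Proof.
by rewrite /frob_norm !frob_dotE mulrA -expr2 sqrtrM ?sqr_ge0 // sqrtr_sqr.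
Qed.

Lemma frob_normN m q (X : 'M[R]_(m, q)) : nrm (- X) = nrm X.
Proof. by rewrite -scaleN1r frob_normZ normrN1 mul1r. Qed.

Lemma frob_normB m q (X Y : 'M[R]_(m, q)) : nrm (X - Y) <= nrm X + nrm Y.
Proof. by rewrite -(frob_normN Y) frob_normD. Qed.

Lemma frob_distC m q (X Y : 'M[R]_(m, q)) : nrm (X - Y) = nrm (Y - X).
Proof. by rewrite -frob_normN opprB. Qed.

Lemma frob_dist_triangle m q (X Y W : 'M[R]_(m, q)) :
  nrm (X - W) <= nrm (X - Y) + nrm (Y - W).
Proof. by have := frob_normD (X - Y) (Y - W); rewrite addrA subrK. Qed.

Lemma frob_norm_tr m q (X : 'M[R]_(m, q)) : nrm X^T = nrm X.
Proof. by rewrite /frob_norm frob_dot_tr. Qed.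

Lemma frob_dot_rows m q (X Y : 'M[R]_(m, q)) :
  dot X Y = \sum_i dot (row i X) (row i Y).
Proof.
apply: eq_bigr => i _; rewrite /frob_dot big_ord1.
by apply: eq_bigr => j _; rewrite !mxE.
Qed.

Lemma sqr_frob_norm_rows m q (X : 'M[R]_(m, q)) :
  nrm X ^+ 2 = \sum_i nrm (row i X) ^+ 2.
Proof.
by rewrite sqr_frob_norm frob_dot_rows; apply: eq_bigr => i _; rewrite sqr_frob_norm.
Qed.

Lemma frob_dot_cols m q (X Y : 'M[R]_(m, q)) :
  dot X Y = \sum_j dot (col j X) (col j Y).
Proof.
rewrite /frob_dot exchange_big; apply: eq_bigr => i _; apply: eq_bigr => j _.
by rewrite big_ord1 !mxE.
Qed.

Lemma frob_dot_row_mx m q s (X X' : 'M[R]_(m, q)) (Y Y' : 'M[R]_(m, s)) :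
  dot (row_mx X Y) (row_mx X' Y') = dot X X' + dot Y Y'.
Proof.
rewrite /frob_dot -big_split; apply: eq_bigr => i _.
rewrite big_split_ord; congr (_ + _); apply: eq_bigr => j _.
  by rewrite !row_mxEl.
by rewrite !row_mxEr.
Qed.

Lemma frob_norm_row_le m q (X : 'M[R]_(m, q)) i : nrm (row i X) <= nrm X.
Proof.
apply: frob_norm_le; first exact: frob_norm_ge0.
rewrite sqr_frob_norm_rows (bigD1 i) //= sqr_frob_norm lerDl.
by apply: sumr_ge0 => j _; rewrite sqr_ge0.
Qed.

Lemma frob_norm_entry_le m q (X : 'M[R]_(m, q)) i j : `|X i j| <= nrm X.
Proof.
apply: le_trans (frob_norm_row_le X i).
rewrite -(ler_pXn2r (_ : 0 < 2)%N) ?nnegrE ?frob_norm_ge0 // sqr_frob_norm.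
rewrite /frob_dot big_ord1 (bigD1 j) //= !mxE real_normK ?num_real // -expr2 lerDl.
by apply: sumr_ge0 => l _; rewrite -expr2 sqr_ge0.
Qed.

Lemma mulmx_entry_dot m q s (X : 'M[R]_(m, q)) (Y : 'M[R]_(q, s)) i j :
  (X *m Y) i j = dot (row i X)^T (col j Y).
Proof.
rewrite mxE /frob_dot; apply: eq_bigr => l _.
by rewrite big_ord1 !mxE.
Qed.

Lemma frob_norm_mulmx m q s (X : 'M[R]_(m, q)) (Y : 'M[R]_(q, s)) :
  nrm (X *m Y) <= nrm X * nrm Y.
Proof.
apply: frob_norm_le; first by rewrite mulr_ge0 ?frob_norm_ge0.
rewrite exprMn [nrm X ^+ 2]sqr_frob_norm_rows -(frob_norm_tr Y) [nrm Y^T ^+ 2]sqr_frob_norm_rows.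
rewrite mulr_suml /frob_dot; apply: ler_sum => i _; rewrite mulr_sumr.
apply: ler_sum => j _; rewrite -expr2 mulmx_entry_dot -tr_col frob_norm_tr.
rewrite -exprMn -[X in X <= _]real_normK ?num_real // ler_pXn2r ?nnegrE ?mulr_ge0 ?frob_norm_ge0 //.
by rewrite -(frob_norm_tr (row i X)) frob_cauchy_schwarz.
Qed.

Lemma frob_norm_sum (I : finType) (P : pred I) m q (F : I -> 'M[R]_(m, q)) :
  nrm (\sum_(i | P i) F i) <= \sum_(i | P i) nrm (F i).
Proof.
elim/big_ind2: _ => [|X x Y y hx hy|//]; first by rewrite frob_norm0.
by apply: le_trans (frob_normD _ _) _; rewrite lerD.
Qed.

Lemma sum_cauchy_schwarz (I : finType) (x y : I -> R) :
  (\sum_i x i * y i) ^+ 2 <= (\sum_i x i ^+ 2) * (\sum_i y i ^+ 2).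
Proof.
pose u := \col_(i < #|I|) x (enum_val i); pose v := \col_(i < #|I|) y (enum_val i).
have e (a b : I -> R) : \sum_i a i * b i =
    dot (\col_(i < #|I|) a (enum_val i)) (\col_(i < #|I|) b (enum_val i)).
  rewrite /frob_dot (reindex (fun i : 'I_#|I| => enum_val i)) /=; last first.
    by apply: onW_bij; exact: enum_val_bij.
  by apply: eq_bigr => i _; rewrite big_ord1 !mxE.
rewrite e; under [X in _ <= X * _]eq_bigr do rewrite expr2.
under [X in _ <= _ * X]eq_bigr do rewrite expr2.
rewrite !e -!sqr_frob_norm -exprMn -[X in X <= _]real_normK ?num_real //.
by rewrite ler_pXn2r ?nnegrE ?mulr_ge0 ?frob_norm_ge0 ?frob_cauchy_schwarz.
Qed.

Lemma sum_sqr_cauchy_schwarz n (x : 'I_n -> R) :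
  (\sum_i x i) ^+ 2 <= n%:R * \sum_i x i ^+ 2.
Proof.
have := sum_cauchy_schwarz (fun _ : 'I_n => 1) x.
under eq_bigr do rewrite mul1r.
by under [X in _ <= X * _ -> _]eq_bigr do rewrite expr1n; rewrite sumr_const card_ord.
Qed.

End FrobeniusNorm.

(** * Extreme values over the orthogonal group and over the unit sphere *)

Section Compactness.
Context {R : realType}.
Local Notation dot := frob_dot.
Local Notation nrm := frob_norm.

Lemma continuous_sum_real (T : topologicalType) (I : Type) (r : seq I) (P : pred I)
    (F : I -> T -> R) :
  (forall i, continuous (F i)) -> continuous (fun x => \sum_(i <- r | P i) F i x).
Proof.
move=> cF; elim: r => [|a r ih] x.
  under eq_fun do rewrite big_nil; exact: cvg_cst.
under eq_fun do rewrite big_cons.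
case: (P a) => //; last exact: ih.
by apply: cvgD; [exact: cF|exact: ih].
Qed.

Lemma continuous_mul_real (T : topologicalType) (f g : T -> R) :
  continuous f -> continuous g -> continuous (fun x => f x * g x).
Proof. by move=> cf cg x; apply: cvgM; [exact: cf|exact: cg]. Qed.

Lemma continuous_coord_rV n (i : 'I_1) (j : 'I_n) : continuous (fun v : 'rV[R]_n => v i j).
Proof. exact: coord_continuous. Qed.

Lemma continuous_cst_real (T : topologicalType) (a : R) : continuous (fun _ : T => a).
Proof. by move=> x; exact: cvg_cst. Qed.

(** The constraint set is an intersection of closed level sets inside a box, hence compact. Row
    vectors serve here as flattened matrices. *)
Lemma constrained_min_rV n (I : Type) (g : I -> 'rV[R]_n -> R) (c : I -> R) (B : R)
    (f : 'rV[R]_n -> R) (v0 : 'rV[R]_n) :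
  (forall i, continuous (g i)) -> continuous f ->
  (forall v, (forall i, g i v = c i) -> forall j, `|v 0 j| <= B) ->
  (forall i, g i v0 = c i) ->
  exists2 v, (forall i, g i v = c i) &
    forall v', (forall i, g i v' = c i) -> f v <= f v'.
Proof.
move=> cg cf hB h0; pose K := [set v | forall i, g i v = c i].
have [|||v Kv hv] := @EVT_min_rV R n f K.
- by exists v0.
- apply: bounded_closed_compact.
    exists `|B|; split; first exact: num_real.
    move=> x Bx v Kv /=; rewrite /Num.norm /= mx_normrE; apply/bigmax_leP.
    split=> [|[i j] _ /=]; first exact: le_trans (ltW Bx).
    by rewrite ord1; apply: le_trans (hB _ Kv _) (le_trans (ler_norm _) (ltW Bx)).
  have -> : K = \bigcap_i (g i @^-1` [set x | x = c i]).
    by apply/seteqP; split=> [v Kv i _ /=|v Kv i]; [exact: Kv|by have := Kv i Logic.I].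
  apply: closed_bigI => i _; apply: preimage_closed; last exact: closed_eq.
  by move=> x _; exact: cg.
- by apply: continuous_subspaceT.
- by exists v => [|v' Kv']; [move: Kv; rewrite inE|apply: hv; rewrite inE].
Qed.

Lemma entry_le_of_sqr_sum (I : finType) (x : I -> R) i : \sum_i x i ^+ 2 <= 1 -> `|x i| <= 1.
Proof.
rewrite (bigD1 i) //= => h; rewrite -(ler_pXn2r (_ : 0 < 2)%N) ?nnegrE //.
rewrite expr1n real_normK ?num_real //; apply: le_trans h; rewrite lerDl.
by apply: sumr_ge0 => j _; rewrite sqr_ge0.
Qed.

(** The equations Q^T Q = 1 are polynomial in the entries, and unit columns bound every entry by 1,
    so the maximum over O(k) is attained. *)
Lemma orthogonal_dot_max k (B : 'M[R]_k) :
  exists2 Q, orthogonal_mx Q & forall Q', orthogonal_mx Q' -> dot B Q' <= dot B Q.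
Proof.
pose g (ij : 'I_k * 'I_k) (v : 'rV[R]_(k * k)) :=
  \sum_l v 0 (mxvec_index l ij.1) * v 0 (mxvec_index l ij.2).
pose f (v : 'rV[R]_(k * k)) := \sum_i \sum_j - B i j * v 0 (mxvec_index i j).
have gE v : orthogonal_mx (vec_mx v) <-> forall ij, g ij v = (1%:M : 'M[R]_k) ij.1 ij.2.
  split=> [h ij|h]; [rewrite -h|apply/matrixP => i j; rewrite -(h (i, j))]; rewrite mxE;
  by apply: eq_bigr => l _; rewrite !mxE.
have fE v : f v = - dot B (vec_mx v).
  rewrite /f /frob_dot -sumrN; apply: eq_bigr => i _; rewrite -sumrN.
  by apply: eq_bigr => j _; rewrite !mxE mulNr.
have [||||v hv hmin] := @constrained_min_rV (k * k) _ g
    (fun ij => (1%:M : 'M[R]_k) ij.1 ij.2) 1 f (mxvec 1%:M).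
- by move=> ij; apply: continuous_sum_real => l; apply: continuous_mul_real; exact: continuous_coord_rV.
- apply: continuous_sum_real => i; apply: continuous_sum_real => j.
  by apply: continuous_mul_real; [exact: continuous_cst_real|exact: continuous_coord_rV].
- move=> v hv j; case/mxvec_indexP: j => i j.
  apply: (@entry_le_of_sqr_sum _ (fun l => v 0 (mxvec_index l j)) i).
  apply: (@le_trans _ _ (g (j, j) v)); last by rewrite hv mxE eqxx.
  by apply: ler_sum => l _; rewrite expr2.
- by apply/gE; rewrite mxvecK /orthogonal_mx /= trmx1 mul1mx.
exists (vec_mx v); first exact/gE.
move=> Q hQ; rewrite -(mxvecK Q) -lerN2 -!fE; apply: hmin.
by apply/gE; rewrite mxvecK.
Qed.

Lemma sphere_min k (M : 'M[R]_k) : (0 < k)%N ->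
  exists2 u : 'rV[R]_k, dot u u = 1 &
    forall v : 'rV[R]_k, dot v v = 1 -> dot (u *m M) u <= dot (v *m M) v.
Proof.
move=> k0; have [||||u hu hmin] := @constrained_min_rV k unit
    (fun=> fun v => dot v v) (fun=> 1) 1 (fun v => dot (v *m M) v) (delta_mx 0 (Ordinal k0)).
- by move=> _; do 2![apply: continuous_sum_real => ?]; apply: continuous_mul_real; exact: continuous_coord_rV.
- do 2![apply: continuous_sum_real => ?]; apply: continuous_mul_real; last exact: continuous_coord_rV.
  under eq_fun do rewrite mxE.
  apply: continuous_sum_real => l.
  by apply: continuous_mul_real; [exact: continuous_coord_rV|exact: continuous_cst_real].
- move=> v /(_ tt) hv j; apply: (@entry_le_of_sqr_sum _ (fun l => v 0 l) j).
  apply: (@le_trans _ _ (dot v v)); last by rewrite hv.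
  by rewrite /frob_dot big_ord1; apply: ler_sum => l _; rewrite expr2.
- move=> _; rewrite /frob_dot big_ord1 (bigD1 (Ordinal k0)) //= !mxE !eqxx mulr1.
  by rewrite big1 ?addr0 // => j /negbTE hj; rewrite !mxE hj mulr0.
by exists u => [|v hv]; [exact: (hu tt)|exact: (hmin v (fun=> hv))].
Qed.
End Compactness.

(** * Procrustes alignment and differences of Gram matrices *)

Section Procrustes.
Context {R : realType}.
Local Notation dot := frob_dot.
Local Notation nrm := frob_norm.

(** First-order optimality in algebraic form; the test value is t = x / (|y| + 1). *)
Lemma linear_le_quadratic_eq0 (x y : R) : (forall t, t * x <= t ^+ 2 * y) -> x = 0.
Proof.
move=> h; pose c := `|y| + 1.
have c0 : 0 < c by rewrite ltr_wpDl.
have yc : y + 1 <= c by rewrite lerD2r ler_norm.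
have := h (x / c); rewrite expr_div_n mulrAC ler_pdivrMr // => h1.
have : x * x <= x ^+ 2 * (y / c).
  apply: le_trans h1 _; rewrite le_eqVlt; apply/orP; left; apply/eqP; field.
  exact: lt0r_neq0.
rewrite -expr2 -subr_ge0 -[X in _ - X]mulr1 -mulrBr => h2.
have : y / c - 1 < 0 by rewrite subr_lt0 ltr_pdivrMr // mul1r; lra.
move=> h3; apply/eqP; rewrite -sqrf_eq0 eq_le sqr_ge0 andbT.
by rewrite -(ler_nM2r h3) mul0r.
Qed.

(** A minimiser u of the quadratic form on the unit sphere is an eigenvector of M, with eigenvalue s
    >= 0. Then s^2 is an eigenvalue of M^T M, so s belongs to the set whose infimum is [sigma_min],
    and m <= s. *)
Lemma sigma_min_quad k (M : 'M[R]_k) (m : R) : (0 < k)%N ->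
  M^T = M -> (forall v : 'rV_k, 0 <= dot (v *m M) v) -> m <= sigma_min M ->
  forall v : 'rV_k, m * dot v v <= dot (v *m M) v.
Proof.
move=> k0 symM psd hm; have [u hu umin] := sphere_min M k0.
set s := dot (u *m M) u in umin.
have low (v : 'rV[R]_k) : s * dot v v <= dot (v *m M) v.
  have [v0|vn0] := eqVneq (dot v v) 0.
    by rewrite (frob_dot_eq0 v0) mul0mx frob_dot0l mulr0.
  have vp : 0 < nrm v.
    rewrite lt_neqAle frob_norm_ge0 andbT eq_sym; apply: contraNneq vn0 => h.
    by rewrite -sqr_frob_norm h expr0n.
  have := umin ((nrm v)^-1 *: v); rewrite -scalemxAl !frob_dotE -sqr_frob_norm.
  move=> /(_ _)/wrap[]; first by field; exact: lt0r_neq0.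
  by rewrite mulrA -invfM mulrC ler_pdivlMr ?mulr_gt0 // expr2.
pose N := M - s%:M.
have dN (v w : 'rV[R]_k) : dot (v *m N) w = dot (v *m M) w - s * dot v w.
  by rewrite mulmxBr mul_mx_scalar !frob_dotE.
(* The form of N is nonnegative and vanishes at u; perturbing u along u N shows that u N itself
   vanishes. *)
have uN : u *m N = 0.
  apply: frob_dot_eq0; set w := u *m N.
  apply: (@linear_le_quadratic_eq0 _ (dot (w *m N) w / 2)) => t.
  have := low (u - t *: w); rewrite -subr_ge0 -dN.
  rewrite !(mulmxBl, mulmxN, mulmxDl, mulNmx) -!scalemxAl !frob_dotE.
  have symN : N^T = N by rewrite /N linearB /= tr_scalar_mx symM.
  have -> : dot (w *m N) u = dot w w by rewrite frob_dot_mulmxr symN.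
  have wu : dot w u = 0 by rewrite /w dN hu -/s mulr1 subrr.
  by rewrite -/w wu; nra.
have uM : u *m M = s *: u.
  by move: uN; rewrite mulmxBr mul_mx_scalar => /eqP; rewrite subr_eq0 => /eqP.
have s0 : 0 <= s by exact: psd.
suff ms : m <= s by move=> v; apply: le_trans (low v); rewrite ler_wpM2r ?frob_dot_ge0.
apply: le_trans hm _; apply: inf_lbound; first by exists 0 => x [].
split => //; apply/eigenvalueP; exists u.
  by rewrite mulmxA symM uM -scalemxAl uM scalerA expr2.
by apply: contra_eq_neq hu => ->; rewrite frob_dot0l eq_sym oner_neq0.
Qed.

(** The Householder reflection; reflections and products of two of them are the competitors in the
    Procrustes problem. *)
Definition reflection k (w : 'rV[R]_k) : 'M[R]_k := 1%:M - (2 / dot w w) *: (w^T *m w).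

Lemma row_mul_tr k (w v : 'rV[R]_k) : w *m v^T = (dot w v)%:M.
Proof.
apply/matrixP => i j; rewrite !ord1 !mxE /frob_dot big_ord1 mulr1n.
by apply: eq_bigr => l _; rewrite mxE.
Qed.

Lemma reflection_orthogonal k (w : 'rV[R]_k) : dot w w != 0 -> orthogonal_mx (reflection w).
Proof.
move=> w0; rewrite /orthogonal_mx /=; set c := 2 / dot w w.
have symH : (reflection w)^T = reflection w.
  apply/matrixP => i j; rewrite !mxE eq_sym; congr (_ - _ * _).
  by apply: eq_bigr => l _; rewrite !mxE mulrC.
have ww : w^T *m w *m (w^T *m w) = dot w w *: (w^T *m w).
  by rewrite mulmxA -(mulmxA _ w w^T) row_mul_tr mul_mx_scalar -scalemxAl.
rewrite symH /reflection -/c mulmxBl mul1mx mulmxBr mulmx1 -!scalemxAl -!scalemxAr ww !scalerA.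
have -> : c * c * dot w w = c + c by rewrite /c; field.
by rewrite scalerDl opprB addrK subrK.
Qed.

Lemma orthogonal_mul k (Q O : 'M[R]_k) :
  orthogonal_mx Q -> orthogonal_mx O -> orthogonal_mx (Q *m O).
Proof.
rewrite /orthogonal_mx /= => hQ hO.
by rewrite trmx_mul mulmxA -(mulmxA O^T) hQ mulmx1.
Qed.

Lemma orthogonal_tr k (Q : 'M[R]_k) : orthogonal_mx Q -> orthogonal_mx Q^T.
Proof. by rewrite /orthogonal_mx /= trmxK => /mulmx1C. Qed.

Lemma orthogonal1 k : orthogonal_mx (1%:M : 'M[R]_k).
Proof. by rewrite /orthogonal_mx /= trmx1 mulmx1. Qed.

Lemma frob_dot_orthogonal n k (Z W : 'M[R]_(n, k)) Q :
  orthogonal_mx Q -> dot (Z *m Q) (W *m Q) = dot Z W.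
Proof.
move=> /orthogonal_tr; rewrite /orthogonal_mx /= trmxK => hQ.
by rewrite frob_dot_mulmxr -mulmxA hQ mulmx1.
Qed.

Lemma frob_norm_orthogonal n k (Z : 'M[R]_(n, k)) Q : orthogonal_mx Q -> nrm (Z *m Q) = nrm Z.
Proof. by move=> hQ; rewrite /frob_norm frob_dot_orthogonal. Qed.

(** Minimising the distance is maximising the pairing of W^T Z with Q, so tr (P O) <= tr P for P =
    Z^T W Q and every orthogonal O. A reflection O gives nonnegativity of the form of P; a rotation
    of a coordinate plane, expanded to first order in its angle, gives the symmetry of P. *)
Lemma procrustes n k (Z W : 'M[R]_(n, k)) :
  exists Q, [/\ orthogonal_mx Q, (Z^T *m (W *m Q))^T = Z^T *m (W *m Q),
    forall v : 'rV_k, 0 <= dot (v *m (Z^T *m (W *m Q))) v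
  & forall Q', orthogonal_mx Q' -> nrm (Z - W *m Q) <= nrm (Z - W *m Q')].
Proof.
have [Q hQ Qmax] := orthogonal_dot_max (W^T *m Z); exists Q.
set P := Z^T *m (W *m Q).
have trP O : orthogonal_mx O -> \tr (P *m O) <= \tr P.
  move=> hO; have := Qmax _ (orthogonal_mul hQ hO).
  by rewrite !frob_dot_mulmxl trmxK !frob_dot_trace /P !mulmxA.
have trE (x y : 'rV[R]_k) : \tr (P *m (x^T *m y)) = dot (y *m P) x.
  by rewrite mulmxA mxtrace_mulC frob_dotC frob_dot_trace [RHS]mxtrace_mulC mulmxA.
have psd (v : 'rV[R]_k) : 0 <= dot (v *m P) v.
  have [v0|vn0] := eqVneq (dot v v) 0.
    by rewrite (frob_dot_eq0 v0) mul0mx frob_dot0l.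
  have := trP _ (reflection_orthogonal vn0).
  rewrite /reflection mulmxBr mulmx1 -scalemxAr linearB /= linearZ /= trE gerBl.
  by rewrite pmulr_rge0 // divr_gt0 // lt_neqAle eq_sym vn0 frob_dot_ge0.
split=> //; last first.
  move=> Q' hQ'; apply: frob_norm_le; first exact: frob_norm_ge0.
  rewrite sqr_frob_norm !frob_dotE !(frob_dotC (W *m _) Z).
  rewrite !frob_dot_orthogonal //.
  have := Qmax _ hQ'; rewrite !frob_dot_mulmxl trmxK => h.
  by rewrite !(frob_dotC Z) in h *; move: h; rewrite !(frob_dotC _ Z) !opprK; lra.
apply/matrixP => i j; rewrite mxE.
have [->//|ij] := eqVneq i j.
pose a : 'rV[R]_k := delta_mx 0 i; pose b : 'rV[R]_k := delta_mx 0 j.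
have dd (x y : 'I_k) : dot (delta_mx 0 x) (delta_mx 0 y : 'rV[R]_k) = (x == y)%:R.
  rewrite /frob_dot big_ord1 (bigD1 x) //= !mxE !eqxx mul1r big1 ?addr0 // => l lx.
  by rewrite !mxE (negbTE lx) andbF mul0r.
have entry (x y : 'I_k) : dot (delta_mx 0 x *m P) (delta_mx 0 y : 'rV[R]_k) = P x y.
  rewrite -rowE /frob_dot big_ord1 (bigD1 y) //= [X in _ + X]big1 => [|l ly].
    by rewrite !mxE !eqxx mulr1 addr0.
  by rewrite !mxE (negbTE ly) andbF mulr0.
apply/eqP; rewrite -subr_eq0; apply/eqP.
apply: (@linear_le_quadratic_eq0 _ (P i i + P j j)) => t.
(* The product of the reflections along e_i and along e_i + t e_j is a rotation in the plane of e_i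
   and e_j; the linear term in t is a multiple of P_ji - P_ij. *)
pose w := a + t *: b.
have ww : dot w w = 1 + t ^+ 2.
  rewrite /w !frob_dotE !dd !eqxx (eq_sym j i) (negbTE ij) /=; ring.
have wp : 0 < 1 + t ^+ 2 by rewrite ltr_wpDr // sqr_ge0.
have wn0 : dot w w != 0 by rewrite ww lt0r_neq0.
have an0 : dot a a != 0 by rewrite dd eqxx oner_neq0.
have := trP _ (orthogonal_mul (reflection_orthogonal an0) (reflection_orthogonal wn0)).
rewrite /reflection mulmxBl mul1mx [_ *m (1%:M - _)]mulmxBr mulmx1 -!scalemxAl -!scalemxAr.
rewrite mulmxA -(mulmxA _ a w^T) row_mul_tr mul_mx_scalar -scalemxAl !scalerA.
rewrite !mulmxBr mulmx1 -!scalemxAr !linearB /= !linearZ /= !trE.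
rewrite ww !dd eqxx divr1 /w !mulmxDl -!scalemxAl !frob_dotE -/a -/b !dd !entry eqxx (negbTE ij).
move=> h; suff : (t * (P j i - P i j) - t ^+ 2 * (P i i + P j j)) * (2 / (1 + t ^+ 2)) <= 0.
  by rewrite pmulr_lle0 ?subr_le0 // divr_gt0.
rewrite -(lerD2l (\tr P)) addr0; apply: le_trans h.
by rewrite le_eqVlt; apply/orP; left; apply/eqP; rewrite /GRing.scale /=; field; rewrite lt0r_neq0.
Qed.

(** With D = Z - W, G = D^T D, S = W^T D (symmetric by alignment) and B = W^T W, the right-hand side
    expands to |G|^2 + 2|S|^2 + 2<G, B> + 4<G, S>. Alignment gives <G, S + B> >= 0, and the
    hypothesis on W gives <G, B> >= s |D|^2. *)
Lemma gram_lower n k (Z W : 'M[R]_(n, k)) (s : R) :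
  (Z^T *m W)^T = Z^T *m W -> (forall v : 'rV_k, 0 <= dot (v *m (Z^T *m W)) v) ->
  (forall v : 'rV_k, s * dot v v <= dot (v *m W^T) (v *m W^T)) ->
  s / 2 * nrm (Z - W) ^+ 2 <= nrm (Z *m Z^T - W *m W^T) ^+ 2.
Proof.
move=> symP psd hs; pose D := Z - W; pose G := D^T *m D; pose S := W^T *m D.
pose B := W^T *m W.
have symS : S^T = S.
  have e : S = Z^T *m W - B by rewrite /S /D mulmxBr -symP trmx_mul trmxK.
  by rewrite e linearB /= symP /B trmx_mul trmxK.
have -> : Z *m Z^T - W *m W^T = D *m D^T + D *m W^T + W *m D^T.
  by rewrite -mulmxDr /D linearB /= subrK mulmxBl mulmxBr addrA subrK.
have GP : 0 <= dot G (S + B).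
  have -> : S + B = Z^T *m W by rewrite -mulmxDr subrK -symP trmx_mul trmxK.
  rewrite /G frob_dot_mulmxl trmxK frob_dotC frob_dot_rows.
  by apply: sumr_ge0 => i _; rewrite row_mul.
have GB : s * nrm D ^+ 2 <= dot G B.
  rewrite /G frob_dot_mulmxl trmxK frob_dotC mulmxA frob_dot_mulmxr.
  rewrite sqr_frob_norm frob_dot_rows mulr_sumr [leRHS]frob_dot_rows.
  by apply: ler_sum => i _; rewrite !row_mul.
have e1 : dot (D *m D^T) (D *m D^T) = dot G G.
  by rewrite frob_dot_mulmxr trmxK -mulmxA -/G frob_dotC frob_dot_mulmxl [LHS]frob_dotC /G frob_dot_mulmxl trmxK.
have e2 : dot (D *m W^T) (D *m W^T) = dot G B.
  by rewrite frob_dot_mulmxr trmxK -mulmxA -/B /G frob_dot_mulmxl trmxK.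
have e3 : dot (W *m D^T) (W *m D^T) = dot G B.
  by rewrite -e2 -[RHS]frob_dot_tr !trmx_mul !trmxK.
have e4 : dot (D *m W^T) (W *m D^T) = dot S S.
  rewrite frob_dot_mulmxr trmxK -mulmxA -[D^T *m W]trmxK trmx_mul trmxK -/S symS.
  by rewrite [in RHS]frob_dot_mulmxl trmxK.
have e5 : dot (D *m D^T) (D *m W^T) = dot G S.
  rewrite frob_dot_mulmxr trmxK -mulmxA -/S /G frob_dot_mulmxl trmxK; done.
have e6 : dot (D *m D^T) (W *m D^T) = dot G S.
  by rewrite frob_dot_mulmxr trmxK -mulmxA -/G [RHS]frob_dotC /S frob_dot_mulmxl trmxK.
rewrite [leRHS]sqr_frob_norm !frob_dotE e1 e2 e3 e5 e6.
rewrite (frob_dotC (W *m D^T) (D *m W^T)) (frob_dotC (D *m W^T) (D *m D^T)).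
rewrite (frob_dotC (W *m D^T) (D *m D^T)) e4 e5 e6.
(* Subtracting this square from the expansion leaves 7/16 |S|^2 + 3/2 <G, S + B> + 1/2 <G, B>, whose
   last term is the claimed bound. *)
have h1 := frob_dot_ge0 (G + (5 / 4) *: S).
have h2 := frob_dot_ge0 S.
rewrite !frob_dotE (frob_dotC S G) in h1; rewrite frob_dotDr in GP.
by rewrite -/D; lra.
Qed.

End Procrustes.

(** * Concavity bounds for the log-likelihood of one edge *)

Section ScalarCurvature.
Context {R : realType}.

Lemma mean_value (f f1 : R -> R) (x y : R) : (forall t : R, is_derive t 1 f (f1 t)) ->
  exists c, [/\ (x <= c <= y) || (y <= c <= x) & f y - f x = f1 c * (y - x)].
Proof.
move=> df; have cf (a b : R) : {within `[a, b], continuous f}.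
  by apply: derivable_within_continuous => t _; have [] := df t.
have [xy|yx] := leP x y.
  have [c hc e] := MVT_segment xy (fun t _ => df t) (cf x y).
  by exists c; rewrite in_itv /= in hc; rewrite hc.
have [c hc e] := MVT_segment (ltW yx) (fun t _ => df t) (cf y x).
exists c; rewrite in_itv /= in hc; rewrite hc orbT; split=> //.
by rewrite -opprB e; ring.
Qed.

(** What is used later of k1 <= -f'' <= k2 on [-b, b], with f1 in the place of f': the two quadratic
    bounds, strong monotonicity, and the Lipschitz bound on f1. *)
Definition curvature_bounds (f f1 : R -> R) (b k1 k2 : R) : Prop :=
  forall x y : R, - b <= x <= b -> - b <= y <= b ->
  [/\ f y <= f x + f1 x * (y - x) - k1 / 2 * (y - x) ^+ 2,
      f x + f1 x * (y - x) - k2 / 2 * (y - x) ^+ 2 <= f y,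
      k1 * (y - x) ^+ 2 <= (f1 x - f1 y) * (y - x)
    & `|f1 x - f1 y| <= k2 * `|x - y| ].

Lemma second_derivative_curvature (f f1 f2 : R -> R) (b k1 k2 : R) :
  (forall t : R, is_derive t 1 f (f1 t)) -> (forall t : R, is_derive t 1 f1 (f2 t)) ->
  (forall t : R, - b <= t <= b -> k1 <= - f2 t <= k2) -> 0 <= k1 -> curvature_bounds f f1 b k1 k2.
Proof.
move=> df df1 hf2 k10 x y hx hy.
have inb (c : R) : (x <= c <= y) || (y <= c <= x) -> - b <= c <= b by lra.
have mono (u v : R) : - b <= u <= b -> - b <= v <= b ->
    k1 * (v - u) ^+ 2 <= (f1 u - f1 v) * (v - u) <= k2 * (v - u) ^+ 2.
  move=> hu hv; have [c [hc e]] := mean_value u v df1.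
  have /andP[h1 h2] := hf2 c ltac:(lra).
  rewrite -(opprB (f1 v)) e; have := sqr_ge0 (v - u); nra.
have quad (k : R) : exists c, ((x <= c <= y) || (y <= c <= x)) /\
    f y - f x - f1 x * (y - x) + k / 2 * (y - x) ^+ 2 =
    (f1 c - f1 x + k * (c - x)) * (y - x).
  (* The error of the quadratic expansion is an increment of g; the mean value theorem for g, then
     monotonicity of f1 between x and the intermediate point, fixes its sign. *)
  pose g (t : R) := f t - f1 x * t + k / 2 * (t - x) ^+ 2.
  have dg (t : R) : is_derive t 1 g (f1 t - f1 x + k * (t - x)).
    rewrite /g; have dft := df t.
    apply: is_derive_eq.
    by rewrite /GRing.scale /=; field.
  have [c [hc e]] := mean_value x y dg.
  exists c; split=> //; rewrite -e /g; ring.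
split.
- have [c [hc e]] := quad k1.
  have /andP[h1 _] := mono x c hx (inb c hc).
  suff : (f1 c - f1 x + k1 * (c - x)) * (y - x) <= 0 by lra.
  have [-> |cx] := eqVneq c x; first by rewrite !subrr mulr0 addr0 mul0r.
  have : (f1 c - f1 x + k1 * (c - x)) * (c - x) <= 0 by nra.
  case/orP: hc => /andP[a1 a2].
    have cx' : x < c by rewrite lt_neqAle eq_sym cx.
    by rewrite pmulr_lle0 ?subr_gt0 // => h; apply: mulr_le0_ge0 => //; lra.
  have cx' : c < x by rewrite lt_neqAle cx.
  by rewrite nmulr_lle0 ?subr_lt0 // => h; apply: mulr_ge0_le0 => //; lra.
- have [c [hc e]] := quad k2.
  have /andP[_ h1] := mono x c hx (inb c hc).
  suff : 0 <= (f1 c - f1 x + k2 * (c - x)) * (y - x) by lra.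
  have [-> |cx] := eqVneq c x; first by rewrite !subrr mulr0 addr0 mul0r.
  have : 0 <= (f1 c - f1 x + k2 * (c - x)) * (c - x) by nra.
  case/orP: hc => /andP[a1 a2].
    have cx' : x < c by rewrite lt_neqAle eq_sym cx.
    by rewrite pmulr_lge0 ?subr_gt0 // => h; apply: mulr_ge0 => //; lra.
  have cx' : c < x by rewrite lt_neqAle cx.
  by rewrite nmulr_lge0 ?subr_lt0 // => h; apply: mulr_le0 => //; lra.
- by have /andP[] := mono x y hx hy.
- have [c [hc e]] := mean_value x y df1.
  have /andP[h1 h2] := hf2 c (inb c hc).
  rewrite distrC e normrM (distrC y) ler_wpM2r //.
  by rewrite ler_norml; apply/andP; split; have := hf2 c (inb c hc); lra.
Qed.

(** Choice turns the curvature constants into functions of the radius b, since several radii are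
    used below. *)
Lemma loglik_curvature (p : R -> R -> R) (X : set R) : loglik_regular p X ->
  exists K1 K2 : R -> R, forall b, 0 < b -> [/\ 0 < K1 b, 0 < K2 b &
    forall x, X x -> curvature_bounds (loglik p ^~ x) (dloglik p 1 ^~ x) b (K1 b) (K2 b)].
Proof.
move=> [hd hk].
have hb b : exists k : R * R, 0 < b -> [/\ 0 < k.1, 0 < k.2 &
    forall x, X x -> curvature_bounds (loglik p ^~ x) (dloglik p 1 ^~ x) b k.1 k.2].
  have [b0|bN] := pselect (0 < b); last by exists (0, 0) => /bN.
  have [k1 [k2 [k3 [k10 k20 _ h]]]] := hk b b0.
  exists (k1, k2) => _; split=> // x Xx.
  have isd m (t : R) : (m < 3)%N -> is_derive t 1 (dloglik p m ^~ x) (dloglik p m.+1 t x).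
    move=> m3; rewrite [dloglik p m.+1 t x]derive1E; apply: derivableP.
    exact: hd.
  have isd0 (t : R) : is_derive t 1 (loglik p ^~ x) (dloglik p 1 t x) by exact: (isd 0%N).
  have isd1 (t : R) : is_derive t 1 (dloglik p 1 ^~ x) (dloglik p 2 t x) by exact: (isd 1%N).
  apply: (second_derivative_curvature isd0 isd1) => [t ht|]; last exact: ltW.
  by have [] := h t x ht Xx.
have [K hK] := choice hb.
exists (fun b => (K b).1), (fun b => (K b).2) => b b0.
exact: hK.
Qed.

End ScalarCurvature.

(** * Integrals of a function of a random variable against a weight *)

Section SimpleApproximation.
Local Open Scope ereal_scope.
Context d1 d2 (T1 : measurableType d1) (T2 : measurableType d2) d (Y : measurableType d)
  (R : realType).
Import HBNNSimple.

Lemma measurable_nnsfun_fiber (f : {nnsfun Y >-> R}) k : measurable (f @^-1` [set k]).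
Proof. by []. Qed.

Lemma weighted_simple_integral (m : {measure set T1 -> \bar R}) (X : T1 -> Y) (G : T1 -> R)
    (f : {nnsfun Y >-> R}) :
  measurable_fun setT X -> measurable_fun setT G -> (forall t, 0 <= G t)%R ->
  \int[m]_t (f (X t) * G t)%:E =
  \sum_(k \in range f) k%:E * \int[m]_t (\1_(f @^-1` [set k]) (X t) * G t)%:E.
Proof.
move=> mX mG G0.
have mI k : measurable_fun setT (fun t => \1_(f @^-1` [set k]) (X t) * G t)%R.
  apply: measurable_funM => //; apply: measurableT_comp mX.
  exact: measurable_indic.
have -> : (fun t => (f (X t) * G t)%:E) =
    (fun t => \sum_(k \in range f) (k * (\1_(f @^-1` [set k]) (X t) * G t))%:E).
  apply/funext => t; rewrite fsumEFin //; congr (_%:E); rewrite fimfunE.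
  rewrite !fsbig_finite //= big_distrl /=; apply: eq_bigr => k _; by rewrite mulrA.
rewrite ge0_integral_fsum //.
- apply: eq_fsbigr => k; rewrite inE => -[y _ <-].
  rewrite -ge0_integralZl_EFin //.
    by move=> t _; rewrite lee_fin mulr_ge0.
  exact/measurable_EFinP.
- by move=> k; apply/measurable_EFinP; apply: measurable_funM.
- move=> k t _; rewrite lee_fin mulrA mulr_ge0 // -lee_fin EFinM.
  exact: nnfun_muleindic_ge0.
Qed.

Lemma weighted_integral_limit (m : {measure set T1 -> \bar R}) (X : T1 -> Y) (G : T1 -> R)
    (f : Y -> R) (mf : measurable_fun setT (EFin \o f)) :
  measurable_fun setT X -> measurable_fun setT G -> (forall t, 0 <= G t)%R ->
  (forall y, 0 <= f y)%R ->
  \int[m]_t (f (X t) * G t)%:E =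
  limn (fun n => \int[m]_t (nnsfun_approx measurableT mf n (X t) * G t)%:E).
Proof.
move=> mX mG G0 f0; rewrite -monotone_convergence //.
- apply: eq_integral => t _; apply/esym/cvg_lim => //.
  under eq_fun do rewrite mulrC EFinM; rewrite mulrC EFinM.
  apply: cvgeZl => //; apply: (cvg_nnsfun_approx measurableT mf) => // y _.
  by rewrite lee_fin.
- move=> n; apply/measurable_EFinP; apply: measurable_funM => //.
  exact: measurableT_comp.
- by move=> n t _; rewrite lee_fin mulr_ge0.
- move=> t _ a b ab; rewrite lee_fin ler_wpM2r //.
  exact/lefP/nd_nnsfun_approx.
Qed.

End SimpleApproximation.

(** Two weighted laws that agree on measurable sets agree on nonnegative functions, by simple
    functions and monotone convergence. It serves both to integrate against the density of an edge
    and to peel off one independent factor. *)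
Lemma weighted_integral_ext d1 d2 (T1 : measurableType d1) (T2 : measurableType d2)
    d (Y : measurableType d) (R : realType)
    (m1 : {measure set T1 -> \bar R}) (m2 : {measure set T2 -> \bar R})
    (X1 : T1 -> Y) (X2 : T2 -> Y) (G1 : T1 -> R) (G2 : T2 -> R) (f : Y -> R) :
  measurable_fun setT X1 -> measurable_fun setT X2 ->
  measurable_fun setT G1 -> measurable_fun setT G2 ->
  (forall t, 0 <= G1 t) -> (forall t, 0 <= G2 t) ->
  measurable_fun setT f -> (forall y, 0 <= f y) ->
  (forall B, measurable B -> (\int[m1]_t (\1_B (X1 t) * G1 t)%:E =
                              \int[m2]_t (\1_B (X2 t) * G2 t)%:E)%E) ->
  (\int[m1]_t (f (X1 t) * G1 t)%:E = \int[m2]_t (f (X2 t) * G2 t)%:E)%E.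
Proof.
move=> mX1 mX2 mG1 mG2 G10 G20 mf f0 h.
have mEf : measurable_fun setT (EFin \o f) by exact/measurable_EFinP.
rewrite (weighted_integral_limit m1 mEf) // (weighted_integral_limit m2 mEf) //.
congr (limn _); apply/funext => n.
rewrite !weighted_simple_integral //; apply: eq_fsbigr => k _.
congr (_ * _)%E; apply: h; exact: measurable_nnsfun_fiber.
Qed.

(** * Expectations of products over independent edges *)

Section Independence.
Context d (Omega : measurableType d) (R : realType) (P : probability Omega R).
Context (I : finType) (J0 : {set I}) (X : I -> Omega -> R).
Hypothesis mX : forall e, measurable_fun [set: Omega] (X e).
Hypothesis indep : forall (J : {set I}) (B : I -> set R), J \subset J0 ->
  (forall e, measurable (B e)) ->
  P [set w | forall e, e \in J -> B e (X e w)] =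
  (\prod_(e in J) P [set w | B e (X e w)])%E.

Let prX e B := fine (P [set w | B (X e w)]).

Let mprX e B : measurable B -> measurable [set w | B (X e w)].
Proof. by move=> mB; rewrite -[X in measurable X]setTI; exact: mX. Qed.

Let prXE e B : measurable B -> P [set w | B (X e w)] = (prX e B)%:E.
Proof. by move=> mB; rewrite /prX fineK // fin_num_measure //; exact: mprX. Qed.

Lemma integral_scale_cst (f : Omega -> R) (a : R) : 0 <= a ->
  measurable_fun setT f -> (forall w, 0 <= f w) ->
  (\int[P]_w (f w * a)%:E = a%:E * \int[P]_w (f w)%:E)%E.
Proof.
move=> a0 mf f0; rewrite -ge0_integralZl_EFin //.
- by apply: eq_integral => w _; rewrite mulrC EFinM.
- by move=> w _; rewrite lee_fin.
- exact/measurable_EFinP.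
Qed.

Lemma measurable_prod_real (s : seq I) (g : I -> Omega -> R) (Q : pred I) :
  (forall e, measurable_fun setT (g e)) ->
  measurable_fun setT (fun w => \prod_(e <- s | Q e) g e w).
Proof.
move=> mg; elim: s => [|a s ih]; first by under eq_fun do rewrite big_nil; exact: measurable_cst.
under eq_fun do rewrite big_cons.
by case: (Q a) => //; apply: measurable_funM.
Qed.

(** Induction on the list of factors that are general functions, the others being indicators. The
    remaining product is treated as a weight, so the first factor of the list may be assumed to be
    an indicator; it then joins J and the induction hypothesis applies. *)
Lemma independent_mixed_expectation (f : I -> R -> R) (c : I -> R) :
  (forall e, measurable_fun setT (f e)) -> (forall e x, 0 <= f e x) ->
  (forall e, e \in J0 -> (\int[P]_w (f e (X e w))%:E = (c e)%:E)%E) ->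
  forall (s : seq I) (J : {set I}) (B : I -> set R),
  uniq s -> {subset s <= J0} -> J \subset J0 -> (forall e, e \in s -> e \notin J) ->
  (forall e, measurable (B e)) ->
  (\int[P]_w ((\prod_(e <- s) f e (X e w)) * \prod_(e in J) \1_(B e) (X e w))%:E =
   ((\prod_(e <- s) c e) * \prod_(e in J) prX e (B e))%:E)%E.
Proof.
move=> mf f0 hc; elim=> [|a s ih] J B us sJ0 JJ0 sJ mB.
  rewrite big_nil mul1r; under eq_integral do rewrite big_nil mul1r.
  transitivity (\int[P]_w (\1_[set w | forall e, e \in J -> B e (X e w)] w)%:E)%E.
    apply: eq_integral => w _; congr (_%:E); rewrite indicE.
    case: (boolP (w \in _)) => [|/negP h].
      rewrite inE => h; apply: big1 => e eJ; rewrite indicE.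
      by rewrite mem_set //; exact: h.
    have /existsP[e /andP[eJ he]] : [exists e, (e \in J) && (X e w \notin B e)].
      rewrite -negb_forall_in; apply/negP => /forall_inP h'; apply: h.
      by rewrite inE /= => e eJ; have := h' e eJ; rewrite inE.
    by rewrite (bigD1 e) //= indicE (negbTE he) mul0r.
  rewrite integral_indic // ?setIT; last first.
    rewrite (_ : [set w | _] = \bigcap_(e in [set` J]) [set w | B e (X e w)]).
      by apply: fin_bigcap_measurable => // e _; exact: mprX.
    by apply/seteqP; split.
  by rewrite [LHS](@indep J B JJ0 mB) -prodEFin; apply: eq_bigr => e _; exact: prXE.
have [au us'] := andP us.
have aJ0 : a \in J0 by apply: sJ0; rewrite inE eqxx.
have c0 : 0 <= (\prod_(e <- s) c e) * \prod_(e in J) prX e (B e).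
  apply: mulr_ge0; last first.
    by apply: prodr_ge0 => e _; apply: fine_ge0; exact: measure_ge0.
  rewrite big_seq; apply: prodr_ge0 => e es.
  rewrite -lee_fin -hc; last by apply: sJ0; rewrite inE es orbT.
  by apply: integral_ge0 => w _; rewrite lee_fin.
pose G w := (\prod_(e <- s) f e (X e w)) * \prod_(e in J) \1_(B e) (X e w).
have mfX e : measurable_fun setT (fun w => f e (X e w)) by exact: measurableT_comp.
have mG : measurable_fun setT G.
  apply: measurable_funM; first exact: measurable_prod_real.
  apply: measurable_prod_real => e; apply: measurableT_comp (mX e).
  exact: measurable_indic.
have G0 w : 0 <= G w.
  by apply: mulr_ge0; apply: prodr_ge0.
under eq_integral do rewrite big_cons -mulrA -/(G _).
rewrite (weighted_integral_ext (m2 := P) (X2 := X a) (G2 := fun=> _) _ _ _ _ G0 (fun=> c0)) //.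
  rewrite integral_scale_cst // hc // -EFinM big_cons; congr (_%:E); ring.
move=> D mD.
pose B' e := if e == a then D else B e.
have aJ : a \notin J by apply: sJ; rewrite inE eqxx.
have JB' (T : comPzRingType) (F : I -> set R -> T) :
    \prod_(e in a |: J) F e (B' e) = F a D * \prod_(e in J) F e (B e).
  rewrite big_setU1 //= /B' eqxx; congr (_ * _); apply: eq_bigr => e eJ.
  by rewrite ifN //; apply: contraNneq aJ => <-.
have JBG w : \prod_(e in a |: J) \1_(B' e) (X e w) =
    \1_D (X a w) * \prod_(e in J) (\1_(B e) (X e w) : R).
  exact: (JB' R (fun e D => \1_D (X e w))).
transitivity (\int[P]_w ((\prod_(e <- s) f e (X e w)) *
    \prod_(e in a |: J) \1_(B' e) (X e w))%:E)%E.
  by apply: eq_integral => w _; rewrite JBG mulrCA.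
rewrite ih //; first rewrite (JB' R prX).
- rewrite integral_scale_cst //; last first.
    by apply: measurableT_comp (mX a); exact: measurable_indic.
  rewrite (_ : (fun w => (\1_D (X a w))%:E) = (fun w => (\1_[set w | D (X a w)] w)%:E)); last first.
    by apply/funext => w; rewrite !indicE; congr (_%:R%:E); apply/idP/idP; rewrite !inE.
  rewrite integral_indic ?setIT //; last exact: mprX.
  rewrite [X in (_ * X)%E](@prXE a D mD) -EFinM; by congr (_%:E); ring.
- by move=> e es; apply: sJ0; rewrite inE es orbT.
- by rewrite finset.subUset finset.sub1set aJ0.
- move=> e es; rewrite !inE negb_or sJ ?inE ?es ?orbT // andbT.
  by apply: contraNneq au => <-.
- by move=> e; rewrite /B'; case: ifP.
Qed.

Lemma independent_expectation_prod (f : I -> R -> R) (c : I -> R) :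
  (forall e, measurable_fun setT (f e)) -> (forall e x, 0 <= f e x) ->
  (forall e, e \in J0 -> (\int[P]_w (f e (X e w))%:E = (c e)%:E)%E) ->
  (\int[P]_w (\prod_(e in J0) f e (X e w))%:E = (\prod_(e in J0) c e)%:E)%E.
Proof.
move=> mf f0 hc.
have := @independent_mixed_expectation f c mf f0 hc (enum J0) finset.set0 (fun=> [set: R]) (enum_uniq (mem J0)).
rewrite big_set0 mulr1 => h.
under eq_integral do rewrite -big_enum.
rewrite -[in RHS]big_enum -h.
- by apply: eq_integral => w _; rewrite big_set0 mulr1.
- by move=> e; rewrite mem_enum.
- by rewrite finset.sub0set.
- by move=> e _; rewrite inE.
- by move=> _; exact: measurableT.
Qed.

End Independence.

(** * The score of one edge and its moment generating function *)

Section Score.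
Context {R : realType}.
Variables (mu : {measure set (measurableTypeR R) -> \bar R}) (p : R -> R -> R) (X : set R).
Hypotheses (hp : density_family mu p) (hX : forall theta, [set x | 0 < p theta x] = X).
Hypothesis (hE1 : loglik_regular p X).

Lemma density_gt0 theta x : X x -> 0 < p theta x.
Proof. by rewrite -(hX theta). Qed.

Lemma density_eq0 theta x : ~ X x -> p theta x = 0.
Proof.
have [_ p0 _] := hp theta.
move=> nX; apply/eqP; rewrite eq_le p0 andbT leNgt; apply/negP => px.
by apply: nX; rewrite -(hX theta).
Qed.

(** The score is the pointwise limit of difference quotients with increments 1 / (n + 1). *)
Lemma measurable_score theta : measurable_fun [set: R] (dloglik p 1 theta).
Proof.
pose u (n : nat) : R := n.+1%:R^-1.
pose h (n : nat) (x : R) : R := (u n)^-1 * (loglik p (u n + theta) x - loglik p theta x).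
have ml t : measurable_fun [set: R] (loglik p t).
  by apply: measurableT_comp; [exact: measurable_ln|have [] := hp t].
apply: (@measurable_fun_cvg _ _ _ _ h).
  by move=> n; apply: measurable_funM => //; apply: measurable_funB.
move=> x _.
have dx : derivable (loglik p ^~ x) theta 1.
  have [Xx|nX] := pselect (X x); first by have [hd _] := hE1; exact: (hd x Xx 0%N).
  (* Off the common support the density vanishes for every parameter and ln 0 = 0, so the
     log-likelihood is constant there. *)
  rewrite (_ : loglik p ^~ x = cst 0); first exact: derivable_cst.
  by apply/funext => t; rewrite /loglik density_eq0 // ln0.
have := dx; rewrite /derivable => /cvg_ex [l hl].
have el : dloglik p 1 theta x = l.
  by rewrite [LHS]derive1E; apply/cvg_lim.
rewrite el; rewrite (_ : h ^~ x = fun n => (fun t : R => t^-1 *: (loglik p (t *: 1 + theta) x -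
  loglik p theta x)) (u n)); last first.
  by apply/funext => n; rewrite /h /GRing.scale /= mulr1.
move/cvgr_dnbhsP: hl; apply; split=> [n|]; first by rewrite invr_neq0.
exact: cvg_harmonic.
Qed.

(** Exponential tilting: the lower quadratic bound on the log-likelihood dominates the integrand by
    exp (k2 h^2 / 2) times the density at theta + h, which integrates to 1. *)
Lemma score_mgf (b k1 k2 : R) theta h : 0 < b ->
  (forall x, X x -> curvature_bounds (loglik p ^~ x) (dloglik p 1 ^~ x) b k1 k2) ->
  - b <= theta <= b -> - b <= theta + h <= b ->
  (\int[mu]_x (expR (h * dloglik p 1 theta x) * p theta x)%:E
    <= (expR (k2 / 2 * h ^+ 2))%:E)%E.
Proof.
move=> b0 hc ht hth.
have [mpt p0 int1] := hp (theta + h).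
have [mpt' p0' _] := hp theta.
apply: (@le_trans _ _ (\int[mu]_x ((expR (k2 / 2 * h ^+ 2))%:E * (p (theta + h) x)%:E))%E); last first.
  rewrite ge0_integralZl_EFin //.
  - by rewrite int1 mule1.
  - by move=> x _; rewrite lee_fin.
  - exact/measurable_EFinP.
apply: ge0_le_integral => //.
- by move=> x _; rewrite lee_fin mulr_ge0 ?expR_ge0.
- apply/measurable_EFinP; apply: measurable_funM => //.
  apply: measurableT_comp => //; apply: measurable_funM => //; exact: measurable_score.
- apply/measurable_EFinP; apply: measurable_funM => //.
move=> x _; rewrite -EFinM lee_fin.
have [Xx|nX] := pselect (X x); last by rewrite !density_eq0 // !mulr0.
have [_ h2 _ _] := hc x Xx _ _ ht hth.
rewrite -[p theta x]lnK ?posrE ?density_gt0 // -[p (theta + h) x]lnK ?posrE ?density_gt0 //.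
rewrite -!expRD ler_expR; rewrite /loglik in h2.
by rewrite (addrC theta h) addrK in h2; rewrite (addrC theta h); lra.
Qed.

End Score.

(** * Exponential Markov inequality and union bound *)

Section Chernoff.
Context d (Omega : measurableType d) (R : realType) (P : probability Omega R).

Lemma exponential_markov (S : Omega -> R) (h t C : R) :
  measurable_fun setT S -> 0 <= h ->
  (\int[P]_w (expR (h * S w))%:E <= C%:E)%E ->
  (P [set w | t < S w]%R <= (expR (- (h * t)) * C)%:E)%E.
Proof.
move=> mS h0 hC.
have mB : measurable [set w | t < S w].
  rewrite -[X in measurable X]setTI (_ : [set w | t < S w] = S @^-1` `]t, +oo[%classic).
    exact: mS.
  by apply/seteqP; split=> w /=; rewrite in_itv /= andbT.
have mE : measurable_fun setT (fun w => expR (h * S w)).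
  by apply: measurableT_comp => //; apply: measurable_funM.
rewrite EFinM; apply: (@le_trans _ _ ((expR (- (h * t)))%:E * \int[P]_w (expR (h * S w))%:E)%E); last first.
  by rewrite lee_wpmul2l // lee_fin expR_ge0.
rewrite -ge0_integralZl_EFin //; last exact/measurable_EFinP.
rewrite -[X in (X <= _)%E](_ : \int[P]_w (\1_[set w | t < S w] w)%:E = _)%E; last first.
  by rewrite integral_indic // setIT.
apply: ge0_le_integral => //.
- exact/measurable_EFinP.
- by apply/measurable_EFinP; apply: measurable_funM => //.
move=> w _; rewrite -EFinM lee_fin indicE; case: (boolP (w \in _)) => hw.
  rewrite -expRD -expR0 ler_expR; rewrite inE /= in hw.
  by rewrite addrC -mulrBr mulr_ge0 // subr_ge0 ltW.
by rewrite mulr_ge0 ?expR_ge0.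
Qed.

Lemma probability_union_le (T : finType) (B : T -> set Omega) (q : T -> R) :
  (forall i, measurable (B i)) -> (forall i, P (B i) <= (q i)%:E)%E ->
  measurable [set w | exists i, B i w] /\
  (P [set w | exists i, B i w] <= (\sum_i q i)%:E)%E.
Proof.
move=> mB hq.
have sub (s : seq T) : measurable (\big[setU/set0]_(i <- s) B i) /\
    (P (\big[setU/set0]_(i <- s) B i) <= (\sum_(i <- s) q i)%:E)%E.
  elim: s => [|a s [ih1 ih2]].
    by rewrite !big_nil; split; [exact: measurable0|rewrite measure0].
  rewrite !big_cons; split; first exact: measurableU.
  apply: (@le_trans _ _ (P (B a) + P (\big[setU/set0]_(i <- s) B i))%E).
    exact: measureU2.
  by rewrite EFinD leeD.
have -> : [set w | exists i, B i w] = \big[setU/set0]_(i <- index_enum T) B i.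
  rewrite -bigcup_seq; apply/seteqP; split=> w.
    by move=> [i Biw]; exists i => //=; rewrite mem_index_enum.
  by move=> [i _ Biw]; exists i.
exact: sub.
Qed.
End Chernoff.

(** * Tail bounds for linear statistics of the scores *)

Section NetworkNoise.
Context {R : realType} {n k : nat} {d : measure_display} {Omega : measurableType d}.
Variables (mu : {measure set (measurableTypeR R) -> \bar R}) (p : R -> R -> R) (X : set R).
Hypotheses (hp : density_family mu p) (hX : forall theta, [set x | 0 < p theta x] = X).
Hypothesis (hE1 : loglik_regular p X).
Variables (P : probability Omega R) (Ystar : 'M[R]_(n, k + 1)) (A : Omega -> 'M[R]_n).
Hypothesis hA : latent_space_model mu p P Ystar A.
Variables (b k1 K : R).
Hypotheses (b_gt0 : 0 < b) (hTheta : forall i j, `|Theta Ystar i j| <= b).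
Hypothesis hK : forall x, X x ->
  curvature_bounds (loglik p ^~ x) (dloglik p 1 ^~ x) (b + 1) k1 K.
Hypothesis K_ge0 : 0 <= K.

Let upper : {set 'I_n * 'I_n} := [set e : 'I_n * 'I_n | (e.1 < e.2)%N].

Definition edge_score (w : Omega) (e : 'I_n * 'I_n) : R :=
  dloglik p 1 (Theta Ystar e.1 e.2) (A w e.1 e.2).

Definition edge_sum (a : 'I_n * 'I_n -> R) (w : Omega) : R :=
  \sum_(e : 'I_n * 'I_n | (e.1 < e.2)%N) a e * edge_score w e.

Let mA e : measurable_fun [set: Omega] (fun w => A w e.1 e.2).
Proof. by have [_ h _ _] := hA; exact: h. Qed.

Lemma measurable_edge_score e : measurable_fun setT (fun w => edge_score w e).
Proof.
by apply: (measurableT_comp (measurable_score hp hX hE1 _)) => //; exact: mA.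
Qed.

Lemma measurable_edge_sum a : measurable_fun setT (edge_sum a).
Proof.
rewrite /edge_sum; elim: (index_enum _) => [|e s ih].
  under eq_fun do rewrite big_nil; exact: measurable_cst.
under eq_fun do rewrite big_cons; case: (e.1 < e.2)%N => //.
apply: measurable_funD => //; apply: measurable_funM => //.
exact: measurable_edge_score.
Qed.

Lemma edge_expectation (e : 'I_n * 'I_n) (f : R -> R) : (e.1 < e.2)%N ->
  measurable_fun setT f -> (forall x, 0 <= f x) ->
  (\int[P]_w (f (A w e.1 e.2))%:E =
   \int[mu]_x (f x * p (Theta Ystar e.1 e.2) x)%:E)%E.
Proof.
move=> he mf f0; have [_ _ _ hlaw] := hA.
have [mpt pt0 _] := hp (Theta Ystar e.1 e.2).
transitivity (\int[P]_w (f (A w e.1 e.2) * 1)%:E)%E.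
  by apply: eq_integral => w _; rewrite mulr1.
apply: (@weighted_integral_ext _ _ _ _ _ _ _ P mu _ (fun x : R => x) (fun=> 1)) => //.
move=> B mB.
transitivity (P [set w | B (A w e.1 e.2)]).
  transitivity (\int[P]_w (\1_[set w | B (A w e.1 e.2)] w)%:E)%E; last first.
    rewrite integral_indic ?setIT //.
    by rewrite -[X in _ X]setTI; exact: mA.
  apply: eq_integral => w _; rewrite mulr1 !indicE.
  have -> // : (A w e.1 e.2 \in B) = (w \in [set w | B (A w e.1 e.2)]).
  by apply/idP/idP; rewrite !inE.
rewrite hlaw // [LHS]integral_mkcond; apply: eq_integral => x _.
rewrite /patch indicE; case: ifP => hx; first by rewrite mul1r.
by rewrite mul0r.
Qed.

(** Chernoff with parameter h. The condition |h a_e| <= 1 keeps the tilted parameters in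
    [-(b + 1), b + 1], where K bounds the curvature. *)
Lemma edge_sum_tail a (h t v : R) : 0 <= h -> (forall e, `|h * a e| <= 1) ->
  h ^+ 2 * \sum_(e : 'I_n * 'I_n | (e.1 < e.2)%N) a e ^+ 2 <= v ->
  (P [set w | t < edge_sum a w]%R <= (expR (- (h * t) + K / 2 * v))%:E)%E.
Proof.
move=> h0 ha hv; have [_ _ hind _] := hA; rewrite expRD.
apply: exponential_markov => //; first exact: measurable_edge_sum.
pose f (e : 'I_n * 'I_n) (x : R) := expR (h * a e * dloglik p 1 (Theta Ystar e.1 e.2) x).
have mf e : measurable_fun setT (f e).
  apply: measurableT_comp => //; apply: measurable_funM => //.
  exact: (measurable_score hp hX hE1).
have f0 e x : 0 <= f e x by exact: expR_ge0.
pose c e := fine (\int[P]_w (f e (A w e.1 e.2))%:E)%E.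
have bnd e : e \in upper ->
    (\int[P]_w (f e (A w e.1 e.2))%:E <= (expR (K / 2 * (h * a e) ^+ 2))%:E)%E.
  rewrite inE => he; rewrite edge_expectation //.
  have := hTheta e.1 e.2; have := ha e; rewrite !ler_norml => /andP[a1 a2] /andP[t1 t2].
  apply: (score_mgf hp hX hE1 _ hK); first by rewrite ltr_wpDl // ltW.
    by apply/andP; split; lra.
  by apply/andP; split; lra.
have cE e : e \in upper -> (\int[P]_w (f e (A w e.1 e.2))%:E = (c e)%:E)%E.
  move=> he; rewrite /c fineK // ge0_fin_numE.
    by apply: le_lt_trans (bnd e he) _; rewrite ltry.
  by apply: integral_ge0 => w _; rewrite lee_fin.
have -> : (\int[P]_w (expR (h * edge_sum a w))%:E =
    \int[P]_w (\prod_(e in upper) f e (A w e.1 e.2))%:E)%E.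
  apply: eq_integral => w _; congr (_%:E); rewrite /edge_sum mulr_sumr expR_sum.
  apply: eq_big => [e|e _]; first by rewrite inE.
  by rewrite /f mulrA.
rewrite (@independent_expectation_prod _ _ _ P _ upper (fun e w => A w e.1 e.2) mA _ f c) //; last first.
  move=> J B hJ mB; apply: hind => // e eJ.
  by have := fintype.subsetP hJ e eJ; rewrite inE.
rewrite lee_fin; apply: (@le_trans _ _ (\prod_(e in upper) expR (K / 2 * (h * a e) ^+ 2))).
  apply: ler_prod => e he; rewrite -!lee_fin -cE // bnd // andbT.
  by apply: integral_ge0 => w _; rewrite lee_fin.
rewrite -expR_sum ler_expR -mulr_sumr ler_wpM2l ?divr_ge0 //.
apply: le_trans hv; rewrite mulr_sumr le_eqVlt; apply/orP; left; apply/eqP.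
by apply: eq_big => [e|e _]; [rewrite inE|rewrite exprMn].
Qed.

Lemma edge_support (e : 'I_n * 'I_n) : (e.1 < e.2)%N ->
  measurable [set w | ~ X (A w e.1 e.2)] /\ P [set w | ~ X (A w e.1 e.2)] = 0%E.
Proof.
move=> he; have mX : measurable (~` X).
  apply: measurableC; have [m0 _ _] := hp 0.
  rewrite -(hX 0) -[X in measurable X]setTI.
  rewrite (_ : [set x | 0 < p 0 x] = p 0 @^-1` `]0, +oo[%classic); first exact: m0.
  by apply/seteqP; split=> x /=; rewrite in_itv /= andbT.
split; first by rewrite -[X in measurable X]setTI; exact: (mA e _ mX).
have [_ _ _ hlaw] := hA.
rewrite (hlaw _ _ he (~` X)) //; apply: integral0_eq => x nX.
by rewrite (density_eq0 hp hX).
Qed.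

(** The event is the complement of the finitely many tail events and of the null events that some
    edge leaves the support; the latter makes the curvature bounds available for the observed
    data. *)
Lemma noise_event (T : finType) (a : T -> 'I_n * 'I_n -> R) (h t v : T -> R) :
  (forall i, 0 <= h i) -> (forall i e, `|h i * a i e| <= 1) ->
  (forall i, h i ^+ 2 * \sum_(e : 'I_n * 'I_n | (e.1 < e.2)%N) a i e ^+ 2 <= v i) ->
  exists E : set Omega, [/\ measurable E,
    ((1 - \sum_i expR (- (h i * t i) + K / 2 * v i))%:E <= P E)%E,
    forall w, E w -> forall i, edge_sum (a i) w <= t i
  & forall w, E w -> forall i j : 'I_n, (i < j)%N -> X (A w i j)].
Proof.
move=> h0 ha hv.
pose B (s : T + {e : 'I_n * 'I_n | (e.1 < e.2)%N}) : set Omega :=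
  match s with
  | inl i => [set w | t i < edge_sum (a i) w]%R
  | inr e => [set w | ~ X (A w (val e).1 (val e).2)]
  end.
pose q (s : T + {e : 'I_n * 'I_n | (e.1 < e.2)%N}) : R :=
  if s is inl i then expR (- (h i * t i) + K / 2 * v i) else 0.
have mB s : measurable (B s).
  case: s => [i|e] /=; last by have [] := edge_support (valP e).
  rewrite -[X in measurable X]setTI.
  rewrite (_ : [set w | _] = edge_sum (a i) @^-1` `]t i, +oo[%classic).
    exact: measurable_edge_sum.
  by apply/seteqP; split=> w /=; rewrite in_itv /= andbT.
have hB s : (P (B s) <= (q s)%:E)%E.
  case: s => [i|e] /=; first exact: edge_sum_tail.
  by have [_ ->] := edge_support (valP e).
have [mU hU] := probability_union_le mB hB.
have qE : \sum_s q s = \sum_i expR (- (h i * t i) + K / 2 * v i).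
  by rewrite big_sumType /= [X in _ + X]big1 ?addr0.
exists (~` [set w | exists s, B s w]); split.
- exact: measurableC.
- rewrite probability_setC // -qE EFinB leeB //.
- by move=> w nB i; rewrite leNgt; apply/negP => hlt; apply: nB; exists (inl i).
- move=> w nB i j ij; apply: contrapT => nX; apply: nB.
  by exists (inr (exist _ (i, j) ij)).
Qed.

End NetworkNoise.

(** * Derivatives along lines *)

Section DirectionalDerivative.
Context {R : realType}.

Lemma is_derive_big (I : Type) (r : seq I) (Q : pred I) (f : I -> R -> R) (df : I -> R) (x : R) :
  (forall i, Q i -> is_derive x 1 (f i) (df i)) ->
  is_derive x 1 (fun t : R => \sum_(i <- r | Q i) f i t) (\sum_(i <- r | Q i) df i).
Proof.
move=> h; elim: r => [|a r ih].
  have -> : (fun t : R => \sum_(i <- [::] | Q i) f i t) = cst 0.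
    by apply/funext => t; rewrite big_nil.
  by rewrite big_nil; apply: (@is_derive_cst R R R 0 x 1).
have -> : (fun t : R => \sum_(i <- a :: r | Q i) f i t) =
    if Q a then f a \+ (fun t => \sum_(i <- r | Q i) f i t)
    else (fun t => \sum_(i <- r | Q i) f i t).
  by apply/funext => t; rewrite big_cons; case: (Q a).
rewrite big_cons; case: (boolP (Q a)) => // Qa; have ha := h a Qa.
exact: (is_deriveD ha ih).
Qed.

Lemma derive_along_line m q (f : 'M[R]_(m, q) -> R) (Y U : 'M[R]_(m, q)) (D : R) :
  is_derive (0 : R) 1 (fun t : R => f (Y + t *: U)) D -> 'D_U f Y = D.
Proof.
move=> [_ <-]; rewrite /derive; set F := fun h => _; set G := fun h => _.
have -> // : F = G.
apply/funext => h; rewrite /F /G /=.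
by rewrite scale0r addr0 [h *: (1 : R)]mulr1 addr0 (addrC Y).
Qed.

End DirectionalDerivative.

(** * The loss, its score matrix and its gradient *)

Section Model.
Context {R : realType} {n k : nat}.
Implicit Types (Y U : 'M[R]_(n, k + 1)).
Local Notation dot := frob_dot.
Local Notation nrm := frob_norm.

(** The matrix [Z, 1_n]: the differential of [Theta_mx] at Y in direction U is U V^T + V U^T with V
    this matrix, so the gradient of the loss is minus score times design. *)
Definition design Y : 'M[R]_(n, k + 1) := row_mx (positions Y) (ones n).

Definition Theta_mx Y : 'M[R]_n := \matrix_(i, j) Theta Y i j.

Lemma Theta_sym Y i j : Theta Y i j = Theta Y j i.
Proof.
rewrite /Theta (addrC (degrees Y i 0)); congr (_ + _).
by apply: eq_bigr => l _; rewrite mulrC.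
Qed.

Lemma Theta_mxE Y : Theta_mx Y = positions Y *m (positions Y)^T +
  (degrees Y *m (ones n)^T + ones n *m (degrees Y)^T).
Proof.
apply/matrixP => i j; rewrite !mxE !big_ord1 !mxE /Theta mulr1 mul1r [LHS]addrC.
congr (_ + _); first by apply: eq_bigr => l _; rewrite !mxE.
by rewrite /degrees !mxE.
Qed.

Lemma positionsD Y U : positions (Y + U) = positions Y + positions U.
Proof. exact: linearD. Qed.
Lemma positionsB Y U : positions (Y - U) = positions Y - positions U.
Proof. exact: linearB. Qed.
Lemma positionsZ a Y : positions (a *: Y) = a *: positions Y.
Proof. exact: linearZ. Qed.
Lemma degreesD Y U : degrees (Y + U) = degrees Y + degrees U.
Proof. exact: linearD. Qed.
Lemma degreesB Y U : degrees (Y - U) = degrees Y - degrees U.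
Proof. exact: linearB. Qed.
Lemma degreesZ a Y : degrees (a *: Y) = a *: degrees Y.
Proof. exact: linearZ. Qed.
Lemma splitY Y : Y = row_mx (positions Y) (degrees Y).
Proof. by rewrite hsubmxK. Qed.

Lemma mul_design U Y : U *m (design Y)^T = positions U *m (positions Y)^T + degrees U *m (ones n)^T.
Proof. by rewrite {1}(splitY U) /design tr_row_mx mul_row_col. Qed.

(** The expansion is exact because the parameter map is quadratic; only positions contribute to
    second order. *)
Lemma Theta_mxD Y U : Theta_mx (Y + U) = Theta_mx Y +
  (U *m (design Y)^T + design Y *m U^T) + positions U *m (positions U)^T.
Proof.
have trD (m q : nat) (a b : 'M[R]_(m, q)) : (a + b)^T = a^T + b^T by exact: linearD.
rewrite -[design Y *m _]trmxK trmx_mul trmxK mul_design.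
rewrite !Theta_mxE positionsD degreesD !trD !trmx_mul !trmxK.
rewrite !mulmxDl !mulmxDr; apply/matrixP => i j; rewrite !mxE; ring.
Qed.

Lemma sum_upper_triangle (f : 'I_n -> 'I_n -> R) : (forall i j, f i j = f j i) ->
  \sum_i \sum_(j | j != i) f i j = 2 * \sum_(i < n) \sum_(j < n | (i < j)%N) f i j.
Proof.
move=> fsym; have split (i : 'I_n) : \sum_(j | j != i) f i j =
    \sum_(j < n | (i < j)%N) f i j + \sum_(j < n | (j < i)%N) f i j.
  rewrite (bigID (fun j : 'I_n => (i < j)%N)) /=; congr (_ + _); apply: eq_bigl => j.
    by case: ltngtP => [h|h|/val_inj ->]; rewrite ?eqxx ?andbF // andbT -(inj_eq val_inj) /= gtn_eqF.
  by case: ltngtP => [h|h|/val_inj ->]; rewrite ?eqxx ?andbF // andbT -(inj_eq val_inj) /= ltn_eqF.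
under eq_bigr do rewrite split.
rewrite big_split /= mulr2n mulrDl mul1r; congr (_ + _).
rewrite (exchange_big_dep xpredT) //=; apply: eq_bigr => i _.
by apply: eq_bigr => j _; exact: fsym.
Qed.

Section Loss.
Variables (p : R -> R -> R) (A : 'M[R]_n).
Hypothesis symA : A^T = A.

Definition score Y : 'M[R]_n :=
  \matrix_(i, j) if i == j then 0 else dloglik p 1 (Theta Y i j) (A i j).

Definition offdiag_sq (M : 'M[R]_n) : R := \sum_i \sum_(j | j != i) M i j ^+ 2.

Lemma symAE i j : A j i = A i j.
Proof. by rewrite -[in LHS]symA mxE. Qed.

Lemma score_sym Y : (score Y)^T = score Y.
Proof. by apply/matrixP => i j; rewrite !mxE eq_sym Theta_sym symAE. Qed.

Lemma score_dot Y (M : 'M[R]_n) :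
  dot (score Y) M = \sum_i \sum_(j | j != i) dloglik p 1 (Theta Y i j) (A i j) * M i j.
Proof.
apply: eq_bigr => i _; rewrite [RHS]big_mkcond; apply: eq_bigr => j _.
by rewrite mxE eq_sym; case: eqP => //=; rewrite mul0r.
Qed.

Lemma loss_double_sum Y :
  loss p A Y = - (1 / 2) * \sum_i \sum_(j | j != i) loglik p (Theta Y i j) (A i j).
Proof.
rewrite sum_upper_triangle /loss; first by field.
by move=> i j; rewrite Theta_sym symAE.
Qed.

(** The edgewise quadratic bounds summed over ordered pairs; every edge is counted twice, hence the
    factors 1/2 and 1/4. *)
Lemma loss_sandwich Y Y' (b k1 k2 : R) :
  (forall i j, i != j -> curvature_bounds (loglik p ^~ (A i j)) (dloglik p 1 ^~ (A i j)) b k1 k2) ->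
  (forall i j, `|Theta Y i j| <= b) -> (forall i j, `|Theta Y' i j| <= b) ->
  loss p A Y - 1 / 2 * dot (score Y) (Theta_mx Y' - Theta_mx Y)
    + k1 / 4 * offdiag_sq (Theta_mx Y' - Theta_mx Y) <= loss p A Y' /\
  loss p A Y' <= loss p A Y - 1 / 2 * dot (score Y) (Theta_mx Y' - Theta_mx Y)
    + k2 / 4 * offdiag_sq (Theta_mx Y' - Theta_mx Y).
Proof.
move=> hc hY hY'; rewrite !loss_double_sum score_dot /offdiag_sq.
set T := Theta_mx Y' - Theta_mx Y.
pose f i j := loglik p (Theta Y' i j) (A i j) - loglik p (Theta Y i j) (A i j)
  - dloglik p 1 (Theta Y i j) (A i j) * T i j.
have ub : \sum_i \sum_(j | j != i) f i j <= \sum_i \sum_(j | j != i) - k1 / 2 * T i j ^+ 2.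
  apply: ler_sum => i _; apply: ler_sum => j ji.
  have [h _ _ _] := hc i j ltac:(by rewrite eq_sym) _ _ (ltac:(rewrite -ler_norml; exact: (hY i j))) (ltac:(rewrite -ler_norml; exact: (hY' i j))).
  by move: h; rewrite /f /T !mxE; lra.
have lb : \sum_i \sum_(j | j != i) - k2 / 2 * T i j ^+ 2 <= \sum_i \sum_(j | j != i) f i j.
  apply: ler_sum => i _; apply: ler_sum => j ji.
  have [_ h _ _] := hc i j ltac:(by rewrite eq_sym) _ _ (ltac:(rewrite -ler_norml; exact: (hY i j))) (ltac:(rewrite -ler_norml; exact: (hY' i j))).
  by move: h; rewrite /f /T !mxE; lra.
have e (c : R) : \sum_i \sum_(j | j != i) - c / 2 * T i j ^+ 2 =
    - c / 2 * \sum_i \sum_(j | j != i) T i j ^+ 2.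
  by rewrite mulr_sumr; apply: eq_bigr => i _; rewrite mulr_sumr.
have ef : \sum_i \sum_(j | j != i) f i j =
    \sum_i \sum_(j | j != i) loglik p (Theta Y' i j) (A i j)
    - \sum_i \sum_(j | j != i) loglik p (Theta Y i j) (A i j)
    - \sum_i \sum_(j | j != i) dloglik p 1 (Theta Y i j) (A i j) * T i j.
  rewrite -!sumrB; apply: eq_bigr => i _; by rewrite -!sumrB.
rewrite !e ef in ub lb; split; lra.
Qed.

Lemma score_lipschitz Y Y' (b k1 k2 : R) : 0 <= k2 ->
  (forall i j, i != j -> curvature_bounds (loglik p ^~ (A i j)) (dloglik p 1 ^~ (A i j)) b k1 k2) ->
  (forall i j, `|Theta Y i j| <= b) -> (forall i j, `|Theta Y' i j| <= b) ->
  nrm (score Y - score Y') <= k2 * nrm (Theta_mx Y - Theta_mx Y').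
Proof.
move=> k20 hc hY hY'; apply: frob_norm_le; first by rewrite mulr_ge0 ?frob_norm_ge0.
rewrite exprMn sqr_frob_norm /frob_dot mulr_sumr; apply: ler_sum => i _.
rewrite mulr_sumr; apply: ler_sum => j _; rewrite !mxE -!expr2.
have [->|ij] := eqVneq i j; first by rewrite subrr expr0n mulr_ge0 ?sqr_ge0.
have [_ _ _ h] := hc i j ij _ _ (ltac:(rewrite -ler_norml; exact: (hY i j))) (ltac:(rewrite -ler_norml; exact: (hY' i j))).
rewrite -exprMn -[X in X <= _]real_normK ?num_real // -[X in _ <= X]real_normK ?num_real //.
rewrite ler_pXn2r ?nnegrE // normrM (ger0_norm k20); exact: h.
Qed.

Lemma score_monotone Y Y' (b k1 k2 : R) :
  (forall i j, i != j -> curvature_bounds (loglik p ^~ (A i j)) (dloglik p 1 ^~ (A i j)) b k1 k2) ->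
  (forall i j, `|Theta Y i j| <= b) -> (forall i j, `|Theta Y' i j| <= b) ->
  k1 * offdiag_sq (Theta_mx Y' - Theta_mx Y) <= dot (score Y - score Y') (Theta_mx Y' - Theta_mx Y).
Proof.
move=> hc hY hY'; rewrite frob_dotDl frob_dotNl !score_dot /offdiag_sq mulr_sumr -sumrB.
apply: ler_sum => i _; rewrite mulr_sumr -sumrB; apply: ler_sum => j ji.
have [_ _ h _] := hc i j ltac:(by rewrite eq_sym) _ _ (ltac:(rewrite -ler_norml; exact: (hY i j))) (ltac:(rewrite -ler_norml; exact: (hY' i j))).
by rewrite -mulrBl !mxE.
Qed.

Hypothesis loglik_diff : forall i j, i != j -> forall theta : R,
  is_derive theta 1 (loglik p ^~ (A i j)) (dloglik p 1 theta (A i j)).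

Lemma Theta_line Y U i j (t : R) : Theta (Y + t *: U) i j =
  Theta Y i j + t * (U *m (design Y)^T + design Y *m U^T) i j
  + t ^+ 2 * (positions U *m (positions U)^T) i j.
Proof.
have -> : Theta (Y + t *: U) i j = Theta_mx (Y + t *: U) i j by rewrite mxE.
have trZ (m q : nat) (a : R) (B : 'M[R]_(m, q)) : (a *: B)^T = a *: B^T by exact: linearZ.
rewrite Theta_mxD positionsZ !trZ -!scalemxAl -!scalemxAr scalerA -scalerDr -expr2.
move: (U *m _ + _) (positions U *m _) => B C.
by rewrite !mxE.
Qed.

Lemma is_derive_edge Y U i j : i != j ->
  is_derive (0 : R) 1 (fun t : R => loglik p (Theta (Y + t *: U) i j) (A i j))
    (dloglik p 1 (Theta Y i j) (A i j) * (U *m (design Y)^T + design Y *m U^T) i j).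
Proof.
move=> ij; set c := (U *m _ + _) i j.
have dT : is_derive (0 : R) 1 (fun t : R => Theta (Y + t *: U) i j) c.
  under eq_fun do rewrite Theta_line -/c.
  apply: is_derive_eq.
  by rewrite /GRing.scale /=; ring.
have dl := loglik_diff ij (Theta (Y + 0 *: U) i j).
have := @is_derive1_comp _ (loglik p ^~ (A i j)) (fun t : R => Theta (Y + t *: U) i j) 0 _ _ dl dT.
by rewrite scale0r addr0.
Qed.

Lemma loss_directional Y U : 'D_U (loss p A) Y = - dot (score Y *m design Y) U.
Proof.
apply: derive_along_line.
have -> : - dot (score Y *m design Y) U = - \sum_(i < n) \sum_(j < n | (i < j)%N)
    dloglik p 1 (Theta Y i j) (A i j) * (U *m (design Y)^T + design Y *m U^T) i j.
  have <- : 1 / 2 * dot (score Y) (U *m (design Y)^T + design Y *m U^T) =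
      dot (score Y *m design Y) U.
    rewrite frob_dotDr frob_dot_mulmxr -[dot _ (design Y *m _)]frob_dot_tr.
    by rewrite score_sym trmx_mul trmxK; field.
  rewrite score_dot sum_upper_triangle; first by field.
  move=> i j; rewrite Theta_sym symAE; congr (_ * _).
  have -> : design Y *m U^T = (U *m (design Y)^T)^T by rewrite trmx_mul trmxK.
  by move: (U *m _) => B; rewrite !mxE addrC.
rewrite -sumrN.
have -> : (fun t : R => loss p A (Y + t *: U)) = (fun t : R => \sum_(i < n)
    \sum_(j < n | (i < j)%N) - loglik p (Theta (Y + t *: U) i j) (A i j)).
  by apply/funext => t; rewrite /loss -sumrN; apply: eq_bigr => i _; rewrite sumrN.
apply: is_derive_big => i _; rewrite -sumrN; apply: is_derive_big => j ij.
apply: is_deriveN; apply: is_derive_edge.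
by rewrite -(inj_eq val_inj) /= ltn_eqF.
Qed.

Lemma frob_dot_delta m q (M : 'M[R]_(m, q)) i j : dot M (delta_mx i j) = M i j.
Proof.
rewrite /frob_dot (bigD1 i) //= (bigD1 j) //= mxE !eqxx mulr1.
rewrite big1 => [|j' hj]; last by rewrite mxE (negbTE hj) andbF mulr0.
rewrite big1 ?addr0 // => i' hi; apply: big1 => j' _.
by rewrite mxE (negbTE hi) mulr0.
Qed.

Lemma gradient_loss Y : gradient (loss p A) Y = - (score Y *m design Y).
Proof.
by apply/matrixP => i j; rewrite mxE loss_directional frob_dot_delta [RHS]mxE.
Qed.

Lemma gradient_row_loss (i : 'I_n) Y c :
  gradient (row_loss p A i) Y i c = - (score Y *m design Y) i c.
Proof.
rewrite mxE; apply: derive_along_line; rewrite [in X in is_derive _ _ _ X]mxE.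
have -> : (fun t : R => row_loss p A i (Y + t *: delta_mx i c)) = (fun t : R =>
    \sum_(j < n | j != i) - loglik p (Theta (Y + t *: delta_mx i c) i j) (A i j)).
  by apply/funext => t; rewrite /row_loss sumrN.
rewrite -sumrN.
have -> : \sum_j - (score Y i j * design Y j c) =
    \sum_(j < n | j != i) - (dloglik p 1 (Theta Y i j) (A i j) *
      (delta_mx i c *m (design Y)^T + design Y *m (delta_mx i c)^T) i j).
  rewrite [RHS]big_mkcond; apply: eq_bigr => j _; rewrite mxE eq_sym.
  case: eqVneq => [|ji] /=; first by rewrite mul0r oppr0.
  congr (- (_ * _)).
  move: (design Y) => V; rewrite [RHS]mxE [X in _ = X + _]mxE (bigD1 c) //= mxE !eqxx mul1r [V^T c j]mxE big1 => [|c' hc]; last first.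
    by rewrite mxE (negbTE hc) andbF mul0r.
  rewrite [X in _ = _ + X]mxE big1 => [|c' _]; first by rewrite !addr0.
  by rewrite [X in _ * X]mxE mxE (negbTE ji) mulr0.
apply: is_derive_big => j ji; apply: is_deriveN; apply: is_derive_edge.
by rewrite eq_sym.
Qed.

End Loss.
End Model.

(** * Row bounds, operator bounds and the Lipschitz constant of the parameter map *)

Section Geometry.
Context {R : realType} {n k : nat}.
Implicit Types (Y U : 'M[R]_(n, k + 1)).
Local Notation dot := frob_dot.
Local Notation nrm := frob_norm.
Local Notation rtn := (Num.sqrt (n%:R : R)).

Definition rows_bounded (b : R) m q (Y : 'M[R]_(m, q)) : Prop := forall i, nrm (row i Y) <= b.

Definition centered Y : Prop := (ones n)^T *m positions Y = 0.

Definition op_bounded (c : R) (M : 'M[R]_n) : Prop := forall x : 'cV_n, nrm (M *m x) <= c * nrm x.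

Lemma rtn_sqr : rtn ^+ 2 = n%:R.
Proof. by rewrite sqr_sqrtr. Qed.

Lemma rtn_ge0 : 0 <= rtn.
Proof. exact: sqrtr_ge0. Qed.

Lemma op_bounded_mulmx c M q (X : 'M[R]_(n, q)) : 0 <= c ->
  op_bounded c M -> nrm (M *m X) <= c * nrm X.
Proof.
move=> c0 h; apply: frob_norm_le; first by rewrite mulr_ge0 ?frob_norm_ge0.
rewrite exprMn sqr_frob_norm !frob_dot_cols mulr_sumr; apply: ler_sum => j _.
rewrite colE -mulmxA -colE -sqr_frob_norm -[X in _ <= _ * X]sqr_frob_norm -exprMn.
by rewrite ler_pXn2r ?nnegrE ?mulr_ge0 ?frob_norm_ge0.
Qed.

Lemma frob_norm_le_sqr m q (X : 'M[R]_(m, q)) m' q' (X' : 'M[R]_(m', q')) :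
  dot X X <= dot X' X' -> nrm X <= nrm X'.
Proof. by move=> h; apply: frob_norm_le; rewrite ?frob_norm_ge0 ?sqr_frob_norm. Qed.

Lemma frob_dot_split U U' : dot U U' = dot (positions U) (positions U') + dot (degrees U) (degrees U').
Proof. by rewrite {1}(splitY U) {1}(splitY U') frob_dot_row_mx. Qed.

Lemma positions_le U : nrm (positions U) <= nrm U.
Proof. by apply: frob_norm_le_sqr; rewrite (frob_dot_split U) lerDl frob_dot_ge0. Qed.

Lemma degrees_le U : nrm (degrees U) <= nrm U.
Proof. by apply: frob_norm_le_sqr; rewrite (frob_dot_split U) lerDr frob_dot_ge0. Qed.

Lemma rows_bounded_frob m q (Y : 'M[R]_(m, q)) b : rows_bounded b Y -> dot Y Y <= m%:R * b ^+ 2.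
Proof.
move=> h; rewrite -sqr_frob_norm sqr_frob_norm_rows.
apply: (@le_trans _ _ (\sum_(i < m) b ^+ 2)); last by rewrite sumr_const card_ord mulr_natl.
by apply: ler_sum => i _; rewrite sqr_frob_norm; exact: frob_norm_sqr_le.
Qed.

Lemma dot_ones : dot (ones n) (ones n : 'cV[R]_n) = n%:R.
Proof.
rewrite /frob_dot; under eq_bigr do rewrite big_ord1 !mxE mulr1.
by rewrite sumr_const card_ord.
Qed.

Lemma nrm_ones : nrm (ones n : 'cV[R]_n) = rtn.
Proof. by rewrite /frob_norm dot_ones. Qed.

Lemma nrm_rows_bounded Y b : 0 <= b -> rows_bounded b Y -> nrm Y <= b * rtn.
Proof.
move=> b0 h; apply: frob_norm_le; first by rewrite mulr_ge0 ?rtn_ge0.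
by rewrite exprMn rtn_sqr mulrC; exact: rows_bounded_frob.
Qed.

Lemma nrm_design Y b : 0 <= b -> rows_bounded b Y -> nrm (design Y) <= (1 + b) * rtn.
Proof.
move=> b0 h; apply: frob_norm_le; first by rewrite mulr_ge0 ?rtn_ge0 ?addr_ge0.
rewrite frob_dot_row_mx dot_ones exprMn rtn_sqr.
have h1 : dot (positions Y) (positions Y) <= n%:R * b ^+ 2.
  by apply: le_trans (rows_bounded_frob h); rewrite (frob_dot_split Y) lerDl frob_dot_ge0.
have : 0 <= n%:R * b :> R by rewrite mulr_ge0.
by move: h1; lra.
Qed.

Lemma row_design Y i : row i (design Y) = row_mx (row i (positions Y)) 1%:M.
Proof.
rewrite row_row_mx; congr row_mx; apply/matrixP => a c.
by rewrite !mxE !ord1 eqxx.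
Qed.

Lemma nrm_row_design Y b i : 0 <= b -> rows_bounded b Y -> nrm (row i (design Y)) <= 1 + b.
Proof.
move=> b0 h; apply: frob_norm_le; first by rewrite addr_ge0.
rewrite row_design frob_dot_row_mx.
have h1 : dot (row i (positions Y)) (row i (positions Y)) <= b ^+ 2.
  apply: le_trans (frob_norm_sqr_le (h i)).
  rewrite {3 4}(splitY Y) row_row_mx frob_dot_row_mx lerDl frob_dot_ge0 //.
have -> : dot (1%:M : 'M[R]_1) 1%:M = 1 by rewrite /frob_dot !big_ord1 !mxE eqxx mulr1.
by move: h1; lra.
Qed.

Lemma Theta_diff Y Y' : Theta_mx Y - Theta_mx Y' =
  (Y - Y') *m (design Y)^T + design Y' *m (Y - Y')^T.
Proof.
have trB (m q : nat) (a b : 'M[R]_(m, q)) : (a - b)^T = a^T - b^T by exact: linearB.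
rewrite -[design Y' *m _]trmxK trmx_mul trmxK !mul_design.
have trD (m q : nat) (a b : 'M[R]_(m, q)) : (a + b)^T = a^T + b^T by exact: linearD.
rewrite !Theta_mxE !positionsB !degreesB trD !trmx_mul !trmxK !trB.
rewrite !mulmxBl !mulmxBr; apply/matrixP => i j; rewrite !mxE; ring.
Qed.

Lemma Theta_diff_le Y Y' b : 0 <= b -> rows_bounded b Y -> rows_bounded b Y' ->
  nrm (Theta_mx Y - Theta_mx Y') <= 2 * (1 + b) * rtn * nrm (Y - Y').
Proof.
move=> b0 hY hY'; rewrite Theta_diff.
apply: le_trans (frob_normD _ _) _.
have h1 := frob_norm_mulmx (Y - Y') (design Y)^T.
have h2 := frob_norm_mulmx (design Y') (Y - Y')^T.
rewrite !frob_norm_tr in h1 h2.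
have h3 := nrm_design b0 hY; have h4 := nrm_design b0 hY'.
have := frob_norm_ge0 (Y - Y'); nra.
Qed.

Lemma Theta_diff_diag Y Y' b : 0 <= b -> rows_bounded b Y -> rows_bounded b Y' ->
  \sum_i (Theta_mx Y - Theta_mx Y') i i ^+ 2 <= 4 * (1 + b) ^+ 2 * nrm (Y - Y') ^+ 2.
Proof.
move=> b0 hY hY'; rewrite [nrm _ ^+ 2]sqr_frob_norm_rows mulr_sumr; apply: ler_sum => i _.
rewrite Theta_diff mxE !mulmx_entry_dot.
set a := nrm (row i (Y - Y')).
have h1 := frob_cauchy_schwarz (row i (Y - Y'))^T (col i (design Y)^T).
have h2 := frob_cauchy_schwarz (row i (design Y'))^T (col i (Y - Y')^T).
rewrite -!tr_row !frob_norm_tr -/a in h1 h2.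
have h3 := nrm_row_design i b0 hY; have h4 := nrm_row_design i b0 hY'.
have a0 : 0 <= a by exact: frob_norm_ge0.
rewrite -!tr_row.
move: (dot _ _) (dot _ _) h1 h2 => x y h1 h2.
have h5 : `|x + y| <= 2 * (1 + b) * a.
  apply: le_trans (ler_normD _ _) _.
  have : a * nrm (row i (design Y)) <= a * (1 + b) by rewrite ler_wpM2l.
  have : nrm (row i (design Y')) * a <= (1 + b) * a by rewrite ler_wpM2r.
  by lra.
rewrite -[X in X <= _]real_normK ?num_real //.
apply: (@le_trans _ _ ((2 * (1 + b) * a) ^+ 2)); last by rewrite le_eqVlt; apply/orP; left; apply/eqP; ring.
rewrite addrC ler_pXn2r ?nnegrE //; exact: le_trans h5.
Qed.

Lemma Theta_le Y b i j : 0 <= b -> rows_bounded b Y -> `|Theta Y i j| <= (1 + b) ^+ 2.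
Proof.
move=> b0 h.
have hZ i' : nrm (row i' (positions Y)) <= b.
  apply: le_trans (h i'); apply: frob_norm_le_sqr.
  by rewrite {3 4}(splitY Y) row_row_mx frob_dot_row_mx lerDl frob_dot_ge0.
have ha i' : `|degrees Y i' 0| <= b.
  apply: le_trans (h i'); apply: le_trans (frob_norm_entry_le _ 0 (rshift k 0)).
  by rewrite /degrees !mxE.
have h1 : `|\sum_(l < k) positions Y i l * positions Y j l| <= b * b.
  have -> : \sum_(l < k) positions Y i l * positions Y j l =
    dot (row i (positions Y)) (row j (positions Y)).
    by rewrite /frob_dot big_ord1; apply: eq_bigr => l _; rewrite [in RHS]mxE [in X in _ = _ * X]mxE.
  apply: le_trans (frob_cauchy_schwarz _ _) _.
  by rewrite ler_pM ?frob_norm_ge0.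
rewrite /Theta.
have := ha i; have := ha j; move: h1; rewrite !ler_norml => /andP[? ?] /andP[? ?] /andP[? ?].
by apply/andP; split; nra.
Qed.

Lemma offdiag_sqE (M : 'M[R]_n) : offdiag_sq M + \sum_i M i i ^+ 2 = nrm M ^+ 2.
Proof.
rewrite sqr_frob_norm /frob_dot /offdiag_sq -big_split; apply: eq_bigr => i _ /=.
rewrite [RHS](bigD1 i) //= addrC -expr2; congr (_ + _).
Qed.

Lemma offdiag_sq_le (M : 'M[R]_n) : offdiag_sq M <= nrm M ^+ 2.
Proof. by rewrite -offdiag_sqE lerDl; apply: sumr_ge0 => i _; rewrite sqr_ge0. Qed.

End Geometry.

(** * Quadratic growth and gradient bounds around a stationary point *)

Section StationaryGeometry.
Context {R : realType} {n k : nat}.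
Implicit Types (Y U : 'M[R]_(n, k + 1)).
Local Notation dot := frob_dot.
Local Notation nrm := frob_norm.
Local Notation rtn := (Num.sqrt (n%:R : R)).
Variables (p : R -> R -> R) (A : 'M[R]_n).
Hypothesis symA : A^T = A.
Hypothesis loglik_diff : forall i j, i != j -> forall theta : R,
  is_derive theta 1 (loglik p ^~ (A i j)) (dloglik p 1 theta (A i j)).

(** The conclusions of [procrustes], for Yh already rotated onto Y. *)
Definition aligned Y Yh : Prop :=
  [/\ ((positions Y)^T *m positions Yh)^T = (positions Y)^T *m positions Yh,
      forall v : 'rV[R]_k, 0 <= dot (v *m ((positions Y)^T *m positions Yh)) v
    & forall Q, orthogonal_mx Q ->
        nrm (positions Y - positions Yh) <= nrm (positions Y - positions Yh *m Q)].

Definition well_conditioned (m : R) Y : Prop :=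
  forall v : 'rV[R]_k, m * n%:R * dot v v <= dot (v *m (positions Y)^T) (v *m (positions Y)^T).

Lemma centered_tr Y : centered Y -> (positions Y)^T *m ones n = 0.
Proof. by move=> h; rewrite -[LHS]trmxK trmx_mul trmxK h trmx0. Qed.

(** By centering, the difference of Gram matrices is orthogonal to the degree part, so their squared
    norms add. The first is bounded by [gram_lower], the second is at least 2 n times the squared
    degree error. *)
Lemma Theta_lower Y Yh mu : mu <= 2 -> centered Y -> centered Yh -> aligned Y Yh ->
  well_conditioned (2 * mu) Yh ->
  mu * n%:R * nrm (Y - Yh) ^+ 2 <= nrm (Theta_mx Y - Theta_mx Yh) ^+ 2.
Proof.
move=> mu2 cY cYh [sym psd _] wc.
pose G : 'M[R]_n := positions Y *m (positions Y)^T - positions Yh *m (positions Yh)^T.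
have := gram_lower sym psd wc; rewrite -/G => hG.
pose a : 'cV[R]_n := degrees Y - degrees Yh.
have e : Theta_mx Y - Theta_mx Yh = G + (a *m (ones n)^T + ones n *m a^T).
  have trB (m' q : nat) (B C : 'M[R]_(m', q)) : (B - C)^T = B^T - C^T by exact: linearB.
  rewrite !Theta_mxE /G /a trB mulmxBl mulmxBr; apply/matrixP => i j; rewrite !mxE; ring.
have oG : dot G (a *m (ones n)^T) = 0.
  rewrite frob_dotC frob_dot_mulmxr trmxK mulmxBl -!mulmxA !centered_tr // !mulmx0 subr0.
  exact: frob_dot0r.
have symG : G^T = G.
  have trB (m' q : nat) (B C : 'M[R]_(m', q)) : (B - C)^T = B^T - C^T by exact: linearB.
  by rewrite /G trB !trmx_mul !trmxK.
have oG' : dot G (ones n *m a^T) = 0.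
  by rewrite -frob_dot_tr symG trmx_mul trmxK.
have ea : degrees Y - degrees Yh = a by []; clearbody G a.
rewrite e [leRHS]sqr_frob_norm !frob_dotE oG oG' !(frob_dotC _ G) oG oG'.
have e1 : dot (a *m (ones n)^T) (a *m (ones n)^T) = n%:R * dot a a.
  rewrite frob_dot_mulmxr trmxK -mulmxA.
  have -> : (ones n)^T *m ones n = (n%:R)%:M :> 'M[R]_1.
    apply/matrixP => i j; rewrite !ord1 !mxE; under eq_bigr do rewrite !mxE mulr1.
    by rewrite sumr_const card_ord mulr1n.
  by rewrite mul_mx_scalar frob_dotE.
have e2 : dot (ones n *m a^T) (ones n *m a^T) = n%:R * dot a a.
  by rewrite -e1 -[RHS]frob_dot_tr trmx_mul trmxK.
have e3 : 0 <= dot (a *m (ones n)^T) (ones n *m a^T).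
  rewrite frob_dot_mulmxr trmxK -mulmxA.
  rewrite (_ : a^T *m ones n = (dot a (ones n))%:M); last first.
    apply/matrixP => i j; rewrite !ord1 !mxE /frob_dot mulr1n; apply: eq_bigr => l _.
    by rewrite big_ord1 mxE.
  by rewrite mul_mx_scalar frob_dotE -expr2 sqr_ge0.
rewrite (frob_dotC (ones n *m _)) e1 e2 -sqr_frob_norm.
rewrite sqr_frob_norm frob_dot_split positionsB degreesB ea -sqr_frob_norm.
have n0 : 0 <= n%:R :> R by [].
have := frob_dot_ge0 a; move: hG e3.
have -> : 2 * mu * n%:R / 2 = mu * n%:R by field.
move: (dot a a) (nrm _ ^+ 2) (nrm G ^+ 2) (dot _ _) => x y z u hG e3 x0.
have : mu * (n%:R * x) <= 2 * (n%:R * x) by rewrite ler_wpM2r // mulr_ge0.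
by lra.
Qed.

Variables (b k1 k2 mu w : R) (Yh : 'M[R]_(n, k + 1)).
Hypotheses (b0 : 0 <= b) (k10 : 0 < k1) (k20 : 0 < k2) (mu0 : 0 < mu) (mu2 : mu <= 2)
  (w0 : 0 <= w) (w1 : w <= 1).
Hypothesis hc : forall i j, i != j ->
  curvature_bounds (loglik p ^~ (A i j)) (dloglik p 1 ^~ (A i j)) ((1 + b) ^+ 2) k1 k2.
Hypotheses (bYh : rows_bounded b Yh) (cYh : centered Yh)
  (stat : score p A Yh *m design Yh = 0) (opF : op_bounded (w * n%:R) (score p A Yh))
  (wc : well_conditioned (2 * mu) Yh).

Local Notation F := (score p A Yh).

Lemma stationary_positions : F *m positions Yh = 0.
Proof.
move: stat; rewrite /design mul_mx_row -(row_mx0 R n k 1) => e.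
by move/eq_row_mx: e => [].
Qed.

(** Stationarity kills the linear part of the change of [Theta_mx]. What remains is quadratic in the
    displacement, and therefore controlled by the operator norm of the score matrix. *)
Lemma stationary_dot Y :
  dot F (Theta_mx Y - Theta_mx Yh) = dot (F *m (positions (Y - Yh))) (positions (Y - Yh)).
Proof.
have e : Theta_mx Y - Theta_mx Yh = positions (Y - Yh) *m (positions (Y - Yh))^T
    + ((Y - Yh) *m (design Yh)^T + design Yh *m (Y - Yh)^T).
  have := Theta_mxD Yh (Y - Yh); rewrite (addrC Yh) subrK => ->.
  by rewrite addrAC (addrC (Theta_mx Yh)) addrK addrC.
rewrite e !frob_dotE.
have z1 U : dot F (U *m (design Yh)^T) = 0.
  by rewrite frob_dotC frob_dot_mulmxr trmxK stat frob_dot0r.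
have z2 U : dot F (design Yh *m U^T) = 0.
  by rewrite -frob_dot_tr score_sym // trmx_mul trmxK z1.
rewrite z1 z2 !addr0 [LHS]frob_dotC frob_dot_mulmxr trmxK.
by rewrite frob_dotC.
Qed.

Lemma stationary_quad Y :
  `|dot (F *m positions (Y - Yh)) (positions (Y - Yh))| <= w * n%:R * nrm (Y - Yh) ^+ 2.
Proof.
apply: le_trans (frob_cauchy_schwarz _ _) _.
have wn : 0 <= w * n%:R by rewrite mulr_ge0.
have h1 := op_bounded_mulmx (positions (Y - Yh)) wn opF.
have h2 := positions_le (Y - Yh).
have h3 := frob_norm_ge0 (positions (Y - Yh)).
have h4 := frob_norm_ge0 (F *m positions (Y - Yh)).
apply: (@le_trans _ _ ((w * n%:R * nrm (Y - Yh)) * nrm (Y - Yh))); last by rewrite expr2 mulrA.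
by apply: ler_pM => //; apply: le_trans h1 _; rewrite ler_wpM2l.
Qed.

(** The diagonal carries no data. It accounts for at most 4 (1 + b)^2 times the squared
    displacement, which is half of the lower bound from [Theta_lower] once n is large. *)
Lemma offdiag_lower Y : rows_bounded b Y -> centered Y -> aligned Y Yh ->
  8 * (1 + b) ^+ 2 <= mu * n%:R ->
  mu / 2 * n%:R * nrm (Y - Yh) ^+ 2 <= offdiag_sq (Theta_mx Y - Theta_mx Yh).
Proof.
move=> bY cY al hn.
have h1 := Theta_lower mu2 cY cYh al wc.
have h2 := Theta_diff_diag b0 bY bYh.
have := offdiag_sqE (Theta_mx Y - Theta_mx Yh).
have := sqr_ge0 (nrm (Y - Yh)); move: h1 h2.
move: (nrm (Y - Yh) ^+ 2) => x h1 h2 x0 e.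
have : 8 * (1 + b) ^+ 2 * x <= mu * n%:R * x by rewrite ler_wpM2r.
by lra.
Qed.

Lemma loss_growth Y : rows_bounded b Y -> centered Y -> aligned Y Yh ->
  8 * (1 + b) ^+ 2 <= mu * n%:R -> w <= k1 * mu / 8 ->
  k1 * mu / 16 * n%:R * nrm (Y - Yh) ^+ 2 <= loss p A Y - loss p A Yh.
Proof.
move=> bY cY al hn hw.
have [h _] := loss_sandwich symA hc (fun i j => Theta_le i j b0 bYh) (fun i j => Theta_le i j b0 bY).
have h1 := offdiag_lower bY cY al hn.
have h2 := stationary_quad Y; rewrite -stationary_dot ler_norml in h2.
have /andP[_ h3] := h2.
have h4 : k1 / 4 * (mu / 2 * n%:R * nrm (Y - Yh) ^+ 2) <=
  k1 / 4 * offdiag_sq (Theta_mx Y - Theta_mx Yh) by rewrite ler_pM2l // divr_gt0.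
have x0 : 0 <= n%:R * nrm (Y - Yh) ^+ 2 by rewrite mulr_ge0 // sqr_ge0.
have : w * (n%:R * nrm (Y - Yh) ^+ 2) <= k1 * mu / 8 * (n%:R * nrm (Y - Yh) ^+ 2).
  by rewrite ler_wpM2r.
by lra.
Qed.

Lemma loss_upper Y : rows_bounded b Y ->
  loss p A Y - loss p A Yh <= (k2 * (1 + b) ^+ 2 + 1) * n%:R * nrm (Y - Yh) ^+ 2.
Proof.
move=> bY.
have [_ h] := loss_sandwich symA hc (fun i j => Theta_le i j b0 bYh) (fun i j => Theta_le i j b0 bY).
have h1 := offdiag_sq_le (Theta_mx Y - Theta_mx Yh).
have h2 := stationary_quad Y; rewrite -stationary_dot ler_norml in h2.
have /andP[h3 _] := h2.
have h4 : k2 / 4 * offdiag_sq (Theta_mx Y - Theta_mx Yh) <=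
    k2 / 4 * (4 * (1 + b) ^+ 2 * n%:R * nrm (Y - Yh) ^+ 2).
  rewrite ler_pM2l ?divr_gt0 //; apply: le_trans h1 _.
  have h5 := Theta_diff_le b0 bY bYh.
  apply: (@le_trans _ _ ((2 * (1 + b) * rtn * nrm (Y - Yh)) ^+ 2)).
    rewrite ler_pXn2r ?nnegrE ?frob_norm_ge0 //; exact: le_trans (frob_norm_ge0 _) h5.
  by rewrite !exprMn rtn_sqr; lra.
have x0 : 0 <= n%:R * nrm (Y - Yh) ^+ 2 by rewrite mulr_ge0 // sqr_ge0.
have : w * (n%:R * nrm (Y - Yh) ^+ 2) <= 1 * (n%:R * nrm (Y - Yh) ^+ 2).
  by rewrite ler_wpM2r.
by lra.
Qed.

Lemma score_diff_le Y : rows_bounded b Y ->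
  nrm (score p A Y - F) <= k2 * (2 * (1 + b)) * rtn * nrm (Y - Yh).
Proof.
move=> bY.
have h := score_lipschitz (ltW k20) hc (fun i j => Theta_le i j b0 bY) (fun i j => Theta_le i j b0 bYh).
apply: le_trans h _; rewrite -!mulrA ler_pM2l // !mulrA.
by have := Theta_diff_le b0 bY bYh; lra.
Qed.

Lemma gradient_upper Y : rows_bounded b Y ->
  nrm (score p A Y *m design Y) <= (2 * k2 * (1 + b) ^+ 2 + 1) * n%:R * nrm (Y - Yh).
Proof.
move=> bY.
have -> : score p A Y *m design Y = (score p A Y - F) *m design Y + F *m (design Y - design Yh).
  by rewrite mulmxBl mulmxBr stat subr0 subrK.
apply: le_trans (frob_normD _ _) _.
have h1 := frob_norm_mulmx (score p A Y - F) (design Y).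
have h2 := score_diff_le bY; have h3 := nrm_design b0 bY.
have wn : 0 <= w * n%:R by rewrite mulr_ge0.
have h4 := op_bounded_mulmx (design Y - design Yh) wn opF.
have h5 : nrm (design Y - design Yh) <= nrm (Y - Yh).
  have -> : design Y - design Yh = row_mx (positions (Y - Yh)) 0.
    by rewrite /design opp_row_mx add_row_mx subrr positionsB.
  apply: frob_norm_le_sqr; rewrite frob_dot_row_mx frob_dot0l addr0 [leRHS]frob_dot_split.
  by rewrite lerDl frob_dot_ge0.
have D0 := frob_norm_ge0 (Y - Yh).
have h6 : nrm (score p A Y - F) * nrm (design Y) <=
    (k2 * (2 * (1 + b)) * rtn * nrm (Y - Yh)) * ((1 + b) * rtn).
  by apply: ler_pM; rewrite ?frob_norm_ge0.
have h7 : (k2 * (2 * (1 + b)) * rtn * nrm (Y - Yh)) * ((1 + b) * rtn) =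
    2 * k2 * (1 + b) ^+ 2 * n%:R * nrm (Y - Yh).
  by have := @rtn_sqr R n; move: (Num.sqrt _) => r <-; ring.
have h8 : w * n%:R * nrm (design Y - design Yh) <= 1 * n%:R * nrm (Y - Yh).
  by apply: ler_pM => //; [exact: frob_norm_ge0|rewrite ler_wpM2r].
by lra.
Qed.

(** One-point strong convexity towards Yh. Let T be the change of [Theta_mx], Q the Gram matrix of
    the position displacement, and F, S the scores at Yh and Y. Twice the right-hand side is <F - S,
    T> + <F - S, Q> - 2 <F, T>. The first term is at least k1 times the off-diagonal square of T;
    the second is small because the displacement is at most delta sqrt n; the third is small by
    stationarity. *)
Lemma gradient_lower Y delta : rows_bounded b Y -> centered Y -> aligned Y Yh ->
  8 * (1 + b) ^+ 2 <= mu * n%:R -> nrm (Y - Yh) <= delta * rtn ->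
  k2 * (1 + b) * delta + w <= k1 * mu / 8 ->
  k1 * mu / 8 * n%:R * nrm (Y - Yh) ^+ 2 <= - dot (score p A Y *m design Y) (Y - Yh).
Proof.
move=> bY cY al hn hD hsm.
set D := Y - Yh; set S := score p A Y; set T := Theta_mx Y - Theta_mx Yh.
pose Q := positions D *m (positions D)^T.
have e : D *m (design Y)^T + design Y *m D^T = T + Q.
  have trB (m' q : nat) (B C : 'M[R]_(m', q)) : (B - C)^T = B^T - C^T by exact: linearB.
  have eD : design Y = design Yh + row_mx (positions D) 0.
    by rewrite /design add_row_mx addr0 positionsB addrC subrK.
  rewrite /T Theta_diff -/D {2}eD [X in _ + X = _]mulmxDl addrA; congr (_ + _).
  by rewrite {2}(splitY D) tr_row_mx mul_row_col mul0mx addr0.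
have eg : dot (S *m design Y) D = 1 / 2 * dot S (T + Q).
  rewrite -e [in RHS]frob_dotDr [LHS]frob_dot_mulmxr -[dot _ (design Y *m _)]frob_dot_tr.
  by rewrite score_sym // trmx_mul trmxK; field.
(* T and Q differ by the linear part of the change at Yh, which F annihilates. *)
have eQ : dot F Q = dot F T.
  by rewrite stationary_dot /Q [LHS]frob_dotC frob_dot_mulmxr trmxK frob_dotC.
have h1 := offdiag_lower bY cY al hn; rewrite -/D -/T in h1.
have h2 := score_monotone hc (fun i j => Theta_le i j b0 bYh) (fun i j => Theta_le i j b0 bY).
rewrite -/S -/T in h2.
have h3 := stationary_quad Y; rewrite -stationary_dot -/T -/D ler_norml in h3.
have /andP[_ h4] := h3.
have h5 := frob_cauchy_schwarz (F - S) Q; rewrite ler_norml in h5.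
have /andP[h6 _] := h5.
have h7 : nrm (F - S) * nrm Q <= k2 * (2 * (1 + b)) * delta * (n%:R * nrm D ^+ 2).
  rewrite frob_distC; have h := score_diff_le bY; rewrite -/S -/D in h.
  have hQ : nrm Q <= nrm D * nrm D.
    apply: le_trans (frob_norm_mulmx _ _) _; rewrite frob_norm_tr.
    by apply: ler_pM; rewrite ?frob_norm_ge0 ?positions_le.
  apply: (@le_trans _ _ ((k2 * (2 * (1 + b)) * rtn * nrm D) * (nrm D * nrm D))).
    by apply: ler_pM; rewrite ?frob_norm_ge0.
  have -> : k2 * (2 * (1 + b)) * rtn * nrm D * (nrm D * nrm D) =
    (k2 * (2 * (1 + b)) * rtn * nrm D ^+ 2) * nrm D by ring.
  have -> : k2 * (2 * (1 + b)) * delta * (n%:R * nrm D ^+ 2) =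
    (k2 * (2 * (1 + b)) * rtn * nrm D ^+ 2) * (delta * rtn) by have := @rtn_sqr R n; move: (Num.sqrt _) => r <-; ring.
  rewrite ler_wpM2l // mulr_ge0 ?sqr_ge0 // mulr_ge0 ?rtn_ge0 // mulr_ge0 ?(ltW k20) //.
  by rewrite mulr_ge0 // addr_ge0.
have x0 : 0 <= n%:R * nrm D ^+ 2 by rewrite mulr_ge0 // sqr_ge0.
have h8 : (k2 * (1 + b) * delta + w) * (n%:R * nrm D ^+ 2) <= k1 * mu / 8 * (n%:R * nrm D ^+ 2).
  by rewrite ler_wpM2r.
have h9 : k1 * (mu / 2 * n%:R * nrm D ^+ 2) <= k1 * offdiag_sq T by rewrite ler_pM2l.
have eST : dot S (T + Q) = dot S T + dot S Q by exact: frob_dotDr.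
have eT : dot (F - S) T = dot F T - dot S T by rewrite [LHS]frob_dotDl [X in _ + X]frob_dotNl.
have eQ' : dot (F - S) Q = dot F Q - dot S Q by rewrite [LHS]frob_dotDl [X in _ + X]frob_dotNl.
rewrite eT in h2; rewrite eQ' eQ in h6; rewrite eg eST.
move: (dot S T) (dot S Q) (dot F T) (nrm _ * nrm _) (offdiag_sq T) (nrm D ^+ 2) h1 h2 h4 h6 h7 h8 h9.
by move=> x1 x2 x3 x4 x5 x6; lra.
Qed.

End StationaryGeometry.

(** * The loss of one row with the other rows frozen *)

Section RowObjective.
Context {R : realType} {n k : nat}.
Implicit Types (Y U : 'M[R]_(n, k + 1)) (y u : 'rV[R]_(k + 1)) (i : 'I_n).
Local Notation dot := frob_dot.
Local Notation nrm := frob_norm.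
Local Notation rtn := (Num.sqrt (n%:R : R)).
Variables (p : R -> R -> R) (A : 'M[R]_n).
Hypothesis symA : A^T = A.
Hypothesis loglik_diff : forall i j, i != j -> forall theta : R,
  is_derive theta 1 (loglik p ^~ (A i j)) (dloglik p 1 theta (A i j)).

Definition row_theta y Y : 'rV[R]_n := y *m (design Y)^T + (degrees Y)^T.

(** Row i of the parameter is replaced by y and all other rows are read from Y. The parameters are
    affine in y, so this is convex in y, unlike the full loss. *)
Definition row_obj i y Y : R := - \sum_(j < n | j != i) loglik p (row_theta y Y 0 j) (A i j).

Definition row_score i y Y : 'rV[R]_n :=
  \row_j if i == j then 0 else dloglik p 1 (row_theta y Y 0 j) (A i j).

Definition row_grad i y Y : 'rV[R]_(k + 1) := - (row_score i y Y *m design Y).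

Lemma row_mul_design y Y j : (y *m (design Y)^T) 0 j = dot y (row j (design Y)).
Proof.
rewrite mulmx_entry_dot -tr_row frob_dot_tr; congr dot.
by apply/rowP => l; rewrite mxE.
Qed.

Lemma row_Theta_mx Y i : row_theta (row i Y) Y = row i (Theta_mx Y).
Proof.
have -> : Theta_mx Y = Y *m (design Y)^T + ones n *m (degrees Y)^T.
  by rewrite mul_design Theta_mxE addrA.
rewrite linearD /= !row_mul /row_theta; congr (_ + _).
have -> : row i (ones n : 'cV[R]_n) = 1%:M by apply/matrixP => a c; rewrite !ord1 !mxE eqxx.
by rewrite mul1mx.
Qed.

Lemma row_theta_row Y i j : row_theta (row i Y) Y 0 j = Theta Y i j.
Proof. by rewrite row_Theta_mx !mxE. Qed.

Lemma row_score_row Y i : row_score i (row i Y) Y = row i (score p A Y).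
Proof. by apply/rowP => j; rewrite [LHS]mxE row_theta_row !mxE. Qed.

Lemma row_grad_row Y i : row_grad i (row i Y) Y = - row i (score p A Y *m design Y).
Proof. by rewrite /row_grad row_score_row -row_mul. Qed.

Lemma row_loss_update Y U i : (forall j, j != i -> row j U = 0) ->
  row_loss p A i (Y + U) = row_obj i (row i Y + row i U) Y.
Proof.
move=> hU; rewrite /row_loss /row_obj; congr (- _); apply: eq_bigr => j ji.
congr (loglik p _ _).
have hUj c : U j c = 0 by have /rowP/(_ c) := hU j ji; rewrite !mxE.
have -> : Theta (Y + U) i j = Theta_mx (Y + U) i j by rewrite mxE.
rewrite Theta_mxD.
have -> : (Theta_mx Y + (U *m (design Y)^T + design Y *m U^T) + positions U *m (positions U)^T) i j
  = Theta_mx Y i j + (U *m (design Y)^T) i j.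
  rewrite mxE [X in X + _]mxE [X in _ + X + _]mxE.
  rewrite [(design Y *m _) i j]mxE big1 ?addr0 => [|c _]; last by rewrite [X in _ * X]mxE hUj mulr0.
  rewrite [(positions U *m _) i j]mxE big1 ?addr0 => [|c _] //.
  by rewrite [X in _ * X]mxE /positions [X in _ * X]mxE hUj mulr0.
have -> : row_theta (row i Y + row i U) Y = row_theta (row i Y) Y + row i (U *m (design Y)^T).
  by rewrite /row_theta mulmxDl addrAC row_mul.
by rewrite [RHS]mxE row_theta_row [X in _ = _ + X]mxE; congr (_ + _); rewrite mxE.
Qed.

Lemma row_theta_diff y y' Y : row_theta y' Y - row_theta y Y = (y' - y) *m (design Y)^T.
Proof. by rewrite /row_theta opprD addrACA subrr addr0 mulmxBl. Qed.

Lemma row_theta_le y Y b j : 0 <= b -> nrm y <= b -> rows_bounded b Y ->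
  `|row_theta y Y 0 j| <= (1 + b) ^+ 2.
Proof.
move=> b0 hy hY; rewrite mxE.
have ha : `|(degrees Y)^T 0 j| <= b.
  apply: le_trans (hY j); apply: le_trans (frob_norm_entry_le _ 0 (rshift k 0)).
  by rewrite /degrees !mxE.
have h1 : `|(y *m (design Y)^T) 0 j| <= b * (1 + b).
  rewrite row_mul_design; apply: le_trans (frob_cauchy_schwarz _ _) _.
  by apply: ler_pM; rewrite ?frob_norm_ge0 //; exact: nrm_row_design.
apply: le_trans (ler_normD _ _) _; nra.
Qed.

Definition row_increment_sq i u Y : R := \sum_(j < n | j != i) (u *m (design Y)^T) 0 j ^+ 2.

Lemma row_dot i y u Y :
  dot (row_grad i y Y) u = - \sum_(j < n | j != i)
     dloglik p 1 (row_theta y Y 0 j) (A i j) * (u *m (design Y)^T) 0 j.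
Proof.
rewrite /row_grad frob_dotNl frob_dot_mulmxr /frob_dot big_ord1 [in RHS]big_mkcond.
congr (- _); apply: eq_bigr => j _; rewrite [X in X * _]mxE eq_sym.
by case: eqP => //=; rewrite mul0r.
Qed.

Lemma row_obj_sandwich i y y' Y (b k1 k2 : R) :
  (forall j, i != j -> curvature_bounds (loglik p ^~ (A i j)) (dloglik p 1 ^~ (A i j)) b k1 k2) ->
  (forall j, `|row_theta y Y 0 j| <= b) -> (forall j, `|row_theta y' Y 0 j| <= b) ->
  row_obj i y Y + dot (row_grad i y Y) (y' - y) + k1 / 2 * row_increment_sq i (y' - y) Y
    <= row_obj i y' Y /\
  row_obj i y' Y <= row_obj i y Y + dot (row_grad i y Y) (y' - y)
    + k2 / 2 * row_increment_sq i (y' - y) Y.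
Proof.
move=> hc hy hy'; rewrite row_dot /row_obj /row_increment_sq.
have key (c : R) : - \sum_(j < n | j != i) loglik p (row_theta y Y 0 j) (A i j)
    - \sum_(j < n | j != i) dloglik p 1 (row_theta y Y 0 j) (A i j) * ((y' - y) *m (design Y)^T) 0 j
    + c / 2 * \sum_(j < n | j != i) ((y' - y) *m (design Y)^T) 0 j ^+ 2 =
    \sum_(j < n | j != i) (- loglik p (row_theta y Y 0 j) (A i j)
    - dloglik p 1 (row_theta y Y 0 j) (A i j) * ((y' - y) *m (design Y)^T) 0 j
    + c / 2 * ((y' - y) *m (design Y)^T) 0 j ^+ 2).
  by rewrite mulr_sumr -!sumrN -!big_split.
rewrite !key -sumrN.
have e j : ((y' - y) *m (design Y)^T) 0 j = row_theta y' Y 0 j - row_theta y Y 0 j.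
  by rewrite -row_theta_diff !mxE.
have h j : j != i -> _ := fun ji => hc j ltac:(by rewrite eq_sym) _ _
  (ltac:(rewrite -ler_norml; exact: (hy j))) (ltac:(rewrite -ler_norml; exact: (hy' j))).
split; apply: ler_sum => j ji; rewrite e.
  by have [h1 _ _ _] := h j ji; lra.
by have [_ h2 _ _] := h j ji; lra.
Qed.

Lemma row_grad_monotone i y y' Y (b k1 k2 : R) :
  (forall j, i != j -> curvature_bounds (loglik p ^~ (A i j)) (dloglik p 1 ^~ (A i j)) b k1 k2) ->
  (forall j, `|row_theta y Y 0 j| <= b) -> (forall j, `|row_theta y' Y 0 j| <= b) ->
  k1 * row_increment_sq i (y' - y) Y <= dot (row_grad i y' Y - row_grad i y Y) (y' - y).
Proof.
move=> hc hy hy'; rewrite frob_dotDl frob_dotNl !row_dot /row_increment_sq opprK [leRHS]addrC -sumrB mulr_sumr.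
have e j : ((y' - y) *m (design Y)^T) 0 j = row_theta y' Y 0 j - row_theta y Y 0 j.
  by rewrite -row_theta_diff !mxE.
apply: ler_sum => j ji; rewrite e.
have [_ _ h _] := hc j ltac:(by rewrite eq_sym) _ _
    (ltac:(rewrite -ler_norml; exact: (hy j))) (ltac:(rewrite -ler_norml; exact: (hy' j))).
by rewrite -mulrBl.
Qed.

Lemma row_score_lipschitz i y Y y' Y' (b k1 k2 : R) : 0 <= k2 ->
  (forall j, i != j -> curvature_bounds (loglik p ^~ (A i j)) (dloglik p 1 ^~ (A i j)) b k1 k2) ->
  (forall j, `|row_theta y Y 0 j| <= b) -> (forall j, `|row_theta y' Y' 0 j| <= b) ->
  nrm (row_score i y Y - row_score i y' Y') <= k2 * nrm (row_theta y Y - row_theta y' Y').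
Proof.
move=> k20 hc hY hY'; apply: frob_norm_le; first by rewrite mulr_ge0 ?frob_norm_ge0.
rewrite exprMn sqr_frob_norm /frob_dot !big_ord1 mulr_sumr; apply: ler_sum => j _.
rewrite /row_score; have := hY j; have := hY' j.
move: (row_theta y Y) (row_theta y' Y') => T T' hT' hT; rewrite !mxE -!expr2.
have [_|ij] := eqVneq i j; first by rewrite subrr expr0n mulr_ge0 ?sqr_ge0.
have [_ _ _ h] := hc j ij _ _ (ltac:(rewrite -ler_norml; exact: hT)) (ltac:(rewrite -ler_norml; exact: hT')).
rewrite -exprMn -[X in X <= _]real_normK ?num_real // -[X in _ <= X]real_normK ?num_real //.
by rewrite ler_pXn2r ?nnegrE // normrM (ger0_norm k20).
Qed.

Lemma row_increment_upper i u Y b : 0 <= b -> rows_bounded b Y ->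
  row_increment_sq i u Y <= (1 + b) ^+ 2 * n%:R * nrm u ^+ 2.
Proof.
move=> b0 hY; apply: (@le_trans _ _ (nrm (u *m (design Y)^T) ^+ 2)).
  rewrite sqr_frob_norm /frob_dot big_ord1 (bigD1 i) //= /row_increment_sq.
  have -> : \sum_(j < n | j != i) (u *m (design Y)^T) 0 j ^+ 2 =
    \sum_(j < n | j != i) (u *m (design Y)^T) 0 j * (u *m (design Y)^T) 0 j.
    by apply: eq_bigr => j _; rewrite expr2.
  by rewrite lerDr -expr2 sqr_ge0.
have h1 := frob_norm_mulmx u (design Y)^T; rewrite frob_norm_tr in h1.
have h2 := nrm_design b0 hY.
apply: (@le_trans _ _ ((nrm u * ((1 + b) * rtn)) ^+ 2)); last first.
  by rewrite !exprMn rtn_sqr; lra.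
rewrite ler_pXn2r ?nnegrE ?mulr_ge0 ?frob_norm_ge0 ?rtn_ge0 ?addr_ge0 //.
by apply: le_trans h1 _; rewrite ler_wpM2l ?frob_norm_ge0.
Qed.

(** Centering decouples positions from degrees in the quadratic form of the design matrix, which is
    then at least 2 mu n; omitting the term j = i costs at most (1 + b)^2, half of it for large
    n. *)
Lemma row_increment_lower i u Y b mu : 0 <= b -> rows_bounded b Y -> 2 * mu <= 1 ->
  centered Y -> well_conditioned (2 * mu) Y -> (1 + b) ^+ 2 <= mu * n%:R ->
  mu * n%:R * nrm u ^+ 2 <= row_increment_sq i u Y.
Proof.
move=> b0 hY mu1 cY wc hn.
have e : nrm (u *m (design Y)^T) ^+ 2 =
    row_increment_sq i u Y + (u *m (design Y)^T) 0 i ^+ 2.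
  rewrite sqr_frob_norm /frob_dot big_ord1 (bigD1 i) //= addrC -expr2; congr (_ + _).
have h1 : (u *m (design Y)^T) 0 i ^+ 2 <= (1 + b) ^+ 2 * nrm u ^+ 2.
  rewrite row_mul_design -[X in X <= _]real_normK ?num_real // -exprMn.
  rewrite ler_pXn2r ?nnegrE ?mulr_ge0 ?frob_norm_ge0 ?addr_ge0 //.
  apply: le_trans (frob_cauchy_schwarz _ _) _; rewrite mulrC ler_wpM2r ?frob_norm_ge0 //.
  exact: nrm_row_design.
pose z : 'rV[R]_k := lsubmx u; pose a : 'rV[R]_1 := rsubmx u.
have eu : u = row_mx z a by rewrite hsubmxK.
have h2 : 2 * mu * n%:R * nrm u ^+ 2 <= nrm (u *m (design Y)^T) ^+ 2.
  rewrite !sqr_frob_norm {3 4}eu /design tr_row_mx mul_row_col !frob_dotE.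
  have c0 : dot (z *m (positions Y)^T) (a *m (ones n)^T) = 0.
    by rewrite frob_dotC frob_dot_mulmxr trmxK -mulmxA centered_tr // mulmx0 frob_dot0r.
  rewrite c0 (frob_dotC (a *m _) (z *m _)) c0 addr0 add0r.
  have -> : dot (a *m (ones n)^T) (a *m (ones n)^T) = n%:R * dot a a.
    rewrite frob_dot_mulmxr trmxK -mulmxA.
    have -> : (ones n)^T *m ones n = (n%:R)%:M :> 'M[R]_1.
      apply/matrixP => i' j'; rewrite !ord1 !mxE; under eq_bigr do rewrite !mxE mulr1.
      by rewrite sumr_const card_ord mulr1n.
    by rewrite mul_mx_scalar frob_dotE.
  have -> : dot u u = dot z z + dot a a by rewrite {1 2}eu frob_dot_row_mx.
  have := wc z; have : 2 * mu * (n%:R * dot a a) <= 1 * (n%:R * dot a a).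
    by rewrite ler_wpM2r // mulr_ge0 ?frob_dot_ge0.
  lra.
have : (1 + b) ^+ 2 * nrm u ^+ 2 <= mu * n%:R * nrm u ^+ 2 by rewrite ler_wpM2r ?sqr_ge0.
by lra.
Qed.

End RowObjective.

Section RowComparison.
Context {R : realType} {n k : nat}.
Implicit Types (Y U : 'M[R]_(n, k + 1)) (y u : 'rV[R]_(k + 1)) (i : 'I_n).
Local Notation dot := frob_dot.
Local Notation nrm := frob_norm.
Local Notation rtn := (Num.sqrt (n%:R : R)).
Variables (p : R -> R -> R) (A : 'M[R]_n).
Hypothesis loglik_diff : forall i j, i != j -> forall theta : R,
  is_derive theta 1 (loglik p ^~ (A i j)) (dloglik p 1 theta (A i j)).
Variables (K1 K2 : R -> R).
Hypothesis K1_gt0 : forall b, 0 < b -> 0 < K1 b.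
Hypothesis K2_gt0 : forall b, 0 < b -> 0 < K2 b.
Hypothesis hc : forall b, 0 < b -> forall i j, i != j ->
  curvature_bounds (loglik p ^~ (A i j)) (dloglik p 1 ^~ (A i j)) b (K1 b) (K2 b).

Local Notation obj := (row_obj p A).
Local Notation grad := (row_grad p A).

Definition theta_range (b : R) : R := (1 + b) ^+ 2.

Lemma theta_range_gt0 b : 0 <= b -> 0 < theta_range b.
Proof. by move=> b0; rewrite exprn_gt0 // ltr_pwDl. Qed.

Lemma row_obj_convex i y y' Y : obj i y Y + dot (grad i y Y) (y' - y) <= obj i y' Y.
Proof.
(* Convexity uses only that the curvature is nonnegative, so the radius may depend on the two
   points. *)
pose b := 1 + nrm (row_theta y Y) + nrm (row_theta y' Y).
have h1 := frob_norm_ge0 (row_theta y Y); have h2 := frob_norm_ge0 (row_theta y' Y).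
have b0 : 0 < b by rewrite /b; lra.
have [||h _] := @row_obj_sandwich R n k p A i y y' Y b (K1 b) (K2 b) (hc b0 (i := i)).
- by move=> j; apply: le_trans (frob_norm_entry_le _ 0 j) _; rewrite /b; lra.
- by move=> j; apply: le_trans (frob_norm_entry_le _ 0 j) _; rewrite /b; lra.
apply: le_trans h; rewrite lerDl; apply: mulr_ge0.
  by rewrite divr_ge0 // ltW // K1_gt0.
by apply: sumr_ge0 => j _; rewrite sqr_ge0.
Qed.

Lemma row_obj_line i y u Y (t : R) :
  is_derive t 1 (fun t : R => obj i (y + t *: u) Y) (dot (grad i (y + t *: u) Y) u).
Proof.
rewrite row_dot -sumrN.
have -> : (fun t : R => obj i (y + t *: u) Y) = (fun t : R =>
    \sum_(j < n | j != i) - loglik p (row_theta (y + t *: u) Y 0 j) (A i j)).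
  by apply/funext => t'; rewrite /row_obj sumrN.
apply: is_derive_big => j ji; apply: is_deriveN.
set c := (u *m _) 0 j.
have e (t' : R) : row_theta (y + t' *: u) Y 0 j = row_theta y Y 0 j + t' * c.
  rewrite /row_theta mulmxDl -scalemxAl /c; move: (u *m _) (y *m _) => B C.
  by rewrite !mxE; ring.
have dT : is_derive t 1 (fun t : R => row_theta (y + t *: u) Y 0 j) c.
  under eq_fun do rewrite e.
  apply: is_derive_eq.
  by rewrite /GRing.scale /=; ring.
have ij : i != j by rewrite eq_sym.
have dl := loglik_diff ij (row_theta (y + t *: u) Y 0 j).
exact: (@is_derive1_comp _ (loglik p ^~ (A i j)) (fun t : R => row_theta (y + t *: u) Y 0 j) t _ _ dl dT).
Qed.

(** The mean value theorem for the difference of the two row objectives along the segment. It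
    transfers the decrease ensured by (LS2) from the current iterate to the truth. *)
Lemma row_obj_compare i y u Y Y' c :
  (forall t : R, 0 <= t <= 1 -> nrm (grad i (y + t *: u) Y - grad i (y + t *: u) Y') <= c) ->
  obj i (y + u) Y' - obj i y Y' <= obj i (y + u) Y - obj i y Y + c * nrm u.
Proof.
move=> h.
have dphi (t : R) : is_derive t 1 (fun t : R => obj i (y + t *: u) Y' - obj i (y + t *: u) Y)
    (dot (grad i (y + t *: u) Y') u - dot (grad i (y + t *: u) Y) u).
  exact: (is_deriveB (row_obj_line i y u Y' t) (row_obj_line i y u Y t)).
have [c' [hc' e]] := mean_value 0 1 dphi.
have h01 : 0 <= c' <= 1 by case/orP: hc' => /andP[? ?]; apply/andP; split; lra.
move: e; rewrite !scale1r !scale0r !addr0 subr0 mulr1 => e.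
have := h c' h01 => hn.
have : dot (grad i (y + c' *: u) Y') u - dot (grad i (y + c' *: u) Y) u <= c * nrm u.
  rewrite -frob_dotNl -frob_dotDl; apply: le_trans (frob_dot_le _ _) _.
  by rewrite ler_wpM2r ?frob_norm_ge0 // frob_distC.
by lra.
Qed.

Lemma design_diff_le Y Y' : nrm (design Y - design Y') <= nrm (Y - Y').
Proof.
have -> : design Y - design Y' = row_mx (positions (Y - Y')) 0.
  by rewrite /design opp_row_mx add_row_mx subrr positionsB.
apply: frob_norm_le_sqr; rewrite frob_dot_row_mx frob_dot0l addr0 [leRHS]frob_dot_split.
by rewrite lerDl frob_dot_ge0.
Qed.

Lemma row_theta_close y Y Y' b : 0 <= b -> nrm y <= b ->
  nrm (row_theta y Y - row_theta y Y') <= (1 + b) * nrm (Y - Y').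
Proof.
move=> b0 hy.
have -> : row_theta y Y - row_theta y Y' = y *m (design Y - design Y')^T + (degrees (Y - Y'))^T.
  have trB (m' q : nat) (B C : 'M[R]_(m', q)) : (B - C)^T = B^T - C^T by exact: linearB.
  by rewrite degreesB !trB mulmxBr /row_theta opprD addrACA.
apply: le_trans (frob_normD _ _) _.
have h1 := frob_norm_mulmx y (design Y - design Y')^T; rewrite frob_norm_tr in h1.
have h2 := degrees_le (Y - Y'); rewrite frob_norm_tr.
have h3 := design_diff_le Y Y'.
have : nrm y * nrm (design Y - design Y') <= b * nrm (Y - Y').
  by apply: ler_pM; rewrite ?frob_norm_ge0.
by lra.
Qed.

Lemma row_score_le i y Y b L : 0 <= b -> 0 <= L -> nrm y <= b -> rows_bounded b Y ->
  (forall j, `|score p A Y i j| <= L) ->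
  nrm (row_score p A i y Y) <= (L + 2 * K2 (theta_range b) * b * (1 + b)) * rtn.
Proof.
move=> b0 L0 hy hY hL.
have K2b := K2_gt0 (theta_range_gt0 b0).
have -> : row_score p A i y Y = row_score p A i (row i Y) Y +
  (row_score p A i y Y - row_score p A i (row i Y) Y) by rewrite addrC subrK.
apply: le_trans (frob_normD _ _) _; rewrite mulrDl lerD //.
  rewrite row_score_row; apply: frob_norm_le; first by rewrite mulr_ge0 ?rtn_ge0.
  rewrite /frob_dot big_ord1 exprMn rtn_sqr.
  apply: (@le_trans _ _ (\sum_(j < n) L ^+ 2)); last by rewrite sumr_const card_ord mulr_natr.
  apply: ler_sum => j _; rewrite [row _ _ _ _]mxE -expr2 -[X in X <= _]real_normK ?num_real //.
  by rewrite ler_pXn2r ?nnegrE.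
have h := @row_score_lipschitz R n k p A i y Y (row i Y) Y (theta_range b) _ _ (ltW K2b)
  (hc (theta_range_gt0 b0) (i := i)) (fun j => row_theta_le j b0 hy hY) (fun j => row_theta_le j b0 (hY i) hY).
apply: le_trans h _; rewrite row_theta_diff.
have h1 := frob_norm_mulmx (y - row i Y) (design Y)^T; rewrite frob_norm_tr in h1.
have h2 := nrm_design b0 hY.
have h3 : nrm (y - row i Y) <= 2 * b by have := frob_normB y (row i Y); have := hY i; lra.
have : nrm (y - row i Y) * nrm (design Y) <= (2 * b) * ((1 + b) * rtn).
  by apply: ler_pM; rewrite ?frob_norm_ge0.
move=> h4; rewrite mulrC -!mulrA.
have : nrm ((y - row i Y) *m (design Y)^T) * K2 (theta_range b) <= (2 * b * ((1 + b) * rtn)) * K2 (theta_range b).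
  by rewrite ler_wpM2r ?(ltW K2b) //; exact: le_trans h4.
by lra.
Qed.

Lemma row_grad_close i y Y Y' b L : 0 <= b -> 0 <= L -> nrm y <= b ->
  rows_bounded b Y -> rows_bounded b Y' -> (forall j, `|score p A Y' i j| <= L) ->
  nrm (grad i y Y - grad i y Y') <= (3 * K2 (theta_range b) * theta_range b + L) * rtn * nrm (Y - Y').
Proof.
move=> b0 L0 hy hY hY' hL.
have K2b := K2_gt0 (theta_range_gt0 b0).
have -> : grad i y Y - grad i y Y' = - ((row_score p A i y Y - row_score p A i y Y') *m design Y
    + row_score p A i y Y' *m (design Y - design Y')).
  rewrite /row_grad mulmxBl mulmxBr addrA subrK opprB opprK addrC; done.
rewrite frob_normN; apply: le_trans (frob_normD _ _) _.
have h1 := @row_score_lipschitz R n k p A i y Y y Y' (theta_range b) _ _ (ltW K2b)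
  (hc (theta_range_gt0 b0) (i := i)) (fun j => row_theta_le j b0 hy hY) (fun j => row_theta_le j b0 hy hY').
have h2 := row_theta_close Y Y' b0 hy.
have h3 := nrm_design b0 hY.
have h4 := row_score_le b0 L0 hy hY' hL.
have h5 := design_diff_le Y Y'.
have D0 := frob_norm_ge0 (Y - Y').
have h6 := frob_norm_mulmx (row_score p A i y Y - row_score p A i y Y') (design Y).
have h7 := frob_norm_mulmx (row_score p A i y Y') (design Y - design Y').
have h8 : nrm (row_score p A i y Y - row_score p A i y Y') * nrm (design Y) <=
    (K2 (theta_range b) * ((1 + b) * nrm (Y - Y'))) * ((1 + b) * rtn).
  apply: ler_pM; rewrite ?frob_norm_ge0 //; apply: le_trans h1 _.
  by rewrite ler_wpM2l // ltW.
have h9 : nrm (row_score p A i y Y') * nrm (design Y - design Y') <=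
    ((L + 2 * K2 (theta_range b) * b * (1 + b)) * rtn) * nrm (Y - Y').
  by apply: ler_pM; rewrite ?frob_norm_ge0.
have h10 : 0 <= 2 * K2 (theta_range b) * (1 + b) * (rtn * nrm (Y - Y')).
  by rewrite !mulr_ge0 ?rtn_ge0 ?addr_ge0 // ltW.
by rewrite /theta_range in h8 h9 h10 *; lra.
Qed.

Lemma row_grad_lipschitz i y y' Y b : 0 <= b -> nrm y <= b -> nrm y' <= b -> rows_bounded b Y ->
  nrm (grad i y Y - grad i y' Y) <= K2 (theta_range b) * theta_range b * n%:R * nrm (y - y').
Proof.
move=> b0 hy hy' hY.
have K2b := K2_gt0 (theta_range_gt0 b0).
have -> : grad i y Y - grad i y' Y = - ((row_score p A i y Y - row_score p A i y' Y) *m design Y).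
  by rewrite /row_grad mulmxBl opprB opprK addrC.
rewrite frob_normN; apply: le_trans (frob_norm_mulmx _ _) _.
have h1 := @row_score_lipschitz R n k p A i y Y y' Y (theta_range b) _ _ (ltW K2b)
  (hc (theta_range_gt0 b0) (i := i)) (fun j => row_theta_le j b0 hy hY) (fun j => row_theta_le j b0 hy' hY).
have h2 := nrm_design b0 hY.
rewrite row_theta_diff in h1.
have h3 := frob_norm_mulmx (y - y') (design Y)^T; rewrite frob_norm_tr in h3.
have h4 : nrm (y - y') * nrm (design Y) <= nrm (y - y') * ((1 + b) * rtn).
  by rewrite ler_wpM2l ?frob_norm_ge0.
have h5 : nrm (row_score p A i y Y - row_score p A i y' Y) <=
    K2 (theta_range b) * (nrm (y - y') * ((1 + b) * rtn)).
  by apply: le_trans h1 _; rewrite ler_wpM2l ?(ltW K2b) //; lra.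
apply: (@le_trans _ _ ((K2 (theta_range b) * (nrm (y - y') * ((1 + b) * rtn))) * ((1 + b) * rtn))).
  by apply: ler_pM; rewrite ?frob_norm_ge0.
rewrite le_eqVlt; apply/orP; left; apply/eqP; rewrite /theta_range.
by have := @rtn_sqr R n; move: (Num.sqrt _) => r <-; ring.
Qed.

End RowComparison.

(** * Level sets of row objectives at the truth *)

Section LevelSet.
Context {R : realType} {n k : nat}.
Implicit Types (Y U : 'M[R]_(n, k + 1)) (y u : 'rV[R]_(k + 1)) (i : 'I_n).
Local Notation dot := frob_dot.
Local Notation nrm := frob_norm.
Local Notation rtn := (Num.sqrt (n%:R : R)).
Variables (p : R -> R -> R) (A : 'M[R]_n).
Hypothesis loglik_diff : forall i j, i != j -> forall theta : R,
  is_derive theta 1 (loglik p ^~ (A i j)) (dloglik p 1 theta (A i j)).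
Variables (K1 K2 : R -> R).
Hypothesis K1_gt0 : forall b, 0 < b -> 0 < K1 b.
Hypothesis K2_gt0 : forall b, 0 < b -> 0 < K2 b.
Hypothesis hc : forall b, 0 < b -> forall i j, i != j ->
  curvature_bounds (loglik p ^~ (A i j)) (dloglik p 1 ^~ (A i j)) b (K1 b) (K2 b).
Hypothesis n_gt0 : 0 < n%:R :> R.

Local Notation obj := (row_obj p A).
Local Notation grad := (row_grad p A).

Variables (Yo : 'M[R]_(n, k + 1)) (beta0 mu tau : R).
Hypotheses (beta0_ge0 : 0 <= beta0) (bYo : rows_bounded beta0 Yo).
Hypothesis small_grad : forall i, nrm (grad i (row i Yo) Yo) <= tau * n%:R.

(** Strong convexity makes the row objective rise by at least c4 n from the true row to the unit
    sphere around it, and by convexity it keeps rising at least linearly beyond. An excess of T n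
    thus bounds the distance. *)
Lemma row_level_set i y T : centered Yo -> well_conditioned (2 * mu) Yo -> 0 < mu ->
  2 * mu <= 1 -> theta_range (beta0 + 1) <= mu * n%:R ->
  tau <= K1 (theta_range (beta0 + 1)) * mu / 4 -> 0 <= T ->
  obj i y Yo - obj i (row i Yo) Yo <= T * n%:R ->
  nrm (y - row i Yo) <= 1 + T / (K1 (theta_range (beta0 + 1)) * mu / 4).
Proof.
move=> cYo wc mu0 mu1 hn htau T0 hG; set c4 := K1 _ * mu / 4; set yo := row i Yo in hG *.
have b10 : 0 <= beta0 + 1 by rewrite addr_ge0.
have K1b := K1_gt0 (theta_range_gt0 b10).
have c40 : 0 < c4 by rewrite divr_gt0 // mulr_gt0.
set rho := nrm (y - yo).
have Tc : 0 <= T / c4 by rewrite divr_ge0 // ltW.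
have [r1|r1] := leP rho 1; first by lra.
have rho0 : 0 < rho by lra.
(* The point of the segment at distance 1 from the true row; it stays within a fixed radius, where
   the curvature constants apply. *)
pose y1 := yo + rho^-1 *: (y - yo).
have d1 : y1 - yo = rho^-1 *: (y - yo) by rewrite /y1 addrC addKr.
have n1 : nrm (y1 - yo) = 1.
  by rewrite d1 frob_normZ gtr0_norm ?invr_gt0 // mulVf // lt0r_neq0.
have byo : nrm yo <= beta0 + 1 by have := bYo i; rewrite -/yo; lra.
have by1 : nrm y1 <= beta0 + 1.
  have := frob_normD yo (y1 - yo); rewrite addrC subrK n1.
  by have := bYo i; rewrite -/yo; lra.
have bYo' : rows_bounded (beta0 + 1) Yo by move=> j; have := bYo j; lra.
have hcB := hc (theta_range_gt0 b10) (i := i).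
have [h1 _] := row_obj_sandwich hcB (fun j => row_theta_le j b10 byo bYo') (fun j => row_theta_le j b10 by1 bYo').
have h2 := row_increment_lower i (y1 - yo) b10 bYo' mu1 cYo wc hn.
rewrite n1 expr1n mulr1 in h2.
have h3 := frob_cauchy_schwarz (grad i yo Yo) (y1 - yo).
rewrite n1 mulr1 ler_norml in h3; have /andP[h4 _] := h3.
have h5 := small_grad i; rewrite -/yo in h5.
have h6 : K1 (theta_range (beta0 + 1)) / 2 * (mu * n%:R) <=
    K1 (theta_range (beta0 + 1)) / 2 * row_increment_sq i (y1 - yo) Yo.
  by rewrite ler_pM2l // divr_gt0.
have h7 : tau * n%:R <= c4 * n%:R by rewrite ler_wpM2r // ltW.
have G1 : c4 * n%:R <= obj i y1 Yo - obj i yo Yo by rewrite /c4 in h7 *; lra.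
have h8 := row_obj_convex K1_gt0 hc i y1 yo Yo.
have h9 := row_obj_convex K1_gt0 hc i y1 y Yo.
have e1 : y - y1 = (rho - 1) *: (y1 - yo).
  rewrite d1 scalerA mulrBl mulfV ?lt0r_neq0 // mul1r scalerBl scale1r /y1.
  by rewrite opprD addrA.
rewrite e1 frob_dotZr in h9; rewrite -(opprB y1) frob_dotNr in h8.
move: (dot (grad i y1 Yo) (y1 - yo)) (obj i y1 Yo) (obj i y Yo) (obj i yo Yo) G1 h8 h9 hG.
move=> D G g go G1 h8 h9 hG.
have h10 : (rho - 1) * (G - go) <= (rho - 1) * D by apply: ler_wpM2l; lra.
have h11 : rho * (c4 * n%:R) <= rho * (G - go).
  exact: (ler_wpM2l (ltW rho0) G1).
have : rho * c4 * n%:R <= T * n%:R by lra.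
rewrite ler_pM2r // -ler_pdivlMr // => h12.
by lra.
Qed.

Lemma row_obj_upper i y b : 0 <= tau -> beta0 <= b -> nrm y <= b ->
  obj i y Yo - obj i (row i Yo) Yo <=
  (tau * (2 * b) + K2 (theta_range b) / 2 * (theta_range b * (2 * b) ^+ 2)) * n%:R.
Proof.
move=> tau0 hb hy; have b0 : 0 <= b by exact: le_trans hb.
have byo : nrm (row i Yo) <= b by exact: le_trans (bYo i) hb.
have bYo' : rows_bounded b Yo by move=> j; have := bYo j; lra.
have K2b := K2_gt0 (theta_range_gt0 b0).
have [_ h1] := row_obj_sandwich (hc (theta_range_gt0 b0) (i := i)) (fun j => row_theta_le j b0 byo bYo') (fun j => row_theta_le j b0 hy bYo').
have h2 : nrm (y - row i Yo) <= 2 * b by have := frob_normB y (row i Yo); lra.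
have h3 := row_increment_upper i (y - row i Yo) b0 bYo'.
have h4 : dot (grad i (row i Yo) Yo) (y - row i Yo) <= tau * n%:R * (2 * b).
  apply: le_trans (frob_dot_le _ _) _.
  by apply: ler_pM; rewrite ?frob_norm_ge0.
have h5 : nrm (y - row i Yo) ^+ 2 <= (2 * b) ^+ 2.
  by rewrite ler_pXn2r ?nnegrE ?frob_norm_ge0 // mulr_ge0.
have h6 : theta_range b * n%:R * nrm (y - row i Yo) ^+ 2 <= theta_range b * n%:R * (2 * b) ^+ 2.
  by rewrite ler_wpM2l // mulr_ge0 // ltW // theta_range_gt0.
have h7 : K2 (theta_range b) / 2 * row_increment_sq i (y - row i Yo) Yo <=
    K2 (theta_range b) / 2 * (theta_range b * n%:R * (2 * b) ^+ 2).
  by rewrite ler_pM2l ?divr_gt0 //; rewrite /theta_range in h6 *; lra.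
by lra.
Qed.

(** Invariance of a row level set. (LS2) decreases the row objective with the other rows frozen at
    Y; replacing Y by the truth costs eps1 n times the step length, and the extra shift s, which
    comes from recentering, costs Cv2 n eps2. *)
Lemma row_step i Y eta s (b1 b2 Cv Cv2 Cinit C_ls eps1 eps2 hmin T : R) :
  let y := row i Y in let g := grad i y Y in
  0 < b1 -> beta0 <= b1 -> nrm y <= b1 ->
  (forall y', nrm y' <= b2 -> nrm (grad i y' Y - grad i y' Yo) <= eps1 * n%:R) ->
  (forall y', nrm y' <= b2 -> nrm (grad i y' Yo) <= Cv2 * n%:R) ->
  nrm g <= Cv * n%:R -> 0 < eta -> 0 < hmin -> 0 < C_ls -> 0 <= eps1 -> 0 <= eps2 -> 0 <= Cv2 -> 0 <= Cv ->
  hmin <= n%:R * eta -> n%:R * eta <= Cinit ->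
  obj i (y - eta *: g) Y - obj i y Y <= - (C_ls * n%:R * eta ^+ 2 * nrm g ^+ 2) ->
  b1 + Cinit * (Cv + 1) <= b2 -> nrm s <= eps2 -> eps2 <= Cinit ->
  obj i y Yo - obj i (row i Yo) Yo <= T * n%:R -> 2 <= T ->
  eps1 * Cinit * Cv + Cv2 * eps2 <= 1 ->
  eps1 * Cinit * Cv + Cv2 * eps2 <= C_ls * hmin ^+ 2 * (1 / (4 * b1)) ^+ 2 ->
  eps1 <= 1 / (4 * b1) ->
  obj i (y - eta *: g + s) Yo - obj i (row i Yo) Yo <= T * n%:R.
Proof.
move=> y g b10 hb1 hy close hCv2 hg eta0 hmin0 C_ls0 e10 e20 Cv20 Cv0 hh1 hh2 dec hb2 hs he2 hG T2 s1 s2 s3.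
pose v := nrm g / n%:R.
have gv : nrm g = v * n%:R by rewrite /v divfK // lt0r_neq0.
have v0 : 0 <= v by rewrite divr_ge0 ?frob_norm_ge0 // ltW.
have vC : v <= Cv by rewrite ler_pdivrMr.
pose h := n%:R * eta.
have h0 : 0 < h by rewrite mulr_gt0.
have Cinit0 : 0 < Cinit by lra.
have hv : h * v <= Cinit * Cv by apply: ler_pM => //; exact: ltW.
have nu : nrm (- (eta *: g)) = h * v by rewrite frob_normN frob_normZ gtr0_norm // gv /h; ring.
have hvC : h * v + eps2 <= Cinit * (Cv + 1) by lra.
have seg (t : R) : 0 <= t <= 1 -> nrm (y + t *: (- (eta *: g))) <= b2.
  move=> /andP[t0 t1]; apply: le_trans (frob_normD _ _) _.
  rewrite frob_normZ ger0_norm // nu.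
  have : t * (h * v) <= 1 * (h * v) by rewrite ler_wpM2r // mulr_ge0 // ltW.
  lra.
have cmp := @row_obj_compare R n k p A loglik_diff i y (- (eta *: g)) Y Yo (eps1 * n%:R)
  (fun t ht => close _ (seg t ht)).
rewrite nu in cmp.
have n2 : nrm (y - eta *: g + s) <= b2.
  apply: le_trans (frob_normD _ _) _; have := frob_normD y (- (eta *: g)); rewrite nu; lra.
have conv := row_obj_convex K1_gt0 hc i (y - eta *: g + s) (y - eta *: g) Yo.
have es : y - eta *: g - (y - eta *: g + s) = - s by rewrite opprD addrA subrr sub0r.
rewrite es frob_dotNr in conv.
have hs' : dot (grad i (y - eta *: g + s) Yo) s <= Cv2 * n%:R * eps2.
  apply: le_trans (frob_dot_le _ _) _.
  by apply: ler_pM; rewrite ?frob_norm_ge0 ?hCv2.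
have decn : C_ls * n%:R * eta ^+ 2 * nrm g ^+ 2 = C_ls * (h * v) ^+ 2 * n%:R.
  by rewrite gv /h; ring.
rewrite decn in dec.
have e1hv : eps1 * (h * v) <= eps1 * (Cinit * Cv) by rewrite ler_wpM2l.
have tot : obj i (y - eta *: g + s) Yo - obj i y Yo <=
    (- (C_ls * (h * v) ^+ 2) + (eps1 * Cinit * Cv + Cv2 * eps2)) * n%:R.
  have : eps1 * (h * v) * n%:R <= eps1 * (Cinit * Cv) * n%:R by rewrite ler_wpM2r // ltW.
  lra.
have hv20 : 0 <= C_ls * (h * v) ^+ 2 by rewrite mulr_ge0 ?sqr_ge0 // ltW.
(* If the excess is at most (T - 1) n, errors of total size n keep it below T n. Otherwise it is at
   least n, convexity forces a gradient of order n, and the decrease from (LS2) outweighs the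
   errors. *)
have [Gs|Gl] := leP (obj i y Yo - obj i (row i Yo) Yo) ((T - 1) * n%:R).
  have : (- (C_ls * (h * v) ^+ 2) + (eps1 * Cinit * Cv + Cv2 * eps2)) * n%:R <= 1 * n%:R.
    by apply: ler_wpM2r; [exact: ltW|lra].
  lra.
have convy := row_obj_convex K1_gt0 hc i y (row i Yo) Yo.
rewrite -(opprB y (row i Yo)) frob_dotNr in convy.
have hd : dot (grad i y Yo) (y - row i Yo) <= nrm (grad i y Yo) * (2 * b1).
  apply: le_trans (frob_dot_le _ _) _; rewrite ler_wpM2l ?frob_norm_ge0 //.
  by have := frob_normB y (row i Yo); have := bYo i; lra.
have Gl' : 1 * n%:R <= (T - 1) * n%:R by apply: ler_wpM2r; [exact: ltW|lra].
have hgo : n%:R / (2 * b1) <= nrm (grad i y Yo).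
  by rewrite ler_pdivrMr ?mulr_gt0 //; lra.
have hyb2 : nrm y <= b2 by have := mulr_ge0 (ltW Cinit0) (addr_ge0 Cv0 ler01); lra.
have hcl := close y hyb2; rewrite -/g in hcl.
have hgo2 : nrm (grad i y Yo) <= nrm g + eps1 * n%:R.
  have := frob_normB g (g - grad i y Yo); rewrite opprB addrC subrK; lra.
have hvl : 1 / (4 * b1) <= v.
  rewrite -(ler_pM2r n_gt0) -gv.
  have : eps1 * n%:R <= 1 / (4 * b1) * n%:R by rewrite ler_wpM2r // ltW.
  have e4 : n%:R / (2 * b1) = 1 / (4 * b1) * n%:R + 1 / (4 * b1) * n%:R.
    by field; rewrite lt0r_neq0.
  rewrite e4 in hgo.
  lra.
have hq : hmin * (1 / (4 * b1)) <= h * v.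
  by apply: ler_pM => //; [exact: ltW|rewrite divr_ge0 // mulr_ge0 // ltW].
have p1 : 0 <= hmin * (1 / (4 * b1)).
  by apply: mulr_ge0; [exact: ltW|rewrite divr_ge0 // mulr_ge0 // ltW].
have hq2 : (hmin * (1 / (4 * b1))) ^+ 2 <= (h * v) ^+ 2.
  by rewrite ler_pXn2r ?nnegrE //; exact: le_trans hq.
have : C_ls * (hmin * (1 / (4 * b1))) ^+ 2 <= C_ls * (h * v) ^+ 2 by rewrite ler_pM2l.
rewrite exprMn => hq3.
have : (- (C_ls * (h * v) ^+ 2) + (eps1 * Cinit * Cv + Cv2 * eps2)) * n%:R <= 0.
  by rewrite pmulr_lle0 //; lra.
by lra.
Qed.

End LevelSet.

(** * The projected direction, the line search conditions and backtracking *)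

Section LineSearch.
Context {R : realType} {n k : nat}.
Implicit Types (Y U : 'M[R]_(n, k + 1)) (y u : 'rV[R]_(k + 1)) (i : 'I_n).
Local Notation dot := frob_dot.
Local Notation nrm := frob_norm.
Local Notation rtn := (Num.sqrt (n%:R : R)).
Variables (p : R -> R -> R) (A : 'M[R]_n).
Hypothesis symA : A^T = A.
Hypothesis loglik_diff : forall i j, i != j -> forall theta : R,
  is_derive theta 1 (loglik p ^~ (A i j)) (dloglik p 1 theta (A i j)).
Hypothesis n_gt0 : 0 < n%:R :> R.

Local Notation obj := (row_obj p A).
Local Notation grad := (row_grad p A).
Local Notation d := (direction p A).

Lemma ones_tr_ones : (ones n)^T *m ones n = (n%:R)%:M :> 'M[R]_1.
Proof.
apply/matrixP => i j; rewrite !ord1 !mxE; under eq_bigr do rewrite !mxE mulr1.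
by rewrite sumr_const card_ord mulr1n.
Qed.

Lemma ones_centering : (ones n)^T *m (centering : 'M[R]_n) = 0.
Proof.
rewrite /centering mulmxBr mulmx1 -scalemxAr mulmxA ones_tr_ones mul_scalar_mx.
by rewrite scalerA mulVf ?lt0r_neq0 // scale1r subrr.
Qed.

Lemma centering_sym : (centering : 'M[R]_n)^T = centering.
Proof.
apply/matrixP => i j; rewrite !mxE eq_sym; congr (_ - _ * _).
by apply: eq_bigr => l _; rewrite !mxE.
Qed.

Lemma centering_centered q (X : 'M[R]_(n, q)) : (ones n)^T *m X = 0 -> centering *m X = X.
Proof. by move=> h; rewrite /centering mulmxBl mul1mx -scalemxAl -mulmxA h mulmx0 scaler0 subr0. Qed.

Lemma direction_positions Y : positions (d Y) = centering *m positions (score p A Y *m design Y).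
Proof.
rewrite /direction (gradient_loss symA loglik_diff) /positions.
by rewrite opp_row_mx row_mxKl (linearN (@lsubmx _ _ _ _)) /= mulmxN opprK.
Qed.

Lemma direction_degrees Y : degrees (d Y) = degrees (score p A Y *m design Y).
Proof.
rewrite /direction (gradient_loss symA loglik_diff) /degrees.
by rewrite opp_row_mx row_mxKr (linearN (@rsubmx _ _ _ _)) /= opprK.
Qed.

Lemma direction_centered Y : centered (d Y).
Proof. by rewrite /centered direction_positions mulmxA ones_centering mul0mx. Qed.

(** The centering matrix is an orthogonal projection fixing centred positions, so along centred
    displacements the direction acts like the negative gradient. *)
Lemma direction_dot Y U : centered U -> dot (d Y) U = dot (score p A Y *m design Y) U.
Proof.
move=> cU; rewrite !frob_dot_split direction_positions direction_degrees frob_dot_mulmxl.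
by rewrite centering_sym centering_centered.
Qed.

Lemma gradient_direction Y : dot (gradient (loss p A) Y) (d Y) = - nrm (d Y) ^+ 2.
Proof.
rewrite (gradient_loss symA loglik_diff) frob_dotNl sqr_frob_norm.
by rewrite [in RHS]direction_dot //; exact: direction_centered.
Qed.

Lemma direction_le Y : nrm (d Y) <= nrm (score p A Y *m design Y).
Proof.
have h : nrm (d Y) ^+ 2 <= nrm (score p A Y *m design Y) * nrm (d Y).
  rewrite sqr_frob_norm direction_dot; first exact: frob_dot_le.
  exact: direction_centered.
have [d0|dn0] := eqVneq (nrm (d Y)) 0; first by rewrite d0 frob_norm_ge0.
by rewrite -(ler_pM2r (_ : 0 < nrm (d Y))) -?expr2 // lt_neqAle eq_sym dn0 frob_norm_ge0.
Qed.

(** The mean removed by the projection, common to all rows: the only part of the step by which it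
    differs from independent gradient steps in the rows. *)
Definition center_shift Y : 'rV[R]_k :=
  - (n%:R^-1 *: ((ones n)^T *m positions (score p A Y *m design Y))).

Lemma row_direction_split Y i : row i (d Y) = - grad i (row i Y) Y + row_mx (center_shift Y) 0.
Proof.
rewrite row_grad_row opprK (splitY (d Y)) (splitY (score p A Y *m design Y)).
rewrite direction_positions direction_degrees !row_row_mx add_row_mx addr0; congr row_mx.
rewrite /centering mulmxBl mul1mx linearB /=; congr (_ + _).
rewrite /center_shift -scalemxAl -mulmxA; apply/rowP => j.
by rewrite !mxE big_ord1 !mxE mul1r.
Qed.

Lemma center_shift_le Y : nrm (center_shift Y) * rtn <= nrm (score p A Y *m design Y).
Proof.
rewrite /center_shift frob_normN frob_normZ ger0_norm ?invr_ge0 ?(ltW n_gt0) //.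
have h := frob_norm_mulmx (ones n)^T (positions (score p A Y *m design Y)).
rewrite frob_norm_tr nrm_ones in h.
have h2 := positions_le (score p A Y *m design Y).
have h3 : rtn * nrm (positions (score p A Y *m design Y)) <= rtn * nrm (score p A Y *m design Y).
  by rewrite ler_wpM2l ?rtn_ge0.
rewrite -mulrA mulrC ler_pdivrMr //.
have : nrm ((ones n)^T *m positions (score p A Y *m design Y)) * rtn <=
  rtn * nrm (score p A Y *m design Y) * rtn.
  by apply: ler_wpM2r; [exact: rtn_ge0|exact: le_trans h3].
move=> h4; apply: le_trans h4 _; rewrite le_eqVlt; apply/orP; left; apply/eqP.
by have := @rtn_sqr R n; move: (Num.sqrt _) => r <-; ring.
Qed.

Lemma row_row_direction Y i j :
  row j (row_direction p A i Y) = if j == i then - grad i (row i Y) Y else 0.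
Proof.
rewrite row_grad_row /row_direction (gradient_loss symA loglik_diff) mulmxN opprK opprK.
move: (score p A Y *m design Y) => G; rewrite row_mul.
have [->|ji] := eqVneq j i.
  apply/rowP => c; rewrite !mxE (bigD1 i) //= !mxE !eqxx mul1r big1 ?addr0 // => l li.
  by rewrite !mxE (negbTE li) andbF mul0r.
apply/rowP => c; rewrite !mxE big1 // => l _.
by rewrite !mxE (negbTE ji) mul0r.
Qed.

Lemma row_loss_step Y i eta : row_loss p A i (Y + eta *: row_direction p A i Y) =
  obj i (row i Y - eta *: grad i (row i Y) Y) Y.
Proof.
rewrite row_loss_update.
  rewrite linearZ /= row_row_direction eqxx.
  by congr obj; rewrite scalerN.
by move=> j ji; rewrite linearZ /= row_row_direction (negbTE ji) scaler0.
Qed.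

Lemma row_loss_obj Y i : row_loss p A i Y = obj i (row i Y) Y.
Proof.
rewrite -[in LHS](addr0 Y) row_loss_update ?linear0 ?addr0 // => j _.
exact: linear0.
Qed.

Lemma row_gradient_dot Y i :
  dot (gradient (row_loss p A i) Y) (row_direction p A i Y) = - nrm (grad i (row i Y) Y) ^+ 2.
Proof.
rewrite frob_dot_rows (bigD1 i) //= big1 ?addr0 => [|j ji]; last first.
  by rewrite row_row_direction (negbTE ji) frob_dot0r.
rewrite row_row_direction eqxx frob_dotNr sqr_frob_norm; congr (- dot _ _).
by apply/rowP => c; rewrite mxE (gradient_row_loss loglik_diff) row_grad_row !mxE.
Qed.

Variables (K1 K2 : R -> R).
Hypothesis K1_gt0 : forall b, 0 < b -> 0 < K1 b.
Hypothesis K2_gt0 : forall b, 0 < b -> 0 < K2 b.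
Hypothesis hc : forall b, 0 < b -> forall i j, i != j ->
  curvature_bounds (loglik p ^~ (A i j)) (dloglik p 1 ^~ (A i j)) b (K1 b) (K2 b).

(** Smoothness of the loss: the second-order part of [Theta_mx] is paired with the score matrix
    through its operator norm, and the curvature term is bounded by the Lipschitz constant of
    [Theta_mx]. *)
Lemma loss_step_upper Y U b Cop : 0 <= b -> rows_bounded b Y -> rows_bounded b (Y + U) ->
  0 <= Cop -> op_bounded (Cop * n%:R) (score p A Y) ->
  loss p A (Y + U) <= loss p A Y - dot (score p A Y *m design Y) U
    + (Cop / 2 + K2 (theta_range b) * theta_range b) * n%:R * nrm U ^+ 2.
Proof.
move=> b0 bY bYU Cop0 op.
have K2b := K2_gt0 (theta_range_gt0 b0).
have [_ h] := loss_sandwich symA (hc (theta_range_gt0 b0)) (fun i j => Theta_le i j b0 bY) (fun i j => Theta_le i j b0 bYU).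
have e : Theta_mx (Y + U) - Theta_mx Y =
    (U *m (design Y)^T + design Y *m U^T) + positions U *m (positions U)^T.
  by rewrite Theta_mxD addrAC (addrC (Theta_mx Y)) addrK.
have h1 := offdiag_sq_le (Theta_mx (Y + U) - Theta_mx Y).
have h2 := Theta_diff_le b0 bYU bY; rewrite [Y + U - Y]addrC addKr in h2.
have h3 : offdiag_sq (Theta_mx (Y + U) - Theta_mx Y) <= 4 * theta_range b * n%:R * nrm U ^+ 2.
  apply: le_trans h1 _; apply: (@le_trans _ _ ((2 * (1 + b) * rtn * nrm U) ^+ 2)).
    rewrite ler_pXn2r ?nnegrE ?frob_norm_ge0 //; exact: le_trans (frob_norm_ge0 _) h2.
  by rewrite !exprMn rtn_sqr /theta_range; lra.
have h4 : K2 (theta_range b) / 4 * offdiag_sq (Theta_mx (Y + U) - Theta_mx Y) <=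
   K2 (theta_range b) / 4 * (4 * theta_range b * n%:R * nrm U ^+ 2) by rewrite ler_pM2l // divr_gt0.
have h5 : dot (score p A Y) (Theta_mx (Y + U) - Theta_mx Y) =
   2 * dot (score p A Y *m design Y) U + dot (score p A Y *m positions U) (positions U).
  rewrite e !frob_dotDr [dot _ (design Y *m _)]frob_dotC.
  have -> : dot (score p A Y) (U *m (design Y)^T) = dot (score p A Y *m design Y) U.
    by rewrite [RHS]frob_dot_mulmxr.
  have -> : dot (design Y *m U^T) (score p A Y) = dot (score p A Y *m design Y) U.
    rewrite frob_dotC -frob_dot_tr score_sym // trmx_mul trmxK.
    by rewrite [RHS]frob_dot_mulmxr.
  by rewrite [dot (score p A Y *m positions U) _]frob_dot_mulmxr; ring.
have h6 : `|dot (score p A Y *m positions U) (positions U)| <= Cop * n%:R * nrm U ^+ 2.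
  apply: le_trans (frob_cauchy_schwarz _ _) _.
  have cn : 0 <= Cop * n%:R by rewrite mulr_ge0 // ltW.
  have a1 := op_bounded_mulmx (positions U) cn op.
  have a2 := positions_le U; have a3 := frob_norm_ge0 (positions U).
  apply: (@le_trans _ _ ((Cop * n%:R * nrm U) * nrm U)); last by rewrite expr2 mulrA.
  apply: ler_pM; rewrite ?frob_norm_ge0 //; apply: le_trans a1 _.
  by rewrite ler_wpM2l.
rewrite ler_norml in h6; have /andP[h7 _] := h6.
by rewrite h5 in h; lra.
Qed.

Lemma global_decrease_small Y b Cop C_ls eta : 0 <= b -> rows_bounded b Y ->
  rows_bounded b (Y + eta *: d Y) -> 0 <= Cop -> op_bounded (Cop * n%:R) (score p A Y) ->
  0 < eta -> n%:R * eta * (Cop / 2 + K2 (theta_range b) * theta_range b + C_ls) <= 1 ->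
  global_decrease p A C_ls Y eta.
Proof.
move=> b0 bY bYU Cop0 op eta0 hs; rewrite /global_decrease gradient_direction.
have h := loss_step_upper b0 bY bYU Cop0 op.
rewrite frob_dotZr frob_normZ -direction_dot in h; last exact: direction_centered.
rewrite -sqr_frob_norm gtr0_norm // in h.
have x0 : 0 <= eta * nrm (d Y) ^+ 2 by rewrite mulr_ge0 ?sqr_ge0 // ltW.
have : n%:R * eta * (Cop / 2 + K2 (theta_range b) * theta_range b + C_ls) * (eta * nrm (d Y) ^+ 2)
    <= 1 * (eta * nrm (d Y) ^+ 2) by rewrite ler_wpM2r.
by lra.
Qed.

Lemma rowwise_decrease_small Y b C_ls eta : 0 <= b -> rows_bounded b Y ->
  (forall i, nrm (row i Y - eta *: grad i (row i Y) Y) <= b) ->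
  0 < eta -> n%:R * eta * (K2 (theta_range b) * theta_range b + C_ls) <= 1 ->
  rowwise_decrease p A C_ls Y eta.
Proof.
move=> b0 bY bYU eta0 hs; apply/forallP => i.
rewrite row_loss_step row_loss_obj row_gradient_dot.
set g := grad i _ _.
have K2b := K2_gt0 (theta_range_gt0 b0).
have [_ h] := row_obj_sandwich (hc (theta_range_gt0 b0) (i := i))
  (fun j => row_theta_le j b0 (bY i) bY) (fun j => row_theta_le j b0 (bYU i) bY).
rewrite -/g in h.
have e : row i Y - eta *: g - row i Y = - (eta *: g) by rewrite addrAC subrr add0r.
rewrite e in h.
have h1 := row_increment_upper i (- (eta *: g)) b0 bY.
rewrite frob_normN frob_normZ gtr0_norm // in h1.
rewrite frob_dotNr frob_dotZr -sqr_frob_norm in h.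
have h2 : K2 (theta_range b) / 2 * row_increment_sq i (- (eta *: g)) Y <=
  K2 (theta_range b) / 2 * (theta_range b * n%:R * (eta * nrm g) ^+ 2) by rewrite ler_pM2l // divr_gt0.
have x0 : 0 <= eta * nrm g ^+ 2 by rewrite mulr_ge0 ?sqr_ge0 // ltW.
have h3 : n%:R * eta * (K2 (theta_range b) * theta_range b + C_ls) * (eta * nrm g ^+ 2)
    <= 1 * (eta * nrm g ^+ 2) by rewrite ler_wpM2r.
have x1 : 0 <= K2 (theta_range b) * theta_range b * (n%:R * (eta * nrm g) ^+ 2).
  apply: mulr_ge0; last by rewrite mulr_ge0 ?sqr_ge0 // ltW.
  by rewrite mulr_ge0 // ltW // theta_range_gt0.
by lra.
Qed.

Lemma rowwise_decrease_obj Y C_ls eta i : rowwise_decrease p A C_ls Y eta ->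
  obj i (row i Y - eta *: grad i (row i Y) Y) Y - obj i (row i Y) Y <=
    - (C_ls * n%:R * eta ^+ 2 * nrm (grad i (row i Y) Y) ^+ 2).
Proof.
move=> /forallP/(_ i); rewrite row_loss_step row_loss_obj row_gradient_dot; lra.
Qed.

(** Either the initial step is accepted, or the last rejected one exceeded h0, which bounds the
    accepted step below by beta h0. The allowed number of reductions suffices to go below h0. *)
Lemma backtrack_spec C_ls beta Y (steps : nat) eta h0 :
  0 < beta < 1 -> 0 < eta -> 0 < h0 ->
  (forall eta', 0 < eta' -> eta' <= h0 ->
     global_decrease p A C_ls Y eta' && rowwise_decrease p A C_ls Y eta') ->
  beta ^+ steps * eta <= h0 ->
  let eta' := backtrack p A C_ls beta Y steps eta in
  [/\ global_decrease p A C_ls Y eta', rowwise_decrease p A C_ls Y eta',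
      eta' <= eta & Num.min eta (beta * h0) <= eta'].
Proof.
move=> /andP[b0 b1] + h00 hls; elim: steps eta => [|s ih] eta eta0 hs /=.
  rewrite expr0 mul1r in hs; rewrite (hls _ eta0 hs).
  have /andP[-> ->] := hls _ eta0 hs; split => //.
  by rewrite ge_min lexx.
case: ifPn => [/andP[-> ->]|nls]; first by split=> //; rewrite ge_min lexx.
have hlt : h0 < eta by rewrite ltNge; apply: contra nls => h; exact: hls.
have be0 : 0 < beta * eta by rewrite mulr_gt0.
have [|g1 g2 g3 g4] := ih (beta * eta) be0; first by rewrite mulrA -exprSr.
split=> //.
  by apply: le_trans g3 _; rewrite ler_piMl // ltW.
apply: le_trans g4; rewrite le_min; apply/andP; split.
  by rewrite ge_min; apply/orP; right; rewrite ler_pM2l // ltW.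
by rewrite ge_min lexx orbT.
Qed.

End LineSearch.

(** * Rotations of the positions and the distance modulo rotation *)

Section Rotation.
Context {R : realType} {n k : nat}.
Implicit Types (Y : 'M[R]_(n, k + 1)) (Q : 'M[R]_k).
Local Notation dot := frob_dot.
Local Notation nrm := frob_norm.

Definition rotate Y Q : 'M[R]_(n, k + 1) := row_mx (positions Y *m Q) (degrees Y).

Lemma positions_rotate Y Q : positions (rotate Y Q) = positions Y *m Q.
Proof. exact: row_mxKl. Qed.

Lemma degrees_rotate Y Q : degrees (rotate Y Q) = degrees Y.
Proof. exact: row_mxKr. Qed.

Lemma orthogonal_mulr_tr Q : orthogonal_mx Q -> Q *m Q^T = 1%:M.
Proof. by move=> /orthogonal_tr; rewrite /orthogonal_mx /= trmxK. Qed.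

Lemma Theta_rotate Y Q i j : orthogonal_mx Q -> Theta (rotate Y Q) i j = Theta Y i j.
Proof.
move=> hQ; have e : Theta_mx (rotate Y Q) = Theta_mx Y.
  rewrite !Theta_mxE positions_rotate degrees_rotate trmx_mul mulmxA -(mulmxA _ Q).
  by rewrite orthogonal_mulr_tr // mulmx1.
by have := congr1 (fun B : 'M[R]_n => B i j) e; rewrite !mxE.
Qed.

Lemma score_rotate p (A : 'M[R]_n) Y Q : orthogonal_mx Q -> score p A (rotate Y Q) = score p A Y.
Proof. by move=> hQ; apply/matrixP => i j; rewrite !mxE Theta_rotate. Qed.

Lemma loss_rotate p (A : 'M[R]_n) Y Q : orthogonal_mx Q -> loss p A (rotate Y Q) = loss p A Y.
Proof.
move=> hQ; rewrite /loss; congr (- _); apply: eq_bigr => i _; apply: eq_bigr => j _.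
by rewrite Theta_rotate.
Qed.

Lemma design_rotate Y Q : design (rotate Y Q) = row_mx (positions Y *m Q) (ones n).
Proof. by rewrite /design positions_rotate. Qed.

Lemma rows_bounded_rotate b Y Q : orthogonal_mx Q -> rows_bounded b Y -> rows_bounded b (rotate Y Q).
Proof.
move=> hQ h i; apply: le_trans (h i); apply: frob_norm_le_sqr.
have -> : row i Y = row_mx (row i (positions Y)) (row i (degrees Y)).
  by rewrite -row_row_mx -splitY.
by rewrite /rotate !row_row_mx !frob_dot_row_mx row_mul frob_dot_orthogonal.
Qed.

Lemma centered_rotate Y Q : centered Y -> centered (rotate Y Q).
Proof. by rewrite /centered positions_rotate mulmxA => ->; rewrite mul0mx. Qed.

Lemma well_conditioned_rotate m Y Q : orthogonal_mx Q -> well_conditioned m Y ->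
  well_conditioned m (rotate Y Q).
Proof.
move=> hQ h v; rewrite positions_rotate trmx_mul mulmxA.
by have := h (v *m Q^T); rewrite frob_dot_orthogonal //; exact: orthogonal_tr.
Qed.

Lemma stationary_rotate p (A : 'M[R]_n) Y Q : orthogonal_mx Q ->
  score p A Y *m design Y = 0 -> score p A (rotate Y Q) *m design (rotate Y Q) = 0.
Proof.
move=> hQ; rewrite score_rotate // design_rotate /design !mul_mx_row => e.
move: e; rewrite -(row_mx0 R n k 1) => /eq_row_mx [e1 ->].
by rewrite mulmxA e1 mul0mx row_mx0.
Qed.

Let dist_set Yhat Y := [set frob_norm (positions Yhat - positions Y *m Q) ^+ 2
           + frob_norm (degrees Yhat - degrees Y) ^+ 2 | Q in orthogonal_mx (R := R) (k := k)].

Lemma nrm_sub_rotate Y Y' Q : nrm (Y - rotate Y' Q) ^+ 2 =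
  nrm (positions Y - positions Y' *m Q) ^+ 2 + nrm (degrees Y - degrees Y') ^+ 2.
Proof.
rewrite sqr_frob_norm frob_dot_split positionsB degreesB positions_rotate degrees_rotate.
by rewrite !sqr_frob_norm.
Qed.

Lemma dist2_le Y Y' Q : orthogonal_mx Q -> dist2 Y Y' <= nrm (Y - rotate Y' Q) ^+ 2.
Proof.
move=> hQ; rewrite nrm_sub_rotate; apply: ge_inf; last by exists Q.
by exists 0 => x [Q' _ <-]; rewrite addr_ge0 ?sqr_ge0.
Qed.

(** The Procrustes rotation attains the infimum, so [dist2] becomes a squared norm to an aligned
    representative. *)
Lemma dist2_attained Y Y' : exists Q, [/\ orthogonal_mx Q, aligned Y (rotate Y' Q)
  & dist2 Y Y' = nrm (Y - rotate Y' Q) ^+ 2].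
Proof.
have [Q [hQ sym psd hmin]] := procrustes (positions Y) (positions Y').
exists Q; split=> //.
  split; rewrite positions_rotate //.
  by move=> Q' hQ'; rewrite -mulmxA; apply: hmin; exact: orthogonal_mul.
apply/eqP; rewrite eq_le dist2_le //=; apply: lb_le_inf.
  by exists (nrm (positions Y - positions Y' *m Q) ^+ 2 + nrm (degrees Y - degrees Y') ^+ 2); exists Q.
move=> x [Q' hQ' <-]; rewrite nrm_sub_rotate lerD2r ler_pXn2r ?nnegrE ?frob_norm_ge0 //.
exact: hmin.
Qed.

Lemma dist2_ge0 Y Y' : 0 <= dist2 Y Y'.
Proof. by have [Q [_ _ ->]] := dist2_attained Y Y'; exact: sqr_ge0. Qed.

End Rotation.

(** * Constants, data conditions and the invariant of the iteration *)

Section OneStep.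
Context {R : realType} {n k : nat}.
Implicit Types (Y U : 'M[R]_(n, k + 1)) (y u : 'rV[R]_(k + 1)) (i : 'I_n).
Local Notation dot := frob_dot.
Local Notation nrm := frob_norm.
Local Notation rtn := (Num.sqrt (n%:R : R)).
Variables (p : R -> R -> R) (A : 'M[R]_n).
Hypothesis symA : A^T = A.
Hypothesis loglik_diff : forall i j, i != j -> forall theta : R,
  is_derive theta 1 (loglik p ^~ (A i j)) (dloglik p 1 theta (A i j)).
Hypothesis n_gt0 : 0 < n%:R :> R.
Variables (K1 K2 : R -> R).
Hypothesis K1_gt0 : forall b, 0 < b -> 0 < K1 b.
Hypothesis K2_gt0 : forall b, 0 < b -> 0 < K2 b.
Hypothesis hc : forall b, 0 < b -> forall i j, i != j ->
  curvature_bounds (loglik p ^~ (A i j)) (dloglik p 1 ^~ (A i j)) b (K1 b) (K2 b).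
Local Notation obj := (row_obj p A).
Local Notation grad := (row_grad p A).
Local Notation d := (direction p A).

Variables (Yo Yh : 'M[R]_(n, k + 1)).
Variables (beta0 b1 b2 mu tau w L T Cinit C_ls hmin delta eps1 eps2 : R).
Local Notation k1 := (K1 (theta_range b2)).
Local Notation k2 := (K2 (theta_range b2)).
Local Notation Cv := (2 + 2 * K2 (theta_range b1) * theta_range b1 * b1).
Local Notation Cv2 := (1 + 2 * k2 * theta_range b2 * b2).
Local Notation Cd := (2 * k2 * (1 + b2) ^+ 2 + 1).

(** Row radii: [beta0] for the truth and the estimator, [b1] for iterates, [b2] for trial points one
    step away. [tau] bounds row gradients at the truth and [w] the operator norm of the score at the
    estimator, both relative to n; [L] bounds the score entries at the truth. [T] is the level of
    the row objectives, [delta] the radius of the neighbourhood in units of sqrt n, [hmin] and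
    [Cinit] the range of n times the step size, and [eps1], [eps2] the two errors of [row_step]. *)
Record step_constants : Prop := StepConstants {
  beta0_ge0 : 0 <= beta0; beta0_le : beta0 <= b1; b1_gt0 : 0 < b1;
  b12 : b1 + Cinit * (Cv + 1) <= b2; mu_gt0 : 0 < mu; mu_le : 2 * mu <= 1;
  C_ls_gt0 : 0 < C_ls; hmin_gt0 : 0 < hmin; hminC : hmin <= Cinit;
  L_ge0 : 0 <= L; tau_ge0 : 0 <= tau; tau_le1 : tau <= 1; w_ge0 : 0 <= w; w_le1 : w <= 1;
  delta_ge0 : 0 <= delta;
  n_large : 8 * (1 + b2) ^+ 2 <= mu * n%:R;
  w_small : w <= k1 * mu / 8;
  delta_small : k2 * (1 + b2) * delta + w <= k1 * mu / 8;
  tau_small : tau <= K1 (theta_range (beta0 + 1)) * mu / 4;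
  n_large' : theta_range (beta0 + 1) <= mu * n%:R;
  T_ge2 : 2 <= T;
  b1_radius : beta0 + 1 + T / (K1 (theta_range (beta0 + 1)) * mu / 4) <= b1;
  close1 : (3 * K2 (theta_range b1) * theta_range b1 + L) * delta <= 1;
  close2 : (3 * k2 * theta_range b2 + L) * delta <= eps1;
  eps1_ge0 : 0 <= eps1; eps2_ge0 : 0 <= eps2;
  shift_small : Cinit * Cd * delta <= eps2; eps2_le : eps2 <= Cinit;
  small1 : eps1 * Cinit * Cv + Cv2 * eps2 <= 1;
  small2 : eps1 * Cinit * Cv + Cv2 * eps2 <= C_ls * hmin ^+ 2 * (1 / (4 * b1)) ^+ 2;
  small3 : eps1 <= 1 / (4 * b1) }.

Record step_data : Prop := StepData {
  bYo : rows_bounded beta0 Yo; cYo : centered Yo; wcYo : well_conditioned (2 * mu) Yo;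
  small_grad : forall i, nrm (grad i (row i Yo) Yo) <= tau * n%:R;
  scoreL : forall i j, `|score p A Yo i j| <= L;
  bYh : rows_bounded beta0 Yh; cYh : centered Yh; stat : score p A Yh *m design Yh = 0;
  opF : op_bounded (w * n%:R) (score p A Yh); wcYh : well_conditioned (2 * mu) Yh }.

Hypothesis hk : step_constants.
Hypothesis hd : step_data.

(** The induction invariant. Row objectives are compared with one fixed rotation [Yo] of the truth,
    whereas the loss is compared with [Yh] modulo rotation; both distances are recorded. *)
Definition good_iterate Y : Prop :=
  [/\ rows_bounded b1 Y, centered Y,
      forall i, obj i (row i Y) Yo - obj i (row i Yo) Yo <= T * n%:R,
      nrm (Y - Yo) <= delta * rtn & dist2 Y Yh <= (delta * rtn) ^+ 2].

Lemma b1_ge0 : 0 <= b1.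
Proof. exact: ltW (b1_gt0 hk). Qed.

Lemma Cinit_gt0 : 0 < Cinit.
Proof. exact: lt_le_trans (hmin_gt0 hk) (hminC hk). Qed.

Lemma K2b1_gt0 : 0 < K2 (theta_range b1).
Proof. exact: K2_gt0 (theta_range_gt0 b1_ge0). Qed.

Lemma Cv_ge0 : 0 <= Cv.
Proof.
have h1 := ltW K2b1_gt0; have h2 := ltW (theta_range_gt0 b1_ge0).
by apply: addr_ge0 => //; apply: mulr_ge0; [apply: mulr_ge0; [exact: mulr_ge0|exact: h2]|exact: b1_ge0].
Qed.

Lemma b1_le2 : b1 <= b2.
Proof.
apply: le_trans (b12 hk); rewrite lerDl.
exact: (mulr_ge0 (ltW Cinit_gt0) (addr_ge0 Cv_ge0 ler01)).
Qed.

Lemma b2_ge0 : 0 <= b2.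
Proof. exact: le_trans b1_ge0 b1_le2. Qed.

Lemma k1_gt0 : 0 < k1.
Proof. exact: K1_gt0 (theta_range_gt0 b2_ge0). Qed.

Lemma k2_gt0 : 0 < k2.
Proof. exact: K2_gt0 (theta_range_gt0 b2_ge0). Qed.

Lemma Cv2_ge0 : 0 <= Cv2.
Proof.
have h1 := ltW k2_gt0; have h2 := ltW (theta_range_gt0 b2_ge0).
by apply: addr_ge0 => //; apply: mulr_ge0; [apply: mulr_ge0; [exact: mulr_ge0|exact: h2]|exact: b2_ge0].
Qed.

Lemma Cd_ge0 : 0 <= Cd.
Proof.
have h1 := ltW k2_gt0; have h2 := ltW (theta_range_gt0 b2_ge0).
by apply: addr_ge0 => //; apply: mulr_ge0; [exact: mulr_ge0|exact: h2].
Qed.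

Lemma mu_le2 : mu <= 2.
Proof. by have := mu_le hk; lra. Qed.

Lemma bYo1 : rows_bounded b1 Yo.
Proof. by move=> i; exact: le_trans (bYo hd i) (beta0_le hk). Qed.

Lemma bYo2 : rows_bounded b2 Yo.
Proof. by move=> i; exact: le_trans (bYo1 i) b1_le2. Qed.

Lemma grad_close Y b eps : 0 <= b -> rows_bounded b Y -> rows_bounded b Yo ->
  (3 * K2 (theta_range b) * theta_range b + L) * delta <= eps -> nrm (Y - Yo) <= delta * rtn ->
  forall i y, nrm y <= b -> nrm (grad i y Y - grad i y Yo) <= eps * n%:R.
Proof.
move=> b0 bY bYo' he hD i y hy.
have h := row_grad_close K2_gt0 hc b0 (L_ge0 hk) hy bY bYo' (scoreL hd i).
apply: le_trans h _; have c0 : 0 <= 3 * K2 (theta_range b) * theta_range b + L.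
  have h2 := ltW (theta_range_gt0 b0); have h3 := ltW (K2_gt0 (theta_range_gt0 b0)).
  by apply: addr_ge0; [apply: mulr_ge0; [exact: mulr_ge0|exact: h2]|exact: L_ge0 hk].
apply: (@le_trans _ _ ((3 * K2 (theta_range b) * theta_range b + L) * rtn * (delta * rtn))).
  by apply: ler_wpM2l => //; apply: mulr_ge0 => //; exact: rtn_ge0.
have -> : (3 * K2 (theta_range b) * theta_range b + L) * rtn * (delta * rtn) =
  (3 * K2 (theta_range b) * theta_range b + L) * delta * n%:R by have := @rtn_sqr R n; move: (Num.sqrt _) => r <-; ring.
by apply: ler_wpM2r => //; exact: ltW.
Qed.

Lemma truth_grad_le b i y : 0 <= b -> rows_bounded b Yo -> nrm y <= b ->
  nrm (grad i y Yo) <= (1 + 2 * K2 (theta_range b) * theta_range b * b) * n%:R.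
Proof.
move=> b0 hb hy.
have h3 : nrm (y - row i Yo) <= 2 * b by have := frob_normB y (row i Yo); have := hb i; lra.
have h1 := row_grad_lipschitz K2_gt0 hc i b0 hy (hb i) hb.
have h2 := frob_normD (grad i y Yo - grad i (row i Yo) Yo) (grad i (row i Yo) Yo).
rewrite subrK in h2.
have c0 : 0 <= K2 (theta_range b) * theta_range b * n%:R.
  have h6 := ltW (theta_range_gt0 b0); have h7 := ltW (K2_gt0 (theta_range_gt0 b0)).
  by apply: mulr_ge0; [exact: mulr_ge0|exact: ltW].
have h4 : K2 (theta_range b) * theta_range b * n%:R * nrm (y - row i Yo) <=
  K2 (theta_range b) * theta_range b * n%:R * (2 * b) by apply: ler_wpM2l.
have h5 : tau * n%:R <= 1 * n%:R.
  by apply: ler_wpM2r; [exact: ltW|exact: tau_le1 hk].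
apply: le_trans h2 _.
have -> : (1 + 2 * K2 (theta_range b) * theta_range b * b) * n%:R =
  K2 (theta_range b) * theta_range b * n%:R * (2 * b) + 1 * n%:R by ring.
by apply: lerD; [exact: le_trans h4|exact: le_trans (small_grad hd i) h5].
Qed.

Lemma iterate_grad_le Y i : good_iterate Y -> nrm (grad i (row i Y) Y) <= Cv * n%:R.
Proof.
move=> [bY cY _ hD _].
have h1 := grad_close b1_ge0 bY bYo1 (close1 hk) hD i (bY i).
have h2 := truth_grad_le i b1_ge0 bYo1 (bY i).
have h3 := frob_normD (grad i (row i Y) Y - grad i (row i Y) Yo) (grad i (row i Y) Yo).
rewrite subrK in h3; apply: le_trans h3 _.
have -> : Cv * n%:R = 1 * n%:R + (1 + 2 * K2 (theta_range b1) * theta_range b1 * b1) * n%:R by ring.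
exact: lerD.
Qed.

Lemma iterate_aligned Y : good_iterate Y -> exists Wh, [/\ rows_bounded b2 Wh, centered Wh,
  score p A Wh *m design Wh = 0, op_bounded (w * n%:R) (score p A Wh) & well_conditioned (2 * mu) Wh]
  /\ [/\ aligned Y Wh, dist2 Y Yh = nrm (Y - Wh) ^+ 2 & loss p A Wh = loss p A Yh].
Proof.
move=> _; have [Q [hQ al e]] := dist2_attained Y Yh; exists (rotate Yh Q); split; split=> //.
- by apply: rows_bounded_rotate => // i; exact: le_trans (bYh hd i) (le_trans (beta0_le hk) b1_le2).
- exact: centered_rotate (cYh hd).
- exact: stationary_rotate (stat hd).
- by rewrite score_rotate //; exact: opF hd.
- exact: well_conditioned_rotate (wcYh hd).
- exact: loss_rotate.
Qed.

End OneStep.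

(** * One iteration from a good iterate *)

Section StepConclusion.
Context {R : realType} {n k : nat}.
Implicit Types (Y U : 'M[R]_(n, k + 1)) (y u : 'rV[R]_(k + 1)) (i : 'I_n).
Local Notation dot := frob_dot.
Local Notation nrm := frob_norm.
Local Notation rtn := (Num.sqrt (n%:R : R)).
Variables (p : R -> R -> R) (A : 'M[R]_n).
Hypothesis symA : A^T = A.
Hypothesis loglik_diff : forall i j, i != j -> forall theta : R,
  is_derive theta 1 (loglik p ^~ (A i j)) (dloglik p 1 theta (A i j)).
Hypothesis n_gt0 : 0 < n%:R :> R.
Variables (K1 K2 : R -> R).
Hypothesis K1_gt0 : forall b, 0 < b -> 0 < K1 b.
Hypothesis K2_gt0 : forall b, 0 < b -> 0 < K2 b.
Hypothesis hc : forall b, 0 < b -> forall i j, i != j ->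
  curvature_bounds (loglik p ^~ (A i j)) (dloglik p 1 ^~ (A i j)) b (K1 b) (K2 b).
Local Notation obj := (row_obj p A).
Local Notation grad := (row_grad p A).
Local Notation d := (direction p A).
Variables (Yo Yh : 'M[R]_(n, k + 1)).
Variables (beta0 b1 b2 mu tau w L T Cinit C_ls hmin delta eps1 eps2 : R).
Hypothesis hk : @step_constants R n K1 K2 beta0 b1 b2 mu tau w L T Cinit C_ls hmin delta eps1 eps2.
Hypothesis hd : step_data p A Yo Yh beta0 mu tau w L.
Local Notation k1 := (K1 (theta_range b2)).
Local Notation k2 := (K2 (theta_range b2)).
Local Notation Cv := (2 + 2 * K2 (theta_range b1) * theta_range b1 * b1).
Local Notation Cv2 := (1 + 2 * k2 * theta_range b2 * b2).
Local Notation Cd := (2 * k2 * (1 + b2) ^+ 2 + 1).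
Local Notation good := (good_iterate p A Yo Yh b1 T delta).
Local Notation D Y := (Num.sqrt (dist2 Y Yh)).

Let b2_0 : 0 <= b2. Proof. exact: (b2_ge0 K2_gt0 hk). Qed.
Let b12' : b1 <= b2. Proof. exact: (b1_le2 K2_gt0 hk). Qed.
Let k1_0 : 0 < k1. Proof. exact: K1_gt0 (theta_range_gt0 b2_0). Qed.
Let k2_0 : 0 < k2. Proof. exact: K2_gt0 (theta_range_gt0 b2_0). Qed.
Let hc2 := hc (theta_range_gt0 b2_0).
Let n0 : 0 <= n%:R :> R. Proof. exact: ltW. Qed.

(** The loss is invariant under rotations, so the growth bounds apply to the best aligned
    representative of [Yh]. *)
Lemma loss_dist2 Y : rows_bounded b2 Y -> centered Y ->
  k1 * mu / 16 * n%:R * dist2 Y Yh <= loss p A Y - loss p A Yh /\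
  loss p A Y - loss p A Yh <= (k2 * (1 + b2) ^+ 2 + 1) * n%:R * dist2 Y Yh.
Proof.
move=> bY cY; have [Q [hQ al e]] := dist2_attained Y Yh.
have bW : rows_bounded b2 (rotate Yh Q).
  by apply: rows_bounded_rotate => // i; exact: le_trans (bYh hd i) (le_trans (beta0_le hk) b12').
have cW := centered_rotate Q (cYh hd).
have sW := stationary_rotate hQ (stat hd).
have oW : op_bounded (w * n%:R) (score p A (rotate Yh Q)) by rewrite score_rotate //; exact: opF hd.
have wW := well_conditioned_rotate hQ (wcYh hd).
rewrite e -(loss_rotate p A Yh hQ); split.
  exact: (loss_growth symA b2_0 k1_0 (mu_le2 hk) (w_ge0 hk) hc2 bW cW sW oW wW bY cY al (n_large hk) (w_small hk)).
exact: (loss_upper symA b2_0 k2_0 (w_ge0 hk) (w_le1 hk) hc2 bW sW oW bY).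
Qed.

(** The lower bound on the direction is the gradient dominance behind linear convergence:
    Cauchy-Schwarz applied to [gradient_lower]. The operator norm of the score stays small because
    the score is Lipschitz and Y lies within delta sqrt n of a rotation of [Yh]. *)
Lemma iterate_direction Y : good Y ->
  [/\ nrm (score p A Y *m design Y) <= Cd * n%:R * D Y,
      k1 * mu / 8 * n%:R * D Y <= nrm (d Y)
    & op_bounded (k1 * mu / 4 * n%:R) (score p A Y)].
Proof.
move=> [bY cY _ _ hDY]; have [Q [hQ al e]] := dist2_attained Y Yh.
have bY2 : rows_bounded b2 Y by move=> i; exact: le_trans (bY i) b12'.
have bW : rows_bounded b2 (rotate Yh Q).
  by apply: rows_bounded_rotate => // i; exact: le_trans (bYh hd i) (le_trans (beta0_le hk) b12').
have cW := centered_rotate Q (cYh hd).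
have sW := stationary_rotate hQ (stat hd).
have oW : op_bounded (w * n%:R) (score p A (rotate Yh Q)) by rewrite score_rotate //; exact: opF hd.
have wW := well_conditioned_rotate hQ (wcYh hd).
have eD : D Y = nrm (Y - rotate Yh Q) by rewrite e sqrtr_sqr ger0_norm ?frob_norm_ge0.
have hDr : D Y <= delta * rtn.
  rewrite -[X in _ <= X]ger0_norm ?mulr_ge0 ?(delta_ge0 hk) ?rtn_ge0 // -sqrtr_sqr.
  exact: ler_wsqrtr.
rewrite eD in hDr *.
split.
- exact: (gradient_upper b2_0 k2_0 (w_ge0 hk) (w_le1 hk) hc2 bW sW oW bY2).
- have h := gradient_lower symA b2_0 k1_0 k2_0 (mu_le2 hk) (w_ge0 hk) hc2 bW cW sW oW wW bY2 cY al
    (n_large hk) hDr (delta_small hk).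
  have cD : centered (Y - rotate Yh Q).
    by rewrite /centered positionsB mulmxBr cY cW subr0.
  rewrite -direction_dot // -frob_dotNl in h.
  have h2 := le_trans h (frob_dot_le _ _); rewrite frob_normN in h2.
  have [z|nz] := eqVneq (nrm (Y - rotate Yh Q)) 0; first by rewrite z mulr0 frob_norm_ge0.
  have pz : 0 < nrm (Y - rotate Yh Q) by rewrite lt_neqAle eq_sym nz frob_norm_ge0.
  by rewrite -(ler_pM2r pz); apply: le_trans h2; rewrite expr2 mulrA.
- move=> x; rewrite -(subrK (score p A (rotate Yh Q)) (score p A Y)) mulmxDl.
  apply: le_trans (frob_normD _ _) _.
  have h1 := frob_norm_mulmx (score p A Y - score p A (rotate Yh Q)) x.
  have h2 := score_diff_le b2_0 k2_0 hc2 bW bY2.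
  have h3 := oW x.
  have x0 := frob_norm_ge0 x.
  have h4 : nrm (score p A Y - score p A (rotate Yh Q)) <= k2 * (2 * (1 + b2)) * delta * n%:R.
    apply: le_trans h2 _.
    apply: (@le_trans _ _ (k2 * (2 * (1 + b2)) * rtn * (delta * rtn))).
      apply: ler_wpM2l => //; apply: mulr_ge0; last exact: rtn_ge0.
      by apply: mulr_ge0; [exact: ltW|rewrite mulr_ge0 // addr_ge0].
    rewrite le_eqVlt; apply/orP; left; apply/eqP.
    by have := @rtn_sqr R n; move: (Num.sqrt _) => r <-; ring.
  apply: (@le_trans _ _ ((k2 * (2 * (1 + b2)) * delta * n%:R + w * n%:R) * nrm x)).
    by rewrite mulrDl; apply: lerD => //; apply: le_trans h1 _; apply: ler_wpM2r.
  apply: ler_wpM2r => //; rewrite -mulrDl; apply: ler_wpM2r => //.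
  have e1 : k2 * (2 * (1 + b2)) * delta = 2 * (k2 * (1 + b2) * delta) by ring.
  have := delta_small hk; have := w_ge0 hk; rewrite e1.
  move: (k1 * mu) (k2 * (1 + b2) * delta) => a c w0' h.
  by lra.
Qed.

Lemma iterate_shift Y i eta : good Y -> 0 < eta -> n%:R * eta <= Cinit ->
  exists s, [/\ row i (Y + eta *: d Y) = row i Y - eta *: grad i (row i Y) Y + s,
    nrm s <= eps2, nrm (row i Y - eta *: grad i (row i Y) Y) <= b2
  & nrm (row i (Y + eta *: d Y)) <= b2].
Proof.
move=> hY eta0 heta; have [g1 _ _] := iterate_direction hY.
have hY' := hY; have [bY cY _ _ hDY] := hY'.
set s := eta *: row_mx (center_shift p A Y) (0 : 'rV[R]_1); exists s.
set g := grad i (row i Y) Y.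
have e : row i (Y + eta *: d Y) = row i Y - eta *: g + s.
  rewrite linearD linearZ /= row_direction_split // /s /g.
  by rewrite scalerDr scalerN addrA.
have hDr : D Y <= delta * rtn.
  rewrite -[X in _ <= X]ger0_norm ?mulr_ge0 ?(delta_ge0 hk) ?rtn_ge0 // -sqrtr_sqr.
  exact: ler_wsqrtr.
have Cd0 : 0 <= Cd by exact: (Cd_ge0 K2_gt0 hk).
have r0 : 0 < rtn by rewrite sqrtr_gt0.
have sle : nrm (center_shift p A Y) <= Cd * n%:R * delta.
  rewrite -(ler_pM2r r0); apply: le_trans (center_shift_le p A n_gt0 Y) _.
  apply: le_trans g1 _; rewrite -[X in _ <= X]mulrA; apply: ler_wpM2l => //.
  by apply: mulr_ge0.
have ns : nrm s <= eps2.
  rewrite /s frob_normZ gtr0_norm //.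
  have -> : nrm (row_mx (center_shift p A Y) (0 : 'rV[R]_1)) = nrm (center_shift p A Y).
    by rewrite /frob_norm frob_dot_row_mx frob_dot0l addr0.
  apply: le_trans (shift_small hk).
  apply: (@le_trans _ _ (eta * (Cd * n%:R * delta))); first by rewrite ler_pM2l.
  have -> : eta * (Cd * n%:R * delta) = (n%:R * eta) * (Cd * delta) by ring.
  rewrite -[X in _ <= X]mulrA; apply: ler_wpM2r => //; apply: mulr_ge0 => //; exact: (delta_ge0 hk).
have hg := iterate_grad_le n_gt0 K2_gt0 hc hk hd i hY.
rewrite -/g in hg.
have ng : nrm (eta *: g) <= Cinit * Cv.
  rewrite frob_normZ gtr0_norm //.
  apply: (@le_trans _ _ (eta * (Cv * n%:R))); first by rewrite ler_pM2l.
  have -> : eta * (Cv * n%:R) = (n%:R * eta) * Cv by ring.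
  by apply: ler_wpM2r => //; exact: (Cv_ge0 K2_gt0 hk).
have h1 := frob_normB (row i Y) (eta *: g).
have h2 := frob_normD (row i Y - eta *: g) s.
have h3 := b12 hk; have h4 := eps2_le hk; have h5 := bY i.
rewrite mulrDr mulr1 addrA in h3.
split=> //.
  apply: le_trans h1 _; apply: le_trans (lerD h5 ng) _; apply: le_trans h3.
  by rewrite lerDl ltW // (Cinit_gt0 hk).
rewrite e; apply: le_trans h2 _; apply: le_trans (lerD h1 (le_trans ns h4)) _.
by apply: le_trans h3; rewrite lerD2r; exact: lerD.
Qed.

Lemma iterate_line_search Y eta : good Y -> 0 < eta -> n%:R * eta <= Cinit ->
  n%:R * eta * (k1 * mu / 8 + k2 * theta_range b2 + C_ls) <= 1 ->
  global_decrease p A C_ls Y eta && rowwise_decrease p A C_ls Y eta.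
Proof.
move=> hY eta0 heta hs; have hY' := hY; have [bY cY _ _ hDY] := hY'.
have [_ _ op] := iterate_direction hY.
have bY2 : rows_bounded b2 Y by move=> i; exact: le_trans (bY i) b12'.
have km : 0 <= k1 * mu / 4.
  by rewrite divr_ge0 // mulr_ge0 // ?ltW // (mu_gt0 hk).
apply/andP; split.
  apply: (global_decrease_small symA loglik_diff n_gt0 K2_gt0 hc b2_0 bY2 _ km op eta0).
    by move=> i; have [s [_ _ _ h]] := iterate_shift i hY eta0 heta.
  by have -> : k1 * mu / 4 / 2 = k1 * mu / 8 by field.
have hg i : nrm (row i Y - eta *: grad i (row i Y) Y) <= b2.
  by have [s [_ _ h _]] := iterate_shift i hY eta0 heta.
apply: (rowwise_decrease_small symA loglik_diff K2_gt0 hc b2_0 bY2 hg eta0).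
apply: le_trans hs; apply: ler_wpM2l; first by rewrite mulr_ge0 // ltW.
by rewrite lerD2r lerDr; rewrite divr_ge0 // mulr_ge0 // ?ltW // (mu_gt0 hk).
Qed.

(** (LS2) preserves the row levels, hence the radius [b1]; (LS1) with the lower bound on the
    direction decreases the loss gap by a multiple of n times the squared distance. The displacement
    bound feeds the geometric series of [trajectory]. *)
Lemma iterate_next Y eta : good Y -> hmin <= n%:R * eta -> n%:R * eta <= Cinit ->
  global_decrease p A C_ls Y eta -> rowwise_decrease p A C_ls Y eta ->
  let Y' := Y + eta *: d Y in
  [/\ rows_bounded b1 Y', centered Y',
      forall i, obj i (row i Y') Yo - obj i (row i Yo) Yo <= T * n%:R,
      nrm (Y' - Y) <= Cinit * Cd * D Y
    & loss p A Y' - loss p A Yh <= loss p A Y - loss p A Yh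
        - C_ls * hmin ^+ 2 * (k1 * mu / 8) ^+ 2 * n%:R * dist2 Y Yh].
Proof.
move=> hY h1 h2 ls1 ls2 Y'.
have eta0 : 0 < eta by rewrite -(pmulr_rgt0 _ n_gt0); exact: lt_le_trans (hmin_gt0 hk) h1.
have hY' := hY; have [bY cY lev hDo hDY] := hY'.
have bY2 : rows_bounded b2 Y by move=> i; exact: le_trans (bY i) b12'.
have [g1 g2 _] := iterate_direction hY.
have bYo2' : rows_bounded b2 Yo by exact: (bYo2 K2_gt0 hk hd).
have D0 : 0 <= D Y by exact: sqrtr_ge0.
have level i : obj i (row i Y') Yo - obj i (row i Yo) Yo <= T * n%:R.
  have [s [-> ns _ _]] := iterate_shift i hY eta0 h2.
  have X := (row_step loglik_diff K1_gt0 hc n_gt0 (bYo hd) (b1_gt0 hk) (beta0_le hk) (bY i)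
    (grad_close K2_gt0 hc hk hd b2_0 bY2 bYo2' (close2 hk) hDo i)
    (fun y hy => truth_grad_le n_gt0 K2_gt0 hc hk hd i b2_0 bYo2' hy)
    (iterate_grad_le n_gt0 K2_gt0 hc hk hd i hY) eta0 (hmin_gt0 hk) (C_ls_gt0 hk)
    (eps1_ge0 hk) (eps2_ge0 hk) (Cv2_ge0 K2_gt0 hk) (Cv_ge0 K2_gt0 hk) h1 h2
    (rowwise_decrease_obj symA loglik_diff i ls2) (b12 hk) ns (eps2_le hk) (lev i) (T_ge2 hk)
    (small1 hk) (small2 hk) (small3 hk)).
  exact: X.
split=> //.
- move=> i; have T0 : 0 <= T by exact: le_trans (T_ge2 hk).
  have h := row_level_set K1_gt0 hc n_gt0 (beta0_ge0 hk) (bYo hd) (small_grad hd) (cYo hd) (wcYo hd)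
    (mu_gt0 hk) (mu_le hk) (n_large' hk) (tau_small hk) T0 (level i).
  rewrite -(subrK (row i Yo) (row i Y')); apply: le_trans (frob_normD _ _) _.
  apply: le_trans (b1_radius hk); rewrite addrC -addrA; apply: lerD => //.
  exact: (bYo hd i).
- rewrite /centered /Y' positionsD positionsZ mulmxDr cY add0r -scalemxAr.
  by rewrite (direction_centered symA loglik_diff n_gt0) scaler0.
- have -> : Y' - Y = eta *: d Y by rewrite /Y' addrC addKr.
  rewrite frob_normZ gtr0_norm //.
  have hdl := le_trans (direction_le symA loglik_diff n_gt0 Y) g1.
  apply: (@le_trans _ _ (eta * (Cd * n%:R * D Y))); first by rewrite ler_pM2l.
  have -> : eta * (Cd * n%:R * D Y) = (n%:R * eta) * (Cd * D Y) by ring.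
  rewrite -[X in _ <= X]mulrA; apply: ler_wpM2r => //.
  by apply: mulr_ge0 => //; exact: (Cd_ge0 K2_gt0 hk).
- have ls1' : loss p A Y' - loss p A Y - C_ls * n%:R * eta ^+ 2 * (- nrm (d Y) ^+ 2) <= 0.
    by rewrite -(gradient_direction symA loglik_diff n_gt0); exact: ls1.
  have e : dist2 Y Yh = D Y ^+ 2 by rewrite sqr_sqrtr ?dist2_ge0.
  have a1 : (k1 * mu / 8 * n%:R * D Y) ^+ 2 <= nrm (d Y) ^+ 2.
    rewrite ler_pXn2r ?nnegrE ?frob_norm_ge0 // mulr_ge0 // mulr_ge0 // divr_ge0 //.
    by apply: mulr_ge0; [exact: ltW|exact: ltW (mu_gt0 hk)].
  have a2 : hmin ^+ 2 <= (n%:R * eta) ^+ 2.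
    have hm := ltW (hmin_gt0 hk).
    by rewrite ler_pXn2r ?nnegrE //; exact: le_trans h1.
  have a3 : hmin ^+ 2 * (k1 * mu / 8 * n%:R * D Y) ^+ 2 <= (n%:R * eta) ^+ 2 * nrm (d Y) ^+ 2.
    by apply: ler_pM; rewrite ?sqr_ge0.
  have a4 : C_ls * hmin ^+ 2 * (k1 * mu / 8) ^+ 2 * n%:R * dist2 Y Yh <=
      C_ls * n%:R * eta ^+ 2 * nrm (d Y) ^+ 2.
    rewrite -(ler_pM2r n_gt0) e.
    have -> : C_ls * hmin ^+ 2 * (k1 * mu / 8) ^+ 2 * n%:R * D Y ^+ 2 * n%:R =
      C_ls * (hmin ^+ 2 * (k1 * mu / 8 * n%:R * D Y) ^+ 2) by ring.
    have -> : C_ls * n%:R * eta ^+ 2 * nrm (d Y) ^+ 2 * n%:R =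
      C_ls * ((n%:R * eta) ^+ 2 * nrm (d Y) ^+ 2) by ring.
    by rewrite ler_pM2l // (C_ls_gt0 hk).
  move: a4 ls1'; rewrite [X in _ - X <= 0]mulrN.
  move: (C_ls * n%:R * eta ^+ 2 * _) (C_ls * hmin ^+ 2 * _ * _ * _) (loss p A Y') (loss p A Y) (loss p A Yh).
  by move=> u v l1 l2 l3 uv hh; lra.
Qed.

End StepConclusion.

(** * Induction along the iterations *)

Section Trajectory.
Context {R : realType} {n k : nat}.
Implicit Types (Y U : 'M[R]_(n, k + 1)) (y u : 'rV[R]_(k + 1)) (i : 'I_n).
Local Notation dot := frob_dot.
Local Notation nrm := frob_norm.
Local Notation rtn := (Num.sqrt (n%:R : R)).
Variables (p : R -> R -> R) (A : 'M[R]_n).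
Hypothesis symA : A^T = A.
Hypothesis loglik_diff : forall i j, i != j -> forall theta : R,
  is_derive theta 1 (loglik p ^~ (A i j)) (dloglik p 1 theta (A i j)).
Hypothesis n_gt0 : 0 < n%:R :> R.
Variables (K1 K2 : R -> R).
Hypothesis K1_gt0 : forall b, 0 < b -> 0 < K1 b.
Hypothesis K2_gt0 : forall b, 0 < b -> 0 < K2 b.
Hypothesis hc : forall b, 0 < b -> forall i j, i != j ->
  curvature_bounds (loglik p ^~ (A i j)) (dloglik p 1 ^~ (A i j)) b (K1 b) (K2 b).
Local Notation obj := (row_obj p A).
Local Notation grad := (row_grad p A).
Local Notation d := (direction p A).
Variables (Yo Yh : 'M[R]_(n, k + 1)).
Variables (beta0 b1 b2 mu tau w L T Cinit C_ls hmin delta eps1 eps2 : R).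
Hypothesis hk : @step_constants R n K1 K2 beta0 b1 b2 mu tau w L T Cinit C_ls hmin delta eps1 eps2.
Hypothesis hd : step_data p A Yo Yh beta0 mu tau w L.
Local Notation k1 := (K1 (theta_range b2)).
Local Notation k2 := (K2 (theta_range b2)).
Local Notation Cv := (2 + 2 * K2 (theta_range b1) * theta_range b1 * b1).
Local Notation Cv2 := (1 + 2 * k2 * theta_range b2 * b2).
Local Notation Cd := (2 * k2 * (1 + b2) ^+ 2 + 1).
Local Notation good := (good_iterate p A Yo Yh b1 T delta).
Local Notation D Y := (Num.sqrt (dist2 Y Yh)).

Let b2_0 : 0 <= b2. Proof. exact: (b2_ge0 K2_gt0 hk). Qed.
Let k1_0 : 0 < k1. Proof. exact: K1_gt0 (theta_range_gt0 b2_0). Qed.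
Let k2_0 : 0 < k2. Proof. exact: K2_gt0 (theta_range_gt0 b2_0). Qed.
Local Notation Lam := (k1 * mu / 8 + k2 * theta_range b2 + C_ls).
Local Notation Cu := (k2 * (1 + b2) ^+ 2 + 1).
Local Notation cg := (k1 * mu / 16).

Lemma good_step_size Y beta eta_init (Rmax : nat) c3 : good Y -> 0 < beta < 1 ->
  0 < eta_init -> hmin <= n%:R * eta_init -> n%:R * eta_init <= Cinit ->
  0 < c3 -> c3 <= Cinit -> c3 * Lam <= 1 -> hmin <= beta * c3 -> beta ^+ Rmax.+1 * Cinit <= c3 ->
  let eta := step_size p A C_ls beta Rmax eta_init Y in
  [/\ hmin <= n%:R * eta, n%:R * eta <= Cinit,
      global_decrease p A C_ls Y eta & rowwise_decrease p A C_ls Y eta].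
Proof.
move=> hY hb eta0 e1 e2 c30 c3C c3L hc3 hR eta.
have Lam0 : 0 <= Lam.
  apply: addr_ge0; last exact: ltW (C_ls_gt0 hk).
  apply: addr_ge0; first by rewrite divr_ge0 // mulr_ge0 // ?ltW // (mu_gt0 hk).
  by apply: mulr_ge0; [exact: ltW|exact: ltW (theta_range_gt0 b2_0)].
have h00 : 0 < c3 / n%:R by rewrite divr_gt0.
have nn0 : n%:R != 0 :> R by rewrite lt0r_neq0.
have hls eta' : 0 < eta' -> eta' <= c3 / n%:R ->
    global_decrease p A C_ls Y eta' && rowwise_decrease p A C_ls Y eta'.
  move=> p1 p2.
  have p3 : n%:R * eta' <= c3 by rewrite mulrC -ler_pdivlMr.
  apply: (iterate_line_search symA loglik_diff n_gt0 K1_gt0 K2_gt0 hc hk hd hY p1).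
    exact: le_trans p3 c3C.
  by apply: le_trans c3L; apply: ler_wpM2r.
have hR' : beta ^+ Rmax.+1 * eta_init <= c3 / n%:R.
  rewrite ler_pdivlMr //; apply: le_trans hR; rewrite -mulrA (mulrC eta_init).
  apply: ler_wpM2l => //; rewrite exprn_ge0 //; case/andP: hb => b0 _; exact: ltW.
have [g1 g2 g3 g4] := @backtrack_spec R n k p A C_ls beta Y Rmax.+1 eta_init _ hb eta0 h00 hls hR'.
split=> //; last first.
  by apply: le_trans e2; rewrite ler_pM2l.
apply: (@le_trans _ _ (n%:R * Num.min eta_init (beta * (c3 / n%:R)))); last by rewrite ler_pM2l.
rewrite /Num.min; case: ifP => _ //.
by rewrite mulrCA (mulrC n%:R) divfK.
Qed.

Variables (beta eta_init c3 c0 s t : R) (Rmax : nat) (Y0 : 'M[R]_(n, k + 1)).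
Hypothesis hbeta : 0 < beta < 1.
Hypothesis heta : [/\ 0 < eta_init, hmin <= n%:R * eta_init & n%:R * eta_init <= Cinit].
Hypothesis hc3 : [/\ 0 < c3, c3 <= Cinit, c3 * Lam <= 1, hmin <= beta * c3 & beta ^+ Rmax.+1 * Cinit <= c3].
Hypothesis hc0 : [/\ 0 < c0, c0 <= 1 / 2 & c0 * Cu <= C_ls * hmin ^+ 2 * (k1 * mu / 8) ^+ 2].
Hypothesis hs : 0 <= s /\ Cu <= s ^+ 2 * cg.
Hypothesis ht : [/\ 0 <= t, (1 + Cinit * Cd * s * (2 / c0)) * t <= delta & s * t <= delta].
Hypothesis hY0 : [/\ rows_bounded b1 Y0, centered Y0,
  forall i, obj i (row i Y0) Yo - obj i (row i Yo) Yo <= T * n%:R,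
  nrm (Y0 - Yo) <= t * rtn & D Y0 <= t * rtn].

Local Notation iterate r := (pgd_iterate p A C_ls beta Rmax eta_init Y0 r).
Local Notation gap Y := (loss p A Y - loss p A Yh).

Lemma dist2_sqrt Y : dist2 Y Yh = D Y ^+ 2.
Proof. by rewrite sqr_sqrtr // dist2_ge0. Qed.

(** The loss gap and n times the squared distance are equivalent, so contraction of one passes to
    the other. The bound on the distance itself is kept with the simpler ratio 1 - c0 / 2. *)
Lemma gap_dist r Y : rows_bounded b2 Y -> centered Y -> gap Y <= (1 - c0) ^+ r * gap Y0 ->
  dist2 Y Yh <= Cu / cg * (1 - c0) ^+ r * dist2 Y0 Yh /\ D Y <= s * (1 - c0 / 2) ^+ r * D Y0.
Proof.
move=> bY cY hg; have [c00 c01 _] := hc0; have [s0 hs2] := hs; have [bY0 cY0 _ _ _] := hY0.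
have bY02 : rows_bounded b2 Y0 by move=> i; exact: le_trans (bY0 i) (b1_le2 K2_gt0 hk).
have [h1 _] := loss_dist2 symA K1_gt0 K2_gt0 hc hk hd bY cY.
have [_ h2] := loss_dist2 symA K1_gt0 K2_gt0 hc hk hd bY02 cY0.
have q0 : 0 <= 1 - c0 by lra.
have cg0 : 0 < cg by rewrite divr_gt0 // mulr_gt0 // (mu_gt0 hk).
have a1 : dist2 Y Yh <= Cu / cg * (1 - c0) ^+ r * dist2 Y0 Yh.
  have cgn : 0 < cg * n%:R by rewrite mulr_gt0.
  rewrite -(ler_pM2l cgn); apply: le_trans h1 _; apply: le_trans hg _.
  apply: (@le_trans _ _ ((1 - c0) ^+ r * (Cu * n%:R * dist2 Y0 Yh))).
    by apply: ler_wpM2l => //; exact: exprn_ge0.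
  rewrite le_eqVlt; apply/orP; left; apply/eqP; field.
  by rewrite !lt0r_neq0 // (mu_gt0 hk).
split=> //.
have q20 : 0 <= 1 - c0 / 2 by lra.
have p0 : 0 <= s * (1 - c0 / 2) ^+ r * D Y0.
  by apply: mulr_ge0; [apply: mulr_ge0 => //; exact: exprn_ge0|exact: sqrtr_ge0].
rewrite -(ler_pXn2r (_ : 0 < 2)%N) ?nnegrE ?sqrtr_ge0 // -dist2_sqrt.
apply: le_trans a1 _; rewrite !exprMn -dist2_sqrt.
apply: ler_wpM2r; first exact: dist2_ge0.
apply: ler_pM; rewrite ?exprn_ge0 //.
- apply: divr_ge0; last exact: ltW.
  by apply: addr_ge0 => //; apply: mulr_ge0; [exact: ltW|exact: sqr_ge0].
- by rewrite ler_pdivrMr.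
(* Here 1 - c0 <= (1 - c0 / 2)^2. *)
rewrite -exprM mulnC exprM; apply: lerXn2r; rewrite ?nnegrE ?exprn_ge0 //.
rewrite -subr_ge0; have -> : (1 - c0 / 2) ^+ 2 - (1 - c0) = (c0 / 2) ^+ 2 by field.
exact: sqr_ge0.
Qed.

(** The distance modulo rotation does not keep the iterates near the fixed [Yo]. Displacements are
    bounded by the current distance to [Yh], which decays geometrically, so the total drift is at
    most a constant times the initial distance. *)
Lemma trajectory r : [/\ good (iterate r), gap (iterate r) <= (1 - c0) ^+ r * gap Y0
  & nrm (iterate r - Y0) <= Cinit * Cd * s * D Y0 * ((1 - (1 - c0 / 2) ^+ r) * (2 / c0))].
Proof.
have [c00 c01 c02] := hc0; have [s0 hs2] := hs; have [bY0 cY0 lY0 oY0 dY0] := hY0.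
have [t0 ht1 ht2] := ht.
have q0 : 0 <= 1 - c0 by lra.
have q20 : 0 <= 1 - c0 / 2 by lra.
have r0 : 0 <= rtn by exact: rtn_ge0.
have D00 : 0 <= D Y0 by exact: sqrtr_ge0.
have CC : 0 <= Cinit * Cd * s.
  apply: mulr_ge0 => //; apply: mulr_ge0; [exact: ltW (Cinit_gt0 hk)|exact: (Cd_ge0 K2_gt0 hk)].
have mk_good m Y : rows_bounded b1 Y -> centered Y ->
    (forall i, obj i (row i Y) Yo - obj i (row i Yo) Yo <= T * n%:R) ->
    gap Y <= (1 - c0) ^+ m * gap Y0 ->
    nrm (Y - Y0) <= Cinit * Cd * s * D Y0 * ((1 - (1 - c0 / 2) ^+ m) * (2 / c0)) -> good Y.
  move=> bY cY lY gY mY; split=> //.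
    apply: le_trans (frob_dist_triangle Y Y0 Yo) _.
    apply: (@le_trans _ _ ((1 + Cinit * Cd * s * (2 / c0)) * t * rtn)); last by apply: ler_wpM2r.
    rewrite -mulrA mulrDl mul1r addrC; apply: lerD => //.
    apply: le_trans mY _.
    apply: (@le_trans _ _ (Cinit * Cd * s * (t * rtn) * (1 * (2 / c0)))); last first.
      by rewrite mul1r mulrAC.
    apply: ler_pM.
    - exact: mulr_ge0.
    - apply: mulr_ge0; last by rewrite divr_ge0 // ltW.
      by rewrite subr_ge0 exprn_ile1 //; lra.
    - exact: ler_wpM2l.
    - apply: ler_wpM2r; first by rewrite divr_ge0 // ltW.
      by rewrite gerBl exprn_ge0.
  have bY2 : rows_bounded b2 Y by move=> i; exact: le_trans (bY i) (b1_le2 K2_gt0 hk).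
  have [_ h] := gap_dist bY2 cY gY.
  rewrite dist2_sqrt ler_pXn2r ?nnegrE ?sqrtr_ge0 ?mulr_ge0 ?(delta_ge0 hk) //.
  apply: le_trans h _.
  apply: (@le_trans _ _ (s * 1 * (t * rtn))).
    apply: ler_pM => //; first by rewrite mulr_ge0 // exprn_ge0.
    by apply: ler_wpM2l => //; rewrite exprn_ile1 //; lra.
  by rewrite mulr1 mulrA; apply: ler_wpM2r.
elim: r => [|r [hg hgap hmove]].
  have g0 : gap Y0 <= (1 - c0) ^+ 0 * gap Y0 by rewrite expr0 mul1r.
  have m0 : nrm (Y0 - Y0) <= Cinit * Cd * s * D Y0 * ((1 - (1 - c0 / 2) ^+ 0) * (2 / c0)).
    by rewrite subrr frob_norm0 expr0 subrr mul0r mulr0.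
  by split => //; apply: (mk_good 0%N).
set Y := iterate r in hg hgap hmove *.
set eta := step_size p A C_ls beta Rmax eta_init Y.
have eY : iterate r.+1 = Y + eta *: d Y by [].
have [e0 e1 e2] := heta; have [a1 a2 a3 a4 a5] := hc3.
have [st1 st2 st3 st4] := good_step_size hg hbeta e0 e1 e2 a1 a2 a3 a4 a5.
have [bY' cY' lY' mY' gY'] := iterate_next symA loglik_diff n_gt0 K1_gt0 K2_gt0 hc hk hd hg st1 st2 st3 st4.
rewrite -/eta -eY in bY' cY' lY' mY' gY'.
have hg' := hg; have [bY cY _ _ _] := hg'.
have bY2 : rows_bounded b2 Y by move=> i; exact: le_trans (bY i) (b1_le2 K2_gt0 hk).
have [_ up] := loss_dist2 symA K1_gt0 K2_gt0 hc hk hd bY2 cY.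
have [_ hD] := gap_dist bY2 cY hgap.
have nd0 : 0 <= n%:R * dist2 Y Yh by rewrite mulr_ge0 ?dist2_ge0.
have gap1 : gap (iterate r.+1) <= (1 - c0) * gap Y.
  have b3 : c0 * gap Y <= c0 * (Cu * n%:R * dist2 Y Yh) by apply: ler_wpM2l => //; exact: ltW.
  have b4 : c0 * Cu * (n%:R * dist2 Y Yh) <=
    C_ls * hmin ^+ 2 * (k1 * mu / 8) ^+ 2 * (n%:R * dist2 Y Yh) by apply: ler_wpM2r.
  apply: le_trans gY' _; rewrite mulrBl mul1r; apply: lerB => //.
  apply: le_trans b3 _; rewrite -[X in _ <= X]mulrA; apply: le_trans b4.
  by rewrite le_eqVlt; apply/orP; left; apply/eqP; ring.
have gap2 : gap (iterate r.+1) <= (1 - c0) ^+ r.+1 * gap Y0.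
  by apply: le_trans gap1 _; rewrite (exprS (1 - c0) r) -mulrA; apply: ler_wpM2l.
have move2 : nrm (iterate r.+1 - Y0) <=
    Cinit * Cd * s * D Y0 * ((1 - (1 - c0 / 2) ^+ r.+1) * (2 / c0)).
  apply: le_trans (frob_dist_triangle _ Y _) _.
  (* The next term of the geometric series is added to its closed-form partial sum. *)
  have -> : Cinit * Cd * s * D Y0 * ((1 - (1 - c0 / 2) ^+ r.+1) * (2 / c0)) =
    Cinit * Cd * (s * (1 - c0 / 2) ^+ r * D Y0) +
    Cinit * Cd * s * D Y0 * ((1 - (1 - c0 / 2) ^+ r) * (2 / c0)).
    rewrite (exprS (1 - c0 / 2) r); have c0n := lt0r_neq0 c00.
    by move: ((1 - c0 / 2) ^+ r) (Cinit * Cd) (D Y0) => z a b; field.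
  apply: lerD => //; apply: le_trans mY' _; apply: ler_wpM2l => //.
  by apply: mulr_ge0; [exact: ltW (Cinit_gt0 hk)|exact: (Cd_ge0 K2_gt0 hk)].
by split=> //; apply: (mk_good r.+1).
Qed.

Lemma trajectory_dist r : dist2 (iterate r) Yh <= Cu / cg * (1 - c0) ^+ r * dist2 Y0 Yh.
Proof.
have [[bY cY _ _ _] hgap _] := trajectory r.
have bY2 : rows_bounded b2 (iterate r) by move=> i; exact: le_trans (bY i) (b1_le2 K2_gt0 hk).
by have [] := gap_dist bY2 cY hgap.
Qed.

End Trajectory.

(** * Simultaneous smallness conditions *)

Section SmallConstants.
Context {R : realType}.

(** One threshold for a finite list of conditions a u <= c with c > 0; the lists below collect all
    the smallness requirements. *)
Lemma small_constant (s : seq (R * R)) : all (fun c => 0 < c.2) s ->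
  exists2 e : R, 0 < e & forall u, 0 <= u -> u <= e -> all (fun c => c.1 * u <= c.2) s.
Proof.
elim: s => [|[a c] s IH] /=; first by exists 1.
case/andP => c0 /IH [e e0 he].
have a1 : 0 < `|a| + 1 by rewrite ltr_wpDl.
exists (Num.min e (c / (`|a| + 1))); first by rewrite lt_min e0 divr_gt0.
move=> u u0; rewrite le_min => /andP [ue uc]; rewrite he // andbT.
rewrite ler_pdivlMr // mulrC in uc; apply: le_trans uc; apply: ler_wpM2r => //.
by apply: le_trans (ler_norm a) _; rewrite lerDl.
Qed.

Lemma expr_small (beta c : R) : 0 < beta < 1 -> 0 < c ->
  exists R0 : nat, forall m : nat, (R0 <= m)%N -> beta ^+ m.+1 <= c.
Proof.
move=> /andP [b0 b1] c0.
have b1' : `|beta| < 1 by rewrite gtr0_norm.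
have /cvgrPdist_le /(_ _ c0) [N _ hN] := cvg_expr b1'.
exists N => m hm; have := hN m.+1 (leq_trans hm (leqnSn m)).
by rewrite /= sub0r normrN ger0_norm // exprn_ge0 // ltW.
Qed.

End SmallConstants.

(** * Choice of constants for linear convergence near a stationary estimator *)

Section LocalConvergence.
Context {R : realType} {k : nat}.
Local Notation nrm := frob_norm.
Variables (p : R -> R -> R) (K1 K2 : R -> R).
Hypothesis K1_gt0 : forall b, 0 < b -> 0 < K1 b.
Hypothesis K2_gt0 : forall b, 0 < b -> 0 < K2 b.

Definition data_regular n (A : 'M[R]_n) : Prop :=
  [/\ A^T = A,
      forall i j, i != j -> forall theta : R,
        is_derive theta 1 (loglik p ^~ (A i j)) (dloglik p 1 theta (A i j))
    & forall b, 0 < b -> forall i j, i != j ->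
        curvature_bounds (loglik p ^~ (A i j)) (dloglik p 1 ^~ (A i j)) b (K1 b) (K2 b)].

(** The constants are fixed before n and the data. What varies with n enters through t, L, tau, w
    and 1/n; as L may grow, smallness is required of the product L t. *)
Lemma local_convergence (beta0 b0 mu C_ls Cinit beta : R) :
  0 <= beta0 -> 0 <= b0 -> 0 < mu -> 2 * mu <= 1 -> 0 < C_ls -> 1 < Cinit -> 0 < beta < 1 ->
  exists C c0 e0 R0, [/\ 0 < C, 0 < c0 < 1, 0 < e0 &
    forall n (A : 'M[R]_n) (Yo Yh Y0 : 'M[R]_(n, k + 1)) (tau w L t eta_init : R) (Rmax r : nat),
    data_regular A -> step_data p A Yo Yh beta0 mu tau w L ->
    1 <= L -> 0 <= t -> L * t <= e0 -> 0 <= tau <= e0 -> 0 <= w <= e0 -> 1 <= e0 * n%:R ->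
    (R0 <= Rmax)%N -> 1 / Cinit <= n%:R * eta_init <= Cinit ->
    rows_bounded b0 Y0 -> centered Y0 -> nrm (Y0 - Yo) <= t * Num.sqrt n%:R ->
    Num.sqrt (dist2 Y0 Yh) <= t * Num.sqrt n%:R ->
    dist2 (pgd_iterate p A C_ls beta Rmax eta_init Y0 r) Yh <= C * (1 - c0) ^+ r * dist2 Y0 Yh].
Proof.
move=> beta00 b00 mu0 mu1 Cls0 Ci1 hbeta.
have Ci0 : 0 < Cinit by exact: lt_trans Ci1.
have b0' : 0 < beta by case/andP: hbeta.
pose tr := @theta_range R.
have tr0 b : 0 <= b -> 0 < tr b by exact: theta_range_gt0.
pose bb := b0 + beta0.
have bb0 : 0 <= bb by exact: addr_ge0.
(* Large enough for the row levels of any initial estimate with rows bounded by b0 ([row_obj_upper]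
   with tau <= 1). *)
pose T := 2 + 2 * bb + K2 (tr bb) / 2 * (tr bb * (2 * bb) ^+ 2).
have Kbb : 0 < K2 (tr bb) by exact: K2_gt0 (tr0 _ bb0).
have T2 : 2 <= T.
  have a1 := tr0 _ bb0.
  have a2 : 0 <= K2 (tr bb) / 2 * (tr bb * (2 * bb) ^+ 2).
    by apply: mulr_ge0; [rewrite divr_ge0 // ltW|apply: mulr_ge0; [exact: ltW|exact: sqr_ge0]].
  by rewrite /T -addrA lerDl; apply: addr_ge0 => //; exact: mulr_ge0.
have T0 : 0 <= T by exact: le_trans T2.
have be1 : 0 <= beta0 + 1 by exact: addr_ge0.
pose c4 := K1 (tr (beta0 + 1)) * mu / 4.
have c40 : 0 < c4 by rewrite divr_gt0 // mulr_gt0 // K1_gt0 // tr0.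
(* The radius of the level sets, enlarged to contain the initial rows; [b2] below adds the longest
   trial step. *)
pose b1 := beta0 + 1 + T / c4 + b0.
have Tc : 0 <= T / c4 by rewrite divr_ge0 // ltW.
have b1_0 : 0 < b1 by rewrite /b1; lra.
have b1_1 : beta0 <= b1 by rewrite /b1; lra.
have b1_2 : b0 <= b1 by rewrite /b1; lra.
have b1_3 : beta0 + 1 + T / c4 <= b1 by rewrite /b1; lra.
have T3 tau : 0 <= tau -> tau <= 1 ->
    tau * (2 * bb) + K2 (tr bb) / 2 * (tr bb * (2 * bb) ^+ 2) <= T.
  move=> _ t1; have : tau * (2 * bb) <= 1 * (2 * bb) by apply: ler_wpM2r => //; exact: mulr_ge0.
  by rewrite /T mul1r; move: (tau * _) (K2 _ / 2 * _) => x y; lra.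
clearbody b1 T.
have K2b1 := K2_gt0 (tr0 _ (ltW b1_0)); have tb1 := tr0 _ (ltW b1_0).
pose Cv := 2 + 2 * K2 (tr b1) * tr b1 * b1.
have Cv0 : 0 <= Cv by apply: addr_ge0 => //; apply: mulr_ge0; [apply: mulr_ge0; [apply: mulr_ge0 => //|]|]; exact: ltW.
pose b2 := b1 + Cinit * (Cv + 1).
have b2_0 : 0 < b2 by rewrite /b2 ltr_wpDr //; apply: mulr_ge0; [exact: ltW|exact: addr_ge0].
have b2_1 : b1 + Cinit * (Cv + 1) <= b2 by [].
clearbody b2.
have K1b2 := K1_gt0 (tr0 _ (ltW b2_0)); have K2b2 := K2_gt0 (tr0 _ (ltW b2_0)).
have tb2 := tr0 _ (ltW b2_0).
set k1 := K1 (tr b2) in K1b2; set k2 := K2 (tr b2) in K2b2.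
pose Lam := k1 * mu / 8 + k2 * tr b2 + C_ls.
have km0 : 0 < k1 * mu by exact: mulr_gt0.
have Lam0 : 0 < Lam.
  by rewrite /Lam ltr_wpDl // addr_ge0 // ?divr_ge0 // ltW // mulr_gt0.
pose c3 := Num.min Cinit (1 / Lam).
(* Below [c3], n times a step size always passes the line search; [hmin] is the resulting lower
   bound for accepted steps. *)
have c30 : 0 < c3 by rewrite lt_min Ci0 divr_gt0.
have c3C : c3 <= Cinit by rewrite ge_min lexx.
have c3L : c3 * Lam <= 1 by rewrite -ler_pdivlMr // ge_min lexx orbT.
clearbody c3.
pose hmin := Num.min (1 / Cinit) (beta * c3).
have h0 : 0 < hmin by rewrite lt_min divr_gt0 // mulr_gt0.
have h1 : hmin <= 1 / Cinit by rewrite ge_min lexx.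
have h2 : hmin <= beta * c3 by rewrite ge_min lexx orbT.
have h3 : hmin <= Cinit.
  apply: le_trans h1 _; apply: (@le_trans _ _ 1); last exact: ltW.
  by rewrite ler_pdivrMr // mul1r ltW.
clearbody hmin.
pose Cu := k2 * (1 + b2) ^+ 2 + 1; pose cg := k1 * mu / 16.
have Cu0 : 0 < Cu by rewrite /Cu ltr_wpDl // mulr_ge0 ?sqr_ge0 // ltW.
have cg0 : 0 < cg by rewrite divr_gt0.
pose q := C_ls * hmin ^+ 2 * (k1 * mu / 8) ^+ 2.
have q0 : 0 < q by rewrite /q; apply: mulr_gt0; [apply: mulr_gt0 => //; exact: exprn_gt0|apply: exprn_gt0; rewrite divr_gt0].
(* The decrease ensured by (LS1), relative to the upper bound on the loss gap, both per n times the
   squared distance. *)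
pose c0 := Num.min (1 / 2) (q / Cu).
have c00 : 0 < c0 by rewrite lt_min !divr_gt0.
have c01 : c0 <= 1 / 2 by rewrite ge_min lexx.
have c0q : c0 * Cu <= q by rewrite -ler_pdivlMr // ge_min lexx orbT.
clearbody c0.
pose s := 1 + Cu / cg.
have Cucg : 0 < Cu / cg by exact: divr_gt0.
have s0 : 0 <= s by rewrite addr_ge0 // ltW.
have hs : Cu <= s ^+ 2 * cg.
  rewrite -ler_pdivrMr // /s; move: (Cu / cg) Cucg => x x0.
  have := sqr_ge0 x; rewrite sqrrD mul1r expr1n; move: (x ^+ 2) => y; lra.
clearbody s.
pose Cd := 2 * k2 * (1 + b2) ^+ 2 + 1.
have Cd0 : 0 <= Cd by rewrite /Cd addr_ge0 // mulr_ge0 ?sqr_ge0 // mulr_ge0 // ltW.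
(* Ratio between the radius [delta] kept along the trajectory and the initial radius t, from the sum
   of the displacements. *)
pose C1 := 1 + Cinit * Cd * s * (2 / c0) + s.
have C1a : 0 <= Cinit * Cd * s * (2 / c0).
  by apply: mulr_ge0; [apply: mulr_ge0 => //; apply: mulr_ge0 => //; exact: ltW|rewrite divr_ge0 // ltW].
have C10 : 0 <= C1 by rewrite /C1 addr_ge0 // addr_ge0.
have C1b : 1 + Cinit * Cd * s * (2 / c0) <= C1 by rewrite /C1 lerDl.
have C1c : s <= C1 by rewrite /C1 lerDr addr_ge0.
clearbody C1.
pose Cv2 := 1 + 2 * k2 * tr b2 * b2.
pose C2 := 3 * k2 * tr b2 + 1.
pose C3 := 3 * K2 (tr b1) * tr b1 + 1.
pose E1 := C2 * C1; pose E2 := Cinit * Cd * C1.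
(* Conditions on tau, w and 1/n are read off at u = e0, those on the radius at u = L t. *)
pose cs : seq (R * R) := [:: (1, 1); (1, k1 * mu / 8); (k2 * (1 + b2) * C1 + 1, k1 * mu / 8);
  (1, c4); (8 * (1 + b2) ^+ 2, mu); (tr (beta0 + 1), mu); (C3 * C1, 1); (E2, Cinit);
  (E1 * Cinit * Cv + Cv2 * E2, 1);
  (E1 * Cinit * Cv + Cv2 * E2, C_ls * hmin ^+ 2 * (1 / (4 * b1)) ^+ 2);
  (E1, 1 / (4 * b1))].
have cs0 : all (fun c => 0 < c.2) cs.
  rewrite /= !ltr01 c40 mu0 Ci0 !andbT.
  have -> : 0 < k1 * mu / 8 by rewrite divr_gt0.
  have -> : 0 < 1 / (4 * b1) by rewrite divr_gt0 // mulr_gt0.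
  rewrite /= andbT; apply: mulr_gt0; [apply: mulr_gt0 => //; exact: exprn_gt0|].
  by apply: exprn_gt0; rewrite divr_gt0 // mulr_gt0.
have [e0 e00 he0] := small_constant cs0.
have [R0 hR0] := expr_small hbeta (divr_gt0 c30 Ci0).
exists (Cu / cg), c0, e0, R0; split=> //; first by rewrite c00 /=; lra.
move=> n A Yo Yh Y0 tau w L t eta_init Rmax r [symA ld hc] hd L1 t0 Lt tau1 w1 en hR heta bY0 cY0 nY0 dY0.
have L0 : 0 <= L by exact: le_trans L1.
have n0 : 0 < n%:R :> R by rewrite -(pmulr_rgt0 _ e00); exact: lt_le_trans en.
have /= := he0 _ (ltW e00) (lexx _).
case/and5P=> z1 z2 z3 z4 /and3P [z5 z6 _].
have Lt0 : 0 <= L * t by exact: mulr_ge0.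
have /= := he0 _ Lt0 Lt.
case/and5P=> _ _ y3 _ /and5P [_ _ y7 y8 /and4P [y9 y10 y11 _]].
have [tau0 tau2] := andP tau1; have [w0 w2] := andP w1.
rewrite !mul1r in z1 z2 z4.
have tLt : t <= L * t by apply: ler_peMl.
have large c : 0 <= c -> c * e0 <= mu -> c <= mu * n%:R.
  move=> cc hcc; apply: (@le_trans _ _ (c * (e0 * n%:R))); first exact: ler_peMr.
  by rewrite mulrA; apply: ler_wpM2r => //; exact: ltW.
pose delta := C1 * t.
have dl0 : 0 <= delta by exact: mulr_ge0.
have dlt : delta <= C1 * (L * t) by apply: ler_wpM2l.
have coefL a : 0 <= a -> (a + L) * delta <= (a + 1) * C1 * (L * t).
  move=> a0; have -> : (a + 1) * C1 * (L * t) = ((a + 1) * L) * delta by rewrite /delta; ring.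
  apply: ler_wpM2r => //; rewrite mulrDl mul1r lerD2r; exact: ler_peMr.
have a1 : 0 <= 3 * k2 * tr b2 by apply: mulr_ge0; [apply: mulr_ge0 => //|]; exact: ltW.
have a2 : 0 <= 3 * K2 (tr b1) * tr b1 by apply: mulr_ge0; [apply: mulr_ge0 => //|]; exact: ltW.
pose eps1 := (3 * k2 * tr b2 + L) * delta; pose eps2 := Cinit * Cd * delta.
have e10 : 0 <= eps1 by apply: mulr_ge0 => //; exact: addr_ge0.
have CC : 0 <= Cinit * Cd by apply: mulr_ge0 => //; exact: ltW.
have e20 : 0 <= eps2 by exact: mulr_ge0.
have e1E : eps1 <= E1 * (L * t) by exact: coefL.
have e2E : eps2 <= E2 * (L * t) by rewrite /eps2 /E2 -[X in _ <= X]mulrA; apply: ler_wpM2l.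
have Cv20 : 0 <= Cv2.
  by apply: addr_ge0 => //; apply: mulr_ge0; [apply: mulr_ge0; [apply: mulr_ge0 => //|]|]; exact: ltW.
have comb : eps1 * Cinit * Cv + Cv2 * eps2 <= (E1 * Cinit * Cv + Cv2 * E2) * (L * t).
  have -> : (E1 * Cinit * Cv + Cv2 * E2) * (L * t) = E1 * (L * t) * Cinit * Cv + Cv2 * (E2 * (L * t)).
    by ring.
  apply: lerD; last exact: ler_wpM2l.
  by apply: ler_wpM2r => //; apply: ler_wpM2r => //; exact: ltW.
have hk : @step_constants R n K1 K2 beta0 b1 b2 mu tau w L T Cinit C_ls hmin delta eps1 eps2.
  split => //.
  - exact: le_trans tau2 z1.
  - exact: le_trans w2 z1.
  - by apply: large => //; apply: mulr_ge0 => //; exact: sqr_ge0.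
  - exact: le_trans w2 z2.
  - apply: le_trans z3; rewrite mulrDl mul1r; apply: lerD => //.
    rewrite /delta mulrA; apply: ler_wpM2l; last exact: le_trans tLt Lt.
    apply: mulr_ge0 => //; apply: mulr_ge0; first exact: ltW.
    by apply: addr_ge0 => //; exact: ltW.
  - exact: le_trans tau2 z4.
  - by apply: large => //; exact: ltW (tr0 _ be1).
  - exact: le_trans (coefL _ a2) y7.
  - exact: le_trans e2E y8.
  - exact: le_trans comb y9.
  - exact: le_trans comb y10.
  - exact: le_trans e1E y11.
have ei0 : 0 < eta_init.
  rewrite -(pmulr_rgt0 _ n0); case/andP: heta => x _; apply: lt_le_trans x; exact: divr_gt0.
apply: (trajectory_dist symA ld n0 K1_gt0 K2_gt0 hc hk hd (beta := beta) (c3 := c3) (s := s) (t := t)) => //.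
- by case/andP: heta => x1 x2; split=> //; exact: le_trans x1.
- split=> //.
  by rewrite -ler_pdivlMr //; exact: hR0.
- by split=> //; apply: ler_wpM2r.
- split=> //; first by move=> i; exact: le_trans (bY0 i) b1_2.
  move=> i; have hb0 : beta0 <= bb by rewrite lerDr.
  have hb1 : nrm (row i Y0) <= bb by apply: le_trans (bY0 i) _; rewrite lerDl.
  have h := row_obj_upper K2_gt0 hc beta00 (bYo hd) (small_grad hd) i tau0 hb0 hb1.
  apply: le_trans h _; apply: ler_wpM2r; first exact: ltW.
  by apply: T3 => //; exact: le_trans tau2 z1.
Qed.

End LocalConvergence.

(** * Row constraints and feasible directions *)

Section RowConstraint.
Context {R : realType} {k : nat}.
Local Notation dot := frob_dot.
Local Notation nrm := frob_norm.
Implicit Types (y u : 'rV[R]_(k + 1)).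

Definition row_ok (M : R) y : Prop := nrm (positions y) <= M /\ nrm (degrees y) <= M.

Lemma row_ok_le M M' y : M <= M' -> row_ok M y -> row_ok M' y.
Proof. by move=> h [h1 h2]; split; apply: le_trans h. Qed.

Lemma row_ok_norm M y : row_ok M y -> nrm y <= 2 * M.
Proof.
move=> [h1 h2].
have h : nrm y ^+ 2 <= (nrm (positions y) + nrm (degrees y)) ^+ 2.
  rewrite sqr_frob_norm frob_dot_split -!sqr_frob_norm.
  have := mulr_ge0 (frob_norm_ge0 (positions y)) (frob_norm_ge0 (degrees y)).
  rewrite sqrrD; move: (nrm _ * _) (nrm _ ^+ 2) (nrm _ ^+ 2) => a b c; lra.
rewrite ler_pXn2r ?nnegrE ?addr_ge0 ?frob_norm_ge0 // in h.
by apply: le_trans h _; rewrite mulrDl mul1r; exact: lerD.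
Qed.

Lemma norm_row_ok M y : nrm y <= M -> row_ok M y.
Proof. by move=> h; split; apply: le_trans h; [exact: positions_le|exact: degrees_le]. Qed.

Lemma row_ok_shift M M' y u : row_ok M y -> nrm u <= M' -> row_ok (M + M') (y + u).
Proof.
move=> [h1 h2] h3; split.
  rewrite positionsD; apply: le_trans (frob_normD _ _) _; apply: lerD => //.
  exact: le_trans (positions_le u) h3.
rewrite degreesD; apply: le_trans (frob_normD _ _) _; apply: lerD => //.
exact: le_trans (degrees_le u) h3.
Qed.

Lemma row_ok_convex M y y' (t : R) : 0 <= t <= 1 -> row_ok M y -> row_ok M y' ->
  row_ok M (y + t *: (y' - y)).
Proof.
move=> /andP [t0 t1] [h1 h2] [h3 h4].
have e : y + t *: (y' - y) = (1 - t) *: y + t *: y'.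
  by rewrite scalerBl scale1r scalerBr addrA addrAC.
have t2 : 0 <= 1 - t by rewrite subr_ge0.
have h : M = (1 - t) * M + t * M by ring.
rewrite e; split; rewrite ?positionsD ?degreesD ?positionsZ ?degreesZ.
  apply: le_trans (frob_normD _ _) _; rewrite !frob_normZ !ger0_norm // [X in _ <= X]h.
  by apply: lerD; apply: ler_wpM2l.
apply: le_trans (frob_normD _ _) _; rewrite !frob_normZ !ger0_norm // [X in _ <= X]h.
by apply: lerD; apply: ler_wpM2l.
Qed.

Lemma row_ok_interior M M' y u : row_ok M y -> M < M' ->
  exists2 t0 : R, 0 < t0 & forall t, 0 <= t -> t <= t0 -> row_ok M' (y + t *: u).
Proof.
move=> hy hM; have u1 : 0 < nrm u + 1 by rewrite ltr_wpDl // frob_norm_ge0.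
exists ((M' - M) / (nrm u + 1)); first by rewrite divr_gt0 // subr_gt0.
move=> t t0; rewrite ler_pdivlMr // => ht.
have -> : M' = M + (M' - M) by rewrite addrC subrK.
apply: row_ok_shift => //; rewrite frob_normZ ger0_norm //; apply: le_trans ht.
by apply: ler_wpM2l => //; rewrite lerDl.
Qed.

End RowConstraint.

Section Feasible.
Context {R : realType} {n k : nat}.
Local Notation dot := frob_dot.
Local Notation nrm := frob_norm.
Implicit Types (Y U : 'M[R]_(n, k + 1)).

Definition row_feasible (M : R) Y : Prop := (forall i, row_ok M (row i Y)) /\ centered Y.

Lemma row_feasible_bounded M Y : row_feasible M Y -> rows_bounded (2 * M) Y.
Proof. by move=> [h _] i; exact: row_ok_norm (h i). Qed.

Lemma uniform_small (Q : 'I_n -> R -> Prop) :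
  (forall i, exists2 t0 : R, 0 < t0 & forall t, 0 <= t -> t <= t0 -> Q i t) ->
  exists2 t0 : R, 0 < t0 & forall t, 0 <= t -> t <= t0 -> forall i, Q i t.
Proof.
move=> /fin_all_exists2 [f f0 hf].
exists (\big[Num.min/1]_i f i).
  by apply/bigmin_gtP; split.
move=> t t0 ht i; apply: hf => //; apply: le_trans ht _.
exact: bigmin_le_cond.
Qed.

End Feasible.

Lemma sub_le_sum3 (R : realType) (x y z c a a' : R) :
  - a <= x -> c <= y -> - a' <= z -> c - (a + a') <= x + (y + z).
Proof. by move=> *; lra. Qed.

Lemma le_of_sub_le (R : realType) (x y z v v' : R) :
  z - v <= x -> y <= v' -> x - y <= 0 -> z <= v + v'.
Proof. by move=> *; lra. Qed.

(** * Consistency and stationarity of the constrained estimator *)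

Section Minimizer.
Context {R : realType} {n k : nat}.
Implicit Types (Y U : 'M[R]_(n, k + 1)) (y u : 'rV[R]_(k + 1)) (i : 'I_n).
Local Notation dot := frob_dot.
Local Notation nrm := frob_norm.
Local Notation rtn := (Num.sqrt (n%:R : R)).
Variables (p : R -> R -> R) (K1 K2 : R -> R) (A : 'M[R]_n).
Hypothesis K1_gt0 : forall b, 0 < b -> 0 < K1 b.
Hypothesis K2_gt0 : forall b, 0 < b -> 0 < K2 b.
Hypothesis regA : data_regular p K1 K2 A.
Hypothesis n_gt0 : 0 < n%:R :> R.
Variables (M M1 : R) (Yo Yh : 'M[R]_(n, k + 1)).
Hypotheses (M1_gt0 : 0 < M1) (M1_le : 2 * M1 <= M).
Hypotheses (feasYo : row_feasible M1 Yo) (feasYh : row_feasible M Yh).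
Hypothesis minYh : forall Y, row_feasible M Y -> loss p A Yh <= loss p A Y.
Local Notation b := (2 * M).
Local Notation F := (score p A Yh).
Local Notation E := (score p A Yo).
Local Notation tr := (theta_range b).
Local Notation k1 := (K1 tr).
Local Notation k2 := (K2 tr).

Let symA : A^T = A. Proof. by case: regA. Qed.
Let ld : forall i j, i != j -> forall theta : R,
  is_derive theta 1 (loglik p ^~ (A i j)) (dloglik p 1 theta (A i j)).
Proof. by case: regA. Qed.
Let hc : forall b, 0 < b -> forall i j, i != j ->
  curvature_bounds (loglik p ^~ (A i j)) (dloglik p 1 ^~ (A i j)) b (K1 b) (K2 b).
Proof. by case: regA. Qed.
Let M_gt0 : 0 < M. Proof. by apply: lt_le_trans M1_le; rewrite mulr_gt0. Qed.
Let M1M : M1 <= M. Proof. by apply: le_trans M1_le; have := M1_gt0; lra. Qed.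
Let b_ge0 : 0 <= b. Proof. by rewrite mulr_ge0 // ltW. Qed.
Let tr_gt0 : 0 < tr. Proof. exact: theta_range_gt0. Qed.
Let k1_gt0 : 0 < k1. Proof. exact: K1_gt0. Qed.
Let k2_gt0 : 0 < k2. Proof. exact: K2_gt0. Qed.
Let bYh : rows_bounded b Yh. Proof. exact: row_feasible_bounded. Qed.
Let bYo : rows_bounded b Yo.
Proof. by move=> i; apply: row_ok_norm; apply: row_ok_le M1M _; case: feasYo. Qed.
Let cYh : centered Yh. Proof. by case: feasYh. Qed.
Let cYo : centered Yo. Proof. by case: feasYo. Qed.

(** The variational inequality along a feasible direction: the linear term of [loss_step_upper] must
    dominate as the step tends to 0. *)
Lemma minimizer_first_order U :
  (exists2 t0 : R, 0 < t0 & forall t, 0 <= t -> t <= t0 -> row_feasible M (Yh + t *: U)) ->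
  dot (F *m design Yh) U <= 0.
Proof.
move=> [t0 t00 ht].
(* The crude Frobenius bound on the operator norm suffices, since the quadratic term vanishes in the
   limit. *)
have Cop0 : 0 <= nrm F / n%:R by rewrite divr_ge0 ?frob_norm_ge0 // ltW.
have op : op_bounded (nrm F / n%:R * n%:R) F.
  by move=> x; rewrite divfK ?lt0r_neq0 //; exact: frob_norm_mulmx.
set Q := ((nrm F / n%:R) / 2 + K2 tr * tr) * n%:R * nrm U ^+ 2.
have Q0 : 0 <= Q.
  apply: mulr_ge0; last exact: sqr_ge0.
  apply: mulr_ge0; last exact: ltW.
  by apply: addr_ge0; [exact: divr_ge0|apply: mulr_ge0; exact: ltW].
have key t : 0 < t -> t <= t0 -> dot (F *m design Yh) U <= t * Q.
  move=> t1 t2; have hf := ht t (ltW t1) t2.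
  have h1 := loss_step_upper symA K2_gt0 hc b_ge0 bYh (row_feasible_bounded hf) Cop0 op.
  have h2 := minYh hf; rewrite frob_dotZr frob_normZ gtr0_norm // exprMn in h1.
  rewrite -(ler_pM2l t1).
  have e : t * (t * Q) = (nrm F / n%:R / 2 + K2 tr * tr) * n%:R * (t ^+ 2 * nrm U ^+ 2).
    by rewrite /Q; ring.
  rewrite e; move: h1 h2; move: (loss _ _ _) (loss _ _ _) (t * _) (_ * (t ^+ 2 * _)) => x y z v; lra.
rewrite leNgt; apply/negP => x0.
set x := dot _ _ in x0 key.
have Q1 : 0 < Q + 1 by rewrite ltr_wpDl.
set t := Num.min t0 (x / (Q + 1)).
have t1 : 0 < t by rewrite lt_min t00 divr_gt0.
have t2 : t <= x / (Q + 1) by rewrite ge_min lexx orbT.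
have := key t t1 (_ : t <= t0); rewrite ge_min lexx /= => /(_ isT) h.
rewrite ler_pdivlMr // in t2.
by lra.
Qed.

(** With slack in all row constraints the projected direction is feasible, and the variational
    inequality makes its squared norm nonpositive. The projection then has to be removed from the
    positions. *)
Lemma minimizer_stationary : (forall i, row_ok (3 / 2 * M1) (row i Yh)) -> F *m design Yh = 0.
Proof.
move=> hin; have n0 := n_gt0.
have hM : 3 / 2 * M1 < M by have := M1_gt0; have := M1_le; lra.
have cd : centered (direction p A Yh) by exact: (direction_centered symA ld n0).
have h : dot (F *m design Yh) (direction p A Yh) <= 0.
  apply: minimizer_first_order.
  have [t0 t00 ht] := uniform_small (fun i => row_ok_interior (row i (direction p A Yh)) (hin i) hM).
  exists t0 => // t t1 t2; split.
    by move=> i; rewrite linearD linearZ; exact: ht.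
  by rewrite /centered positionsD positionsZ mulmxDr cYh add0r -scalemxAr cd scaler0.
rewrite -(direction_dot symA ld _ cd) -sqr_frob_norm in h.
have d0 : direction p A Yh = 0.
  by apply/frob_norm_eq0/eqP; rewrite -sqrf_eq0 eq_le h sqr_ge0.
have h1 := direction_degrees symA ld Yh; have h2 := direction_positions symA ld Yh.
have e : F *m design Yh = row_mx (F *m positions Yh) (F *m ones n) by rewrite /design mul_mx_row.
have F1 : F *m ones n = 0 by move: h1; rewrite d0 e /degrees row_mxKr linear0.
(* F is symmetric with F 1 = 0, so the columns of F Z already have mean zero and centering leaves
   them unchanged. *)
have FZ : F *m positions Yh = 0.
  move: h2; rewrite d0 e /positions row_mxKl linear0 centering_centered //.
  by rewrite mulmxA -(score_sym p symA) -trmx_mul F1 trmx0 mul0mx.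
by rewrite e F1 FZ row_mx0.
Qed.

Variables (mu w tau L : R).
Hypotheses (mu_gt0 : 0 < mu) (mu_le : 2 * mu <= 1) (w_ge0 : 0 <= w) (L_ge0 : 0 <= L).
Hypotheses (opE : op_bounded (w * n%:R) E) (wcYo : well_conditioned (2 * mu) Yo).
Hypotheses (gradE : forall i, nrm (row_grad p A i (row i Yo) Yo) <= tau * n%:R).
Hypotheses (scoreE : forall i j, `|E i j| <= L).
Hypotheses (alYh : aligned Yh Yo) (n_large : 8 * (1 + b) ^+ 2 <= mu * n%:R).
Local Notation sigma := (8 * w * (1 + b) / (k1 * mu)).
Local Notation wF := (w + k2 * (2 * (1 + b)) * sigma).

Let km_gt0 : 0 < k1 * mu. Proof. exact: mulr_gt0. Qed.
Let b1_ge0 : 0 <= 1 + b. Proof. exact: addr_ge0. Qed.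
Let sigma_ge0 : 0 <= sigma.
Proof. by apply: divr_ge0; [apply: mulr_ge0 => //; exact: mulr_ge0|exact: ltW]. Qed.
Let wF_ge0 : 0 <= wF.
Proof.
apply: addr_ge0 => //; apply: mulr_ge0 => //; apply: mulr_ge0; first exact: ltW.
exact: mulr_ge0.
Qed.
Let rtn_gt0 : 0 < rtn. Proof. by rewrite sqrtr_gt0; exact: n_gt0. Qed.

Lemma noise_dot_Theta Y Y' : rows_bounded b Y -> rows_bounded b Y' ->
  dot E (Theta_mx Y - Theta_mx Y') <= 2 * (w * n%:R * ((1 + b) * rtn)) * nrm (Y - Y').
Proof.
move=> bY bY'.
have wn : 0 <= w * n%:R by rewrite mulr_ge0 // ltW // n_gt0.
have half X U : rows_bounded b X -> dot E (U *m (design X)^T) <= w * n%:R * ((1 + b) * rtn) * nrm U.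
  move=> bX; have -> : dot E (U *m (design X)^T) = dot (E *m design X) U by rewrite frob_dot_mulmxr.
  apply: le_trans (frob_dot_le _ _) _; apply: ler_wpM2r; first exact: frob_norm_ge0.
  apply: le_trans (op_bounded_mulmx _ wn opE) _; apply: ler_wpM2l => //.
  exact: nrm_design.
rewrite Theta_diff frob_dotDr.
have -> : dot E (design Y' *m (Y - Y')^T) = dot E ((Y - Y') *m (design Y')^T).
  by rewrite -frob_dot_tr (score_sym p symA) trmx_mul trmxK.
by rewrite -mulrA mulrDl mul1r; apply: lerD; exact: half.
Qed.

(** Basic inequality: the loss at Yh is at most that at Yo, so the curvature term, of order n |Yh -
    Yo|^2, is at most the noise term, of order w n^(3/2) |Yh - Yo|. *)
Lemma minimizer_consistent : nrm (Yh - Yo) <= sigma * rtn.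
Proof.
have n0 := n_gt0; have mu2 : mu <= 2 by have := mu_le; lra.
have [h _] := loss_sandwich symA (hc tr_gt0) (fun i j => Theta_le i j b_ge0 bYo) (fun i j => Theta_le i j b_ge0 bYh).
have h1 := offdiag_lower b_ge0 mu2 bYo cYo wcYo bYh cYh alYh n_large.
have h2 := noise_dot_Theta bYh bYo.
have h3 : loss p A Yh <= loss p A Yo.
  by apply: minYh; split => // i; apply: row_ok_le M1M _; case: feasYo.
have h4 : k1 / 4 * (mu / 2 * n%:R * nrm (Yh - Yo) ^+ 2) <=
  k1 / 4 * offdiag_sq (Theta_mx Yh - Theta_mx Yo) by rewrite ler_pM2l // divr_gt0.
set D := nrm (Yh - Yo) in h1 h2 h4 *.
have h5 : k1 * mu / 8 * n%:R * D ^+ 2 <= w * n%:R * ((1 + b) * rtn) * D.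
  move: h h2 h3 h4; move: (loss _ _ _) (loss _ _ _) (dot E _) (offdiag_sq _) (w * _ * (_ * _)).
  by move=> x y z v u; move: (D ^+ 2) => d2; lra.
have [z|nz] := eqVneq D 0; first by rewrite z mulr_ge0 // ltW.
have D0 : 0 < D by rewrite lt_neqAle eq_sym nz frob_norm_ge0.
have c0 : 0 < k1 * mu / 8 * n%:R by rewrite mulr_gt0 // divr_gt0.
rewrite -(ler_pM2l c0) -(ler_pM2r D0).
have -> : k1 * mu / 8 * n%:R * (sigma * rtn) * D = w * n%:R * ((1 + b) * rtn) * D.
  by move: rtn => r; field; rewrite !lt0r_neq0.
by rewrite -mulrA -expr2.
Qed.

Lemma minimizer_op : op_bounded (wF * n%:R) F.
Proof.
move=> x; rewrite -(subrK E F) mulmxDl; apply: le_trans (frob_normD _ _) _.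
rewrite addrC mulrDl mulrDl; apply: lerD; first exact: opE.
apply: le_trans (frob_norm_mulmx _ _) _; apply: ler_wpM2r; first exact: frob_norm_ge0.
apply: le_trans (score_diff_le b_ge0 k2_gt0 (hc tr_gt0) bYo bYh) _.
apply: (@le_trans _ _ (k2 * (2 * (1 + b)) * rtn * (sigma * rtn))).
  apply: ler_wpM2l minimizer_consistent; apply: mulr_ge0; last exact: rtn_ge0.
  by apply: mulr_ge0; [exact: ltW|exact: mulr_ge0].
rewrite le_eqVlt; apply/orP; left; apply/eqP.
by move: (sigma) => sg; have := @rtn_sqr R n; move: (Num.sqrt _) => r <-; ring.
Qed.

Let G : {set 'I_n} := [set i | nrm (row i (Yh - Yo)) <= M1 / 2].

(** Each row outside G adds more than (M1 / 2)^2 to a squared error of at most sigma^2 n, so at most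
    a quarter of the rows lie outside. *)
Lemma good_rows_card : 2 * sigma <= M1 / 2 -> 1 / 4 * n%:R <= #|G|%:R :> R.
Proof.
move=> hs; have n0 := n_gt0; have M10 := M1_gt0.
have h1 : #|~: G|%:R * (M1 / 2) ^+ 2 <= (sigma * rtn) ^+ 2.
  apply: (@le_trans _ _ (nrm (Yh - Yo) ^+ 2)); last first.
    have sr0 : 0 <= sigma * rtn by apply: mulr_ge0; [exact: sigma_ge0|exact: rtn_ge0].
    by rewrite ler_pXn2r ?nnegrE ?frob_norm_ge0 //; exact: minimizer_consistent.
  rewrite sqr_frob_norm_rows (bigID (fun i => i \in ~: G)) /=.
  apply: (@le_trans _ _ (\sum_(i in ~: G) nrm (row i (Yh - Yo)) ^+ 2)); last first.
    by rewrite lerDl sumr_ge0 // => i _; exact: sqr_ge0.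
  rewrite mulr_natl -sumr_const; apply: ler_sum => i; rewrite !inE -ltNge => /ltW hi.
  by rewrite ler_pXn2r ?nnegrE ?frob_norm_ge0 // divr_ge0 // ltW.
have h2 : (sigma * rtn) ^+ 2 <= 1 / 4 * n%:R * (M1 / 2) ^+ 2.
  rewrite exprMn rtn_sqr.
  have : (2 * sigma) ^+ 2 <= (M1 / 2) ^+ 2.
    have s20 : 0 <= 2 * sigma by exact: mulr_ge0.
    by rewrite ler_pXn2r ?nnegrE // divr_ge0 // ltW.
  rewrite exprMn => h.
  have : (1 / 4 * n%:R) * (2 ^+ 2 * sigma ^+ 2) <= (1 / 4 * n%:R) * (M1 / 2) ^+ 2.
    by rewrite ler_pM2l // mulr_gt0.
  by move: (sigma ^+ 2) => s2; lra.
have h3 : #|~: G|%:R <= 1 / 4 * n%:R :> R.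
  have p0 : 0 < (M1 / 2) ^+ 2 by rewrite exprn_gt0 // divr_gt0.
  by rewrite -(ler_pM2r p0); exact: le_trans h1 h2.
have h4 : #|G|%:R + #|~: G|%:R = n%:R :> R by rewrite -natrD cardsC card_ord.
by lra.
Qed.

(** If row i were bad, moving it towards the truth would be a descent direction: its own
    contribution is of order n |D|^2, D being the error of row i. The compensation over the good
    rows only meets the operator norm of F and is of smaller order, against the variational
    inequality. *)
Lemma minimizer_row_close i : 2 * sigma <= M1 / 2 ->
  (3 * k2 * tr + L) * sigma + tau + 2 * (wF * (1 + b)) < k1 * mu * (M1 / 2) ->
  nrm (row i (Yh - Yo)) <= M1 / 2.
Proof.
move=> hs hsmall; have n0 := n_gt0; have M10 := M1_gt0; rewrite leNgt; apply/negP => hbad.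
have hG := good_rows_card hs.
have g0 : 0 < #|G|%:R :> R by apply: lt_le_trans hG; rewrite mulr_gt0.
have iG : i \notin G by rewrite inE -ltNge.
set yh := row i Yh; set yo := row i Yo; pose u := yo - yh.
pose gv : 'cV[R]_n := \col_j (j \in G)%:R.
pose uz : 'rV[R]_(k + 1) := row_mx (positions u) 0.
(* Row i moves to the truth; the opposite position shift is spread evenly over G to keep the
   positions centred. Degrees are not subject to centering, hence the 0 in [uz]. *)
pose U : 'M[R]_(n, k + 1) := delta_mx i 0 *m u - #|G|%:R^-1 *: (gv *m uz).
have rowU j : row j U = (j == i)%:R *: u - (#|G|%:R^-1 * (j \in G)%:R) *: uz.
  apply/rowP => l; rewrite !mxE !big_ord1 !mxE andbT mulrA.
  by case: (j == i).
have g0' : #|G|%:R != 0 :> R by exact: lt0r_neq0.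
have cU : centered U.
  rewrite /centered positionsB positionsZ /positions -!mulmx_lsub row_mxKl mulmxBr -scalemxAr !mulmxA.
  have -> : (ones n)^T *m (delta_mx i 0 : 'cV[R]_n) = 1%:M.
    apply/matrixP => a c; rewrite !ord1 !mxE (bigD1 i) //= !mxE !eqxx mulr1 big1 ?addr0 //.
    by move=> j ji; rewrite !mxE (negbTE ji) mulr0.
  have -> : (ones n)^T *m gv = (#|G|%:R)%:M.
    apply/matrixP => a c; rewrite !ord1 !mxE mulr1n -sum1_card natr_sum [in RHS]big_mkcond.
    by apply: eq_bigr => j _; rewrite !mxE mul1r; case: (j \in G).
  by rewrite mul1mx mul_scalar_mx scalerA mulVf // scale1r subrr.
have nonpos : dot (F *m design Yh) U <= 0.
  apply: minimizer_first_order.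
  have hM : M1 + M1 / 2 < M by have := M1_gt0; have := M1_le; lra.
  (* Row i stays feasible by convexity; rows in G have norms at most 3/2 M1 < M, so they may move a
     little; the others do not move. *)
  have hr j : exists2 t0 : R, 0 < t0 & forall t, 0 <= t -> t <= t0 -> row_ok M (row j Yh + t *: row j U).
    have [->|ji] := eqVneq j i.
      exists 1 => // t t0 t1; rewrite rowU (negbTE iG) eqxx mulr0 scale0r subr0 scale1r /u.
      apply: row_ok_convex; [by rewrite t0|exact: (proj1 feasYh)|].
      by apply: row_ok_le M1M _; exact: (proj1 feasYo).
    have [jG|jG] := boolP (j \in G); last first.
      exists 1 => // t t0 t1; rewrite rowU (negbTE ji) (negbTE jG) mulr0 !scale0r subrr scaler0 addr0.
      exact: (proj1 feasYh).
    apply: row_ok_interior hM; rewrite -(subrK (row j Yo) (row j Yh)) [X in row_ok _ X]addrC.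
    apply: row_ok_shift; first exact: (proj1 feasYo).
    by move: jG; rewrite inE linearB.
  have [t0 t00 ht] := uniform_small hr.
  exists t0 => // t t1 t2; split.
    by move=> j; rewrite linearD linearZ; exact: ht.
  by rewrite /centered positionsD positionsZ mulmxDr cYh add0r -scalemxAr cU scaler0.
pose D := yh - yo.
have eu : u = - D by rewrite /u /D opprB.
have nD : nrm D = nrm (row i (Yh - Yo)) by rewrite linearB.
have D0 : 0 < nrm D by rewrite nD; apply: lt_trans hbad; rewrite divr_gt0.
have row_part : dot (F *m design Yh) (delta_mx i 0 *m u) = dot (row_grad p A i yh Yh) D.
  rewrite frob_dotC frob_dot_mulmxl trmx_delta -rowE row_grad_row eu.
  by rewrite !frob_dotNl frob_dotC.
have wn : 0 <= wF * n%:R by rewrite mulr_ge0 // ltW.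
have ngv : nrm gv = Num.sqrt #|G|%:R.
  rewrite /frob_norm; congr Num.sqrt; rewrite /frob_dot -sum1_card natr_sum [in RHS]big_mkcond.
  apply: eq_bigr => j _; rewrite big_ord1 !mxE; case: (j \in G); by rewrite ?mulr1 ?mulr0.
have nuz : nrm uz <= nrm D.
  apply: le_trans (_ : nrm (positions u) <= _); first by rewrite /frob_norm frob_dot_row_mx frob_dot0l addr0.
  by have -> : nrm D = nrm u by [rewrite eu frob_normN]; exact: positions_le.
set sg := Num.sqrt #|G|%:R in ngv.
have sg0 : 0 < sg by rewrite sqrtr_gt0.
have sgE : sg ^+ 2 = #|G|%:R by rewrite sqr_sqrtr // ltW.
have sgl : rtn <= 2 * sg.
  have : rtn ^+ 2 <= (2 * sg) ^+ 2 by rewrite rtn_sqr exprMn sgE; lra.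
  by rewrite ler_pXn2r ?nnegrE ?rtn_ge0 // mulr_ge0 // ltW.
(* Spreading over the good rows gains a factor sqrt |G| in norm, and n <= 4 |G| turns sqrt n / sqrt
   |G| into 2. *)
have good_part : `|#|G|%:R^-1 * dot (F *m design Yh) (gv *m uz)| <= 2 * (wF * (1 + b)) * n%:R * nrm D.
  rewrite normrM gtr0_norm ?invr_gt0 // -(ler_pM2l g0) mulVKf //.
  apply: le_trans (frob_cauchy_schwarz _ _) _.
  have a1 : nrm (F *m design Yh) <= wF * n%:R * ((1 + b) * rtn).
    apply: le_trans (op_bounded_mulmx _ wn minimizer_op) _; apply: ler_wpM2l => //.
    exact: nrm_design.
  have a2 : nrm (gv *m uz) <= sg * nrm D.
    apply: le_trans (frob_norm_mulmx _ _) _; rewrite ngv; apply: ler_wpM2l => //; exact: ltW.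
  apply: (@le_trans _ _ ((wF * n%:R * ((1 + b) * rtn)) * (sg * nrm D))).
    by apply: ler_pM => //; exact: frob_norm_ge0.
  have a3 : (wF * n%:R * (1 + b) * sg * nrm D) * rtn <= (wF * n%:R * (1 + b) * sg * nrm D) * (2 * sg).
    apply: ler_wpM2l => //; apply: mulr_ge0; last exact: frob_norm_ge0.
    by apply: mulr_ge0; [exact: mulr_ge0|exact: ltW].
  move: a3; rewrite -sgE; move: (nrm D) (wF) (sg) (n%:R) (rtn) => d f s m r a3.
  have -> : f * m * ((1 + b) * r) * (s * d) = f * m * (1 + b) * s * d * r by ring.
  by apply: le_trans a3 _; rewrite le_eqVlt; apply/orP; left; apply/eqP; ring.
have grad_part : k1 * (mu * n%:R * nrm D ^+ 2) - ((3 * k2 * tr + L) * sigma * n%:R + tau * n%:R) * nrm D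
    <= dot (row_grad p A i yh Yh) D.
  have hcl := row_grad_close K2_gt0 hc b_ge0 L_ge0 (bYh i) bYh bYo (scoreE i).
  have hmo := row_grad_monotone (hc tr_gt0 (i := i)) (fun j => row_theta_le j b_ge0 (bYo i) bYo)
    (fun j => row_theta_le j b_ge0 (bYh i) bYo).
  have n1 : (1 + b) ^+ 2 <= mu * n%:R.
    by have := n_large; have := sqr_ge0 (1 + b); move: (_ ^+ 2) => x; lra.
  have hin := row_increment_lower i D b_ge0 bYo mu_le cYo wcYo n1.
  have hin' : k1 * (mu * n%:R * nrm D ^+ 2) <= k1 * row_increment_sq i D Yo by rewrite ler_pM2l.
  have sp (x y z : 'rV[R]_(k + 1)) : dot x D = dot (x - y) D + (dot (y - z) D + dot z D).
    by rewrite -!frob_dotDl !subrK.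
  rewrite (sp _ (row_grad p A i yh Yo) (row_grad p A i yo Yo)).
  have c1 := frob_cauchy_schwarz (row_grad p A i yh Yh - row_grad p A i yh Yo) D.
  have c2 := frob_cauchy_schwarz (row_grad p A i yo Yo) D.
  have c3 : nrm (row_grad p A i yh Yh - row_grad p A i yh Yo) * nrm D <= (3 * k2 * tr + L) * sigma * n%:R * nrm D.
    apply: ler_wpM2r; first exact: frob_norm_ge0.
    apply: le_trans hcl _.
    apply: (@le_trans _ _ ((3 * k2 * tr + L) * rtn * (sigma * rtn))).
      apply: ler_wpM2l minimizer_consistent; apply: mulr_ge0; last exact: rtn_ge0.
      by apply: addr_ge0 => //; apply: mulr_ge0; [apply: mulr_ge0 => //|]; exact: ltW.
    rewrite le_eqVlt; apply/orP; left; apply/eqP.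
    by move: (sigma) => sg'; have := @rtn_sqr R n; move: (Num.sqrt _) => r <-; ring.
  have c4 : nrm (row_grad p A i yo Yo) * nrm D <= tau * n%:R * nrm D.
    by apply: ler_wpM2r; [exact: frob_norm_ge0|exact: gradE].
  have d1 := le_trans c1 c3; have d2 := le_trans c2 c4.
  rewrite ler_norml in d1; rewrite ler_norml in d2.
  have /andP [d3 _] := d1; have /andP [d4 _] := d2; rewrite [X in _ - X <= _]mulrDl.
  have hmo' := le_trans hin' hmo.
  exact: sub_le_sum3 d3 hmo' d4.
move: nonpos; rewrite frob_dotDr frob_dotNr frob_dotZr row_part => nonpos.
rewrite ler_norml in good_part; have /andP [gp1 gp2] := good_part.
have fin : k1 * (mu * n%:R * nrm D ^+ 2) <=
    ((3 * k2 * tr + L) * sigma * n%:R + tau * n%:R + 2 * (wF * (1 + b)) * n%:R) * nrm D.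
  by rewrite [X in _ <= X]mulrDl; exact: le_of_sub_le grad_part gp2 nonpos.
have fin2 : k1 * mu * nrm D <= (3 * k2 * tr + L) * sigma + tau + 2 * (wF * (1 + b)).
  have nD0 : 0 < n%:R * nrm D by exact: mulr_gt0.
  rewrite -(ler_pM2r nD0); move: fin; rewrite expr2.
  move: ((3 * k2 * tr + L) * sigma) (2 * (wF * (1 + b))) (nrm D) => x y d h.
  have e1 : k1 * mu * d * (n%:R * d) = k1 * (mu * n%:R * (d * d)) by ring.
  have e2 : (x + tau + y) * (n%:R * d) = (x * n%:R + tau * n%:R + y * n%:R) * d by ring.
  by rewrite e1 e2.
have := le_lt_trans fin2 hsmall; rewrite ltr_pM2l // nD => h.
by have := lt_trans h hbad; rewrite ltxx.
Qed.

Lemma minimizer_interior : 2 * sigma <= M1 / 2 ->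
  (3 * k2 * tr + L) * sigma + tau + 2 * (wF * (1 + b)) < k1 * mu * (M1 / 2) ->
  F *m design Yh = 0.
Proof.
move=> h1 h2; apply: minimizer_stationary => i.
have -> : 3 / 2 * M1 = M1 + M1 / 2 by field.
rewrite -(subrK (row i Yo) (row i Yh)) [X in row_ok _ X]addrC.
apply: row_ok_shift; first exact: (proj1 feasYo).
by have := minimizer_row_close i h1 h2; rewrite linearB.
Qed.

End Minimizer.

(** * Behaviour of the hypotheses under rotation and small perturbation *)

Section RotationInvariance.
Context {R : realType} {n k : nat}.
Local Notation dot := frob_dot.
Local Notation nrm := frob_norm.
Implicit Types (Y : 'M[R]_(n, k + 1)) (Q : 'M[R]_k).

Lemma row_rotate Y Q i : row i (rotate Y Q) = rotate (row i Y) Q.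
Proof.
rewrite /rotate row_row_mx row_mul; congr (row_mx (_ *m _) _); by apply/rowP => j; rewrite !mxE.
Qed.

Lemma row_feasible_rotate M Y Q : orthogonal_mx Q -> row_feasible M Y -> row_feasible M (rotate Y Q).
Proof.
move=> hQ [h1 h2]; split; last exact: centered_rotate.
move=> i; have [h3 h4] := h1 i; rewrite row_rotate; split; rewrite ?positions_rotate ?degrees_rotate //.
by rewrite frob_norm_orthogonal.
Qed.

Lemma mul_design_rotate (E : 'M[R]_n) Y Q : E *m design (rotate Y Q) = rotate (E *m design Y) Q.
Proof.
rewrite design_rotate /design !mul_mx_row /rotate /positions /degrees row_mxKl row_mxKr.
by rewrite mulmxA.
Qed.

Lemma rotateK Y Q : orthogonal_mx Q -> rotate (rotate Y Q) Q^T = Y.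
Proof.
move=> hQ; rewrite /rotate /positions /degrees row_mxKl row_mxKr -mulmxA.
by rewrite orthogonal_mulr_tr // mulmx1 hsubmxK.
Qed.

Lemma nrm_rotateB Y Y' Q : orthogonal_mx Q -> nrm (rotate Y Q - rotate Y' Q) = nrm (Y - Y').
Proof.
move=> hQ; rewrite /frob_norm frob_dot_split !positionsB !degreesB !positions_rotate !degrees_rotate.
by rewrite -mulmxBl frob_dot_orthogonal // -positionsB -degreesB -frob_dot_split.
Qed.

Lemma rotate_mul Y Q Q' : rotate (rotate Y Q) Q' = rotate Y (Q *m Q').
Proof. by rewrite /rotate /positions /degrees row_mxKl row_mxKr mulmxA. Qed.

Lemma dist2_triangle Y Y' Y1 a c : 0 <= a -> 0 <= c -> dist2 Y Y1 <= a ^+ 2 -> dist2 Y' Y1 <= c ^+ 2 ->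
  dist2 Y Y' <= (a + c) ^+ 2.
Proof.
move=> a0 c0; have [Q [hQ _ ->]] := dist2_attained Y Y1.
have [Q' [hQ' _ ->]] := dist2_attained Y' Y1 => h1 h2.
rewrite ler_pXn2r ?nnegrE ?frob_norm_ge0 // in h1; rewrite ler_pXn2r ?nnegrE ?frob_norm_ge0 // in h2.
have hO : orthogonal_mx (Q'^T *m Q) by apply: orthogonal_mul => //; exact: orthogonal_tr.
apply: le_trans (dist2_le Y Y' hO) _.
rewrite ler_pXn2r ?nnegrE ?frob_norm_ge0 ?addr_ge0 //.
apply: le_trans (frob_dist_triangle _ (rotate Y1 Q) _) _; apply: lerD => //.
rewrite -rotate_mul nrm_rotateB // -{1}(rotateK Y1 hQ') nrm_rotateB; last exact: orthogonal_tr.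
by rewrite frob_distC.
Qed.

(** From (x + y)^2 <= 2 x^2 + 2 y^2, the bound 8 mu for Y' leaves 4 mu - 2 mu for Y. *)
Lemma well_conditioned_close mu Y Y' (s : R) : 0 <= s -> s ^+ 2 <= 2 * mu ->
  nrm (Y - Y') <= s * Num.sqrt n%:R -> well_conditioned (8 * mu) Y' -> well_conditioned (2 * mu) Y.
Proof.
move=> s0 s2 hs hw v; have := hw v; rewrite -!sqr_frob_norm => h.
have e : v *m (positions Y')^T = v *m (positions Y)^T - v *m (positions (Y - Y'))^T.
  by rewrite positionsB linearB /= mulmxBr opprB addrC subrK.
have h1 : nrm (v *m (positions Y')^T) <= nrm (v *m (positions Y)^T) + nrm v * (s * Num.sqrt n%:R).
  rewrite e; apply: le_trans (frob_normB _ _) _; rewrite lerD2l.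
  apply: le_trans (frob_norm_mulmx _ _) _; apply: ler_wpM2l; first exact: frob_norm_ge0.
  by rewrite frob_norm_tr; apply: le_trans (positions_le _) hs.
have h2 : nrm (v *m (positions Y')^T) ^+ 2 <=
    (nrm (v *m (positions Y)^T) + nrm v * (s * Num.sqrt n%:R)) ^+ 2.
  rewrite ler_pXn2r ?nnegrE ?frob_norm_ge0 // addr_ge0 ?frob_norm_ge0 //.
  by apply: mulr_ge0; [exact: frob_norm_ge0|apply: mulr_ge0 => //; exact: sqrtr_ge0].
have h3 : s ^+ 2 * (n%:R * nrm v ^+ 2) <= 2 * mu * (n%:R * nrm v ^+ 2).
  by apply: ler_wpM2r => //; apply: mulr_ge0 => //; exact: sqr_ge0.
have h4 : (nrm v * (s * Num.sqrt n%:R)) ^+ 2 = s ^+ 2 * (n%:R * nrm v ^+ 2).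
  by rewrite !exprMn rtn_sqr; ring.
move: h h2 h3 h4; set x := nrm (v *m (positions Y)^T); set y := nrm v * (s * _).
have := sqr_ge0 (x - y); rewrite sqrrB sqrrD.
move: (nrm (v *m _) ^+ 2) (nrm v ^+ 2) (x * y) (x ^+ 2) (y ^+ 2) => a q z x2 y2; clear.
move: n%:R => m; move=> h0 h1 h2 h3 h4; subst y2; lra.
Qed.

End RotationInvariance.

(** * Convergence for every data matrix satisfying the noise bounds *)

Section DeterministicConvergence.
Context {R : realType} {k : nat}.
Local Notation nrm := frob_norm.
Variables (p : R -> R -> R) (K1 K2 : R -> R).
Hypothesis K1_gt0 : forall b, 0 < b -> 0 < K1 b.
Hypothesis K2_gt0 : forall b, 0 < b -> 0 < K2 b.

(** The estimator is shown to be stationary and close to the truth, then [local_convergence] is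
    applied with initial radius t + sigma, where sigma bounds the estimation error. *)
Lemma deterministic_convergence (M1 M mu b0 C_ls Cinit beta : R) :
  0 < M1 -> 2 * M1 <= M -> 0 <= b0 -> 0 < mu -> 2 * mu <= 1 -> 0 < C_ls -> 1 < Cinit -> 0 < beta < 1 ->
  exists C c0 e1 R0, [/\ 0 < C, 0 < c0 < 1, 0 < e1 &
    forall n (A : 'M[R]_n) (Ystar Yh Y0 : 'M[R]_(n, k + 1)) (tau w L t eta_init : R) (Rmax r : nat),
    data_regular p K1 K2 A ->
    row_feasible M1 Ystar -> well_conditioned (8 * mu) Ystar ->
    op_bounded (w * n%:R) (score p A Ystar) ->
    rows_bounded (tau * n%:R) (score p A Ystar *m design Ystar) ->
    (forall i j, `|score p A Ystar i j| <= L) ->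
    row_feasible M Yh -> (forall Y : 'M[R]_(n, k + 1), row_feasible M Y -> loss p A Yh <= loss p A Y) ->
    rows_bounded b0 Y0 -> centered Y0 -> dist2 Y0 Ystar <= (t * Num.sqrt n%:R) ^+ 2 ->
    1 / Cinit <= n%:R * eta_init <= Cinit -> (R0 <= Rmax)%N ->
    1 <= L -> 0 <= t -> 0 <= w -> 0 <= tau <= e1 -> L * (t + w) <= e1 -> 1 <= e1 * n%:R ->
    dist2 (pgd_iterate p A C_ls beta Rmax eta_init Y0 r) Yh <= C * (1 - c0) ^+ r * dist2 Y0 Yh].
Proof.
move=> M10 hM b00 mu0 mu1 Cls0 Ci1 hbeta.
have M0 : 0 < M by apply: lt_le_trans hM; rewrite mulr_gt0.
pose b := 2 * M.
have bge : 0 <= b by rewrite mulr_ge0 // ltW.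
have [C [c0 [e0 [R0 [C0 hc0 e00 main]]]]] :=
  @local_convergence R k p K1 K2 K1_gt0 K2_gt0 _ _ _ _ _ _ bge b00 mu0 mu1 Cls0 Ci1 hbeta.
have tr0 := theta_range_gt0 bge; set tr := theta_range b in tr0.
have k10 := K1_gt0 tr0; set k1 := K1 tr in k10.
have k20 := K2_gt0 tr0; set k2 := K2 tr in k20.
have b10 : 0 <= 1 + b by exact: addr_ge0.
have km : 0 < k1 * mu by exact: mulr_gt0.
pose C4 := 8 * (1 + b) / (k1 * mu).
have C40 : 0 <= C4 by apply: divr_ge0; [exact: mulr_ge0|exact: ltW].
pose C5 := 1 + k2 * (2 * (1 + b)) * C4.
have C50 : 0 <= C5.
  by apply: addr_ge0 => //; apply: mulr_ge0 => //; apply: mulr_ge0; [exact: ltW|exact: mulr_ge0].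
pose C6 := (3 * k2 * tr + 1) * C4 + 1 + 2 * (C5 * (1 + b)).
pose cs : seq (R * R) := [:: (1, 1); (1, e0); (1 + C4, e0); (C5, e0); (2 * C4, M1 / 2);
  (C6, k1 * mu * (M1 / 2) / 2); (C4, Num.min 1 mu); (8 * (1 + b) ^+ 2, mu)].
have cs0 : all (fun c => 0 < c.2) cs.
  rewrite /= ltr01 e00 mu0 divr_gt0 //= lt_min ltr01 mu0 /= andbT.
  by rewrite divr_gt0 // mulr_gt0 // divr_gt0.
have [e1 e10 he1] := small_constant cs0.
exists C, c0, e1, R0; split=> //.
move=> n A Ystar Yh Y0 tau w L t eta Rmax r regA fS wcS opS rowS hL fH minH bY0 cY0 dY0 heta hR
  L1 t0 w0 htau hLt he.
have L0 : 0 <= L by exact: le_trans L1.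
have [tau0 tau1] := andP htau.
have n0 : 0 < n%:R :> R by rewrite -(pmulr_rgt0 _ e10); exact: lt_le_trans he.
have Lt0 : 0 <= L * t by exact: mulr_ge0.
have Lw0 : 0 <= L * w by exact: mulr_ge0.
have wL : w <= L * w by apply: ler_peMl.
have wtL : L * w <= L * (t + w) by rewrite mulrDr lerDr.
have /= := he1 _ (ltW e10) (lexx _).
case/and5P => z1 z2 _ _ /and5P [_ z6 _ z8 _]; rewrite !mul1r in z1 z2.
have /= := he1 _ (le_trans Lw0 wtL) hLt.
case/and5P => _ _ y3 y4 /and5P [y5 y6 y7 _ _].
set u := L * (t + w) in hLt wtL y3 y4 y5 y6 y7.
have wu : w <= u by exact: le_trans wL wtL.
have u0 : 0 <= u by exact: le_trans w0 wu.
have symA : A^T = A by case: regA.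
pose sigma := 8 * w * (1 + b) / (k1 * mu).
have sE : sigma = C4 * w by rewrite /sigma /C4; move: (k1 * mu)^-1 => q; ring.
have s0 : 0 <= sigma by rewrite sE; exact: mulr_ge0.
have su : sigma <= C4 * u by rewrite sE; apply: ler_wpM2l.
pose wF := w + k2 * (2 * (1 + b)) * sigma.
have wFE : wF = C5 * w by rewrite /wF sE /C5; ring.
have wFu : wF <= C5 * u by rewrite wFE; apply: ler_wpM2l.
have wF0 : 0 <= wF by rewrite wFE; exact: mulr_ge0.
have nl : 8 * (1 + b) ^+ 2 <= mu * n%:R.
  apply: (@le_trans _ _ (8 * (1 + b) ^+ 2 * (e1 * n%:R))).
    by apply: ler_peMr => //; apply: mulr_ge0 => //; exact: sqr_ge0.
  by rewrite mulrA; apply: ler_wpM2r => //; exact: ltW.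
have wcS' : well_conditioned (2 * mu) Ystar.
  move=> v; apply: le_trans (wcS v); apply: ler_wpM2r; first exact: frob_dot_ge0.
  by apply: ler_wpM2r; [exact: ltW|have := mu0; lra].
have bS : rows_bounded b Ystar.
  move=> i; apply: row_ok_norm; apply: row_ok_le (proj1 fS i); have := M10; lra.
(* Two rotations of the truth are needed: one aligned with the estimator, for its consistency, and
   one aligned with the initial estimate, as the fixed reference of the trajectory. *)
have [Q1 [hQ1 al1 _]] := dist2_attained Yh Ystar.
have [Q0 [hQ0 _ d0]] := dist2_attained Y0 Ystar.
have grot Q i : orthogonal_mx Q ->
    nrm (row_grad p A i (row i (rotate Ystar Q)) (rotate Ystar Q)) <= tau * n%:R.
  move=> hQ; rewrite row_grad_row frob_normN score_rotate // mul_design_rotate.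
  exact: rows_bounded_rotate.
have f1 := row_feasible_rotate hQ1 fS.
have op1 : op_bounded (w * n%:R) (score p A (rotate Ystar Q1)) by rewrite score_rotate.
have wc1 := well_conditioned_rotate hQ1 wcS'.
have cons := minimizer_consistent K1_gt0 regA n0 M10 hM f1 fH minH mu0 mu1 w0 op1 wc1 al1 nl.
have opF := minimizer_op K1_gt0 K2_gt0 regA n0 M10 hM f1 fH minH mu0 mu1 w0 op1 wc1 al1 nl.
rewrite -/b -/tr -/k1 -/k2 -/sigma -/wF in cons opF.
have sc1 i j : `|score p A (rotate Ystar Q1) i j| <= L by rewrite score_rotate.
have small : (3 * k2 * tr + L) * sigma + tau + 2 * (wF * (1 + b)) < k1 * mu * (M1 / 2).
  have q0 : 0 < k1 * mu * (M1 / 2) by apply: mulr_gt0 => //; exact: divr_gt0.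
  have a1 : 0 <= 3 * k2 * tr by apply: mulr_ge0; [apply: mulr_ge0 => //|]; exact: ltW.
  have a2 : (3 * k2 * tr + L) * sigma <= (3 * k2 * tr + 1) * C4 * u.
    have -> : (3 * k2 * tr + 1) * C4 * u = (3 * k2 * tr + 1) * (C4 * u) by ring.
    apply: (@le_trans _ _ ((3 * k2 * tr + 1) * (C4 * (L * w)))); last first.
      by apply: ler_wpM2l; [exact: addr_ge0|exact: ler_wpM2l].
    have -> : (3 * k2 * tr + 1) * (C4 * (L * w)) = (3 * k2 * tr + 1) * L * sigma.
      by rewrite sE; ring.
    by apply: ler_wpM2r => //; rewrite [X in _ <= X]mulrDl mul1r lerD2r; exact: ler_peMr.
  have a3 : 2 * (wF * (1 + b)) <= 2 * (C5 * (1 + b)) * u.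
    have -> : 2 * (C5 * (1 + b)) * u = 2 * (C5 * u * (1 + b)) by ring.
    by apply: ler_wpM2l => //; exact: ler_wpM2r.
  have a4 : tau <= e1 by [].
  have a5 : (3 * k2 * tr + 1) * C4 * u + 2 * (C5 * (1 + b)) * u + e1 <= C6 * e1.
    have c1 : 0 <= (3 * k2 * tr + 1) * C4 by apply: mulr_ge0 => //; exact: addr_ge0.
    have c2 : 0 <= 2 * (C5 * (1 + b)) by apply: mulr_ge0 => //; exact: mulr_ge0.
    have -> : C6 * e1 = (3 * k2 * tr + 1) * C4 * e1 + 2 * (C5 * (1 + b)) * e1 + e1 by rewrite /C6; ring.
    by rewrite lerD2r; apply: lerD; exact: ler_wpM2l.
  apply: (@le_lt_trans _ _ (k1 * mu * (M1 / 2) / 2)).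
    apply: le_trans z6; apply: le_trans a5.
    by rewrite addrAC; apply: lerD => //; exact: lerD.
  by rewrite ltr_pdivrMr // ltr_pMr // ltr1n.
have s4 : 2 * sigma <= M1 / 2.
  by apply: le_trans y5; rewrite -mulrA; apply: ler_wpM2l.
have stat := minimizer_interior K1_gt0 K2_gt0 regA n0 M10 hM f1 fH minH mu0 mu1 w0 L0 op1 wc1
  (fun i => grot Q1 i hQ1) sc1 al1 nl s4 small.
have s2 : sigma ^+ 2 <= 2 * mu.
  have c1 : C4 * u <= Num.min 1 mu by [].
  rewrite le_min in c1; have /andP [c2 c3] := c1.
  have d1 := le_trans su c2; have d2 := le_trans su c3.
  apply: (@le_trans _ _ (1 * mu)); first by rewrite expr2; exact: ler_pM.
  by rewrite mul1r ler_peMl ?ler1n // ltW.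
have hd : step_data p A (rotate Ystar Q0) Yh b mu tau wF L.
  split.
  - exact: rows_bounded_rotate.
  - exact: centered_rotate (proj2 fS).
  - exact: well_conditioned_rotate.
  - by move=> i; exact: grot.
  - by move=> i j; rewrite score_rotate.
  - exact: row_feasible_bounded.
  - exact: proj2 fH.
  - exact: stat.
  - exact: opF.
  - exact: well_conditioned_close s0 s2 cons (well_conditioned_rotate hQ1 wcS).
have r0 : 0 <= Num.sqrt (n%:R : R) by exact: sqrtr_ge0.
have dYh : dist2 Yh Ystar <= (sigma * Num.sqrt n%:R) ^+ 2.
  apply: le_trans (dist2_le _ _ hQ1) _.
  by rewrite ler_pXn2r ?nnegrE ?frob_norm_ge0 //; exact: mulr_ge0.
have tr_ : 0 <= t * Num.sqrt n%:R by exact: mulr_ge0.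
have sr_ : 0 <= sigma * Num.sqrt n%:R by exact: mulr_ge0.
have dd := dist2_triangle tr_ sr_ dY0 dYh; rewrite -mulrDl in dd.
apply: (main n A (rotate Ystar Q0) Yh Y0 tau wF L (t + sigma) eta Rmax r) => //.
- exact: addr_ge0.
- apply: le_trans y3.
  have -> : (1 + C4) * u = L * t + L * w + C4 * u by rewrite /u; ring.
  rewrite mulrDr -addrA lerD2l; apply: le_trans (_ : L * sigma <= C4 * (L * w)) _.
    by rewrite sE mulrCA.
  apply: le_trans (_ : C4 * (L * w) <= C4 * u) _; first exact: ler_wpM2l.
  by rewrite lerDr.
- by rewrite tau0 /=; exact: le_trans z2.
- by rewrite wF0 /=; exact: le_trans y4.
- by apply: le_trans he _; apply: ler_wpM2r => //; exact: ltW.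
- rewrite d0 ler_pXn2r ?nnegrE ?frob_norm_ge0 // in dY0; apply: le_trans dY0 _.
  by apply: ler_wpM2r => //; rewrite lerDl.
- rewrite -[X in _ <= X]ger0_norm; last by apply: mulr_ge0 => //; exact: addr_ge0.
  by rewrite -sqrtr_sqr; exact: ler_wsqrtr.
Qed.

End DeterministicConvergence.

(** * From sign sums and entry bounds to the operator norm *)

Section CutNorm.
Context {R : realType} {n : nat}.
Variables (E : 'M[R]_n) (c L : R).
Local Notation nrm := frob_norm.
Implicit Types u v : 'I_n -> R.

Definition bilinear_form u v : R := \sum_i \sum_j u i * E i j * v j.

Lemma bilinear_formDl u u' v : bilinear_form (fun i => u i + u' i) v = bilinear_form u v + bilinear_form u' v.
Proof.
rewrite /bilinear_form -big_split; apply: eq_bigr => i _; rewrite -big_split.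
by apply: eq_bigr => j _; rewrite /= !mulrDl.
Qed.

Lemma bilinear_formDr u v v' : bilinear_form u (fun i => v i + v' i) = bilinear_form u v + bilinear_form u v'.
Proof.
rewrite /bilinear_form -big_split; apply: eq_bigr => i _; rewrite -big_split.
by apply: eq_bigr => j _; rewrite /= mulrDr.
Qed.

Hypothesis signE : forall s s' : {ffun 'I_n -> bool},
  \sum_i \sum_j (-1) ^+ (s i) * E i j * (-1) ^+ (s' j) <= c.
Hypothesis entryE : forall i j, `|E i j| <= L.

Lemma sum_le_signs (a : 'I_n -> R) (x : 'I_n -> R) (t : R) : (forall i, `|x i| <= t) ->
  \sum_i x i * a i <= t * \sum_i (-1) ^+ [ffun i => a i < 0] i * a i.
Proof.
move=> hx; rewrite mulr_sumr; apply: ler_sum => i _; rewrite ffunE.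
have -> : (-1) ^+ (a i < 0)%R * a i = `|a i|.
  by case: ltP => h; rewrite ?expr1 ?expr0 ?mulN1r ?mul1r ?(ltr0_norm h) ?(ger0_norm h).
apply: le_trans (ler_norm _) _; rewrite normrM; apply: ler_wpM2r => //; exact: normr_ge0.
Qed.

Lemma cut_bilinear u v s t : 0 <= s -> 0 <= t ->
  (forall i, `|u i| <= s) -> (forall j, `|v j| <= t) -> bilinear_form u v <= s * t * c.
Proof.
move=> s0 t0 hu hv.
pose a i := \sum_j E i j * v j.
have -> : bilinear_form u v = \sum_i u i * a i.
  apply: eq_bigr => i _; rewrite /a mulr_sumr; apply: eq_bigr => j _; by rewrite mulrA.
apply: le_trans (sum_le_signs a hu) _; rewrite -mulrA; apply: ler_wpM2l => //.
set sg := finfun _.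
pose b j := \sum_i (-1) ^+ (sg i) * E i j.
have -> : \sum_i (-1) ^+ (sg i) * a i = \sum_j v j * b j.
  under eq_bigr do rewrite /a mulr_sumr.
  rewrite exchange_big; apply: eq_bigr => j _; rewrite /b mulr_sumr.
  by apply: eq_bigr => i _; rewrite mulrA mulrC.
apply: le_trans (sum_le_signs b hv) _; apply: ler_wpM2l => //.
set sg' := finfun _; apply: le_trans (signE sg sg').
rewrite exchange_big /=; apply: ler_sum => j _; rewrite /b mulr_sumr.
by apply: ler_sum => i _; rewrite mulrC.
Qed.

Lemma entry_bilinear u v : bilinear_form u v <= L * (\sum_i `|u i|) * \sum_j `|v j|.
Proof.
rewrite (mulrC L) !mulr_suml; apply: ler_sum => i _; rewrite mulr_sumr; apply: ler_sum => j _.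
apply: le_trans (ler_norm _) _; rewrite !normrM; apply: ler_wpM2r => //; exact: ler_wpM2l.
Qed.

Let l2 u : R := Num.sqrt (\sum_i u i ^+ 2).

Lemma sum_norm_le u : \sum_i `|u i| <= Num.sqrt n%:R * l2 u.
Proof.
have h := sum_sqr_cauchy_schwarz (fun i => `|u i|).
rewrite -sqrtrM // -[X in X <= _]ger0_norm ?sumr_ge0 // -sqrtr_sqr; apply: ler_wsqrtr.
by apply: le_trans h _; under eq_bigr do rewrite real_normK ?num_real //.
Qed.

Definition clip_low (a : R) u i : R := if `|u i| <= a then u i else 0.
Definition clip_high (a : R) u i : R := if `|u i| <= a then 0 else u i.

Lemma clip_split a u : u = fun i => clip_low a u i + clip_high a u i.
Proof. by apply/funext => i; rewrite /clip_low /clip_high; case: ifP; rewrite ?addr0 ?add0r. Qed.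

Lemma clip_low_le a u i : 0 <= a -> `|clip_low a u i| <= a.
Proof. by move=> a0; rewrite /clip_low; case: ifP => // _; rewrite normr0. Qed.

Lemma sum_clip_low a u : \sum_i `|clip_low a u i| <= \sum_i `|u i|.
Proof. by apply: ler_sum => i _; rewrite /clip_low; case: ifP => // _; rewrite normr0. Qed.

Lemma sum_clip_high a u : 0 < a -> \sum_i `|clip_high a u i| <= (\sum_i u i ^+ 2) / a.
Proof.
move=> a0; rewrite mulr_suml; apply: ler_sum => i _; rewrite /clip_high; case: ifPn => h.
  by rewrite normr0 divr_ge0 ?sqr_ge0 // ltW.
rewrite ler_pdivlMr // -real_normK ?num_real // expr2; apply: ler_wpM2l => //.
by rewrite ltW // ltNge.
Qed.

(** Both vectors are clipped at tau times their norm. The bounded parts are extremised by sign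
    vectors and cost tau^2 c; a high part has l1 norm at most |u| / tau, so pairs involving one are
    handled by the entry bound L and the inequality between l1 and l2 norms. *)
Lemma bilinear_bound u v (tau : R) : 0 < tau -> 0 <= L ->
  0 < l2 u -> 0 < l2 v ->
  bilinear_form u v <= (tau ^+ 2 * c + 2 * L * Num.sqrt n%:R / tau) * (l2 u * l2 v).
Proof.
move=> tau0 L0 u0 v0.
have lu : l2 u ^+ 2 = \sum_i u i ^+ 2 by rewrite sqr_sqrtr // sumr_ge0 // => i _; exact: sqr_ge0.
have lv : l2 v ^+ 2 = \sum_i v i ^+ 2 by rewrite sqr_sqrtr // sumr_ge0 // => i _; exact: sqr_ge0.
set a := tau * l2 u; set a' := tau * l2 v.
have a0 : 0 < a by exact: mulr_gt0.
have a'0 : 0 < a' by exact: mulr_gt0.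
rewrite {1}(clip_split a u) bilinear_formDl.
rewrite [X in bilinear_form (clip_low a u) X](clip_split a' v) bilinear_formDr.
have h1 := cut_bilinear (ltW a0) (ltW a'0) (fun i => clip_low_le u i (ltW a0)) (fun i => clip_low_le v i (ltW a'0)).
have r0 : 0 <= Num.sqrt (n%:R : R) by exact: sqrtr_ge0.
have sv : 0 <= \sum_j `|v j| by exact: sumr_ge0.
have h2 : bilinear_form (clip_low a u) (clip_high a' v) <= L * (Num.sqrt n%:R * l2 u) * (l2 v ^+ 2 / a').
  apply: le_trans (entry_bilinear _ _) _; apply: ler_pM; rewrite ?sumr_ge0 //.
  - by apply: mulr_ge0 => //; exact: sumr_ge0.
  - by apply: ler_wpM2l => //; apply: le_trans (sum_clip_low _ _) (sum_norm_le u).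
  - by rewrite lv; exact: sum_clip_high.
have h3 : bilinear_form (clip_high a u) v <= L * (l2 u ^+ 2 / a) * (Num.sqrt n%:R * l2 v).
  apply: le_trans (entry_bilinear _ _) _; apply: ler_pM; rewrite ?sumr_ge0 //.
  - by apply: mulr_ge0 => //; exact: sumr_ge0.
  - by apply: ler_wpM2l => //; rewrite lu; exact: sum_clip_high.
  - exact: sum_norm_le.
apply: le_trans (lerD (lerD h1 h2) h3) _.
rewrite le_eqVlt; apply/orP; left; apply/eqP; rewrite /a /a'.
move: (l2 u) (l2 v) (Num.sqrt n%:R) u0 v0 => x y r x0 y0; field.
by rewrite !lt0r_neq0.
Qed.

Lemma cut_op_bounded (tau : R) : 0 < tau -> 0 <= L -> 0 <= c ->
  op_bounded (tau ^+ 2 * c + 2 * L * Num.sqrt n%:R / tau) E.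
Proof.
move=> tau0 L0 c0 x; set B := _ + _.
have B0 : 0 <= B.
  apply: addr_ge0; first by apply: mulr_ge0 => //; exact: sqr_ge0.
  apply: divr_ge0; last exact: ltW.
  by apply: mulr_ge0; [exact: mulr_ge0|exact: sqrtr_ge0].
have el (y : 'cV[R]_n) : nrm y = l2 (fun i => y i 0).
  by rewrite /frob_norm /frob_dot; congr Num.sqrt; apply: eq_bigr => i _; rewrite big_ord1 expr2.
set y := E *m x.
have [->|ny] := eqVneq (nrm y) 0; first by apply: mulr_ge0 => //; exact: frob_norm_ge0.
have y0 : 0 < nrm y by rewrite lt_neqAle eq_sym ny frob_norm_ge0.
have [x0|nx] := eqVneq (nrm x) 0.
  by move: ny; rewrite /y (frob_norm_eq0 x0) mulmx0 frob_norm0 eqxx.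
have x0 : 0 < nrm x by rewrite lt_neqAle eq_sym nx frob_norm_ge0.
rewrite !el in y0 x0 *.
have h := bilinear_bound tau0 L0 y0 x0; rewrite -/B in h.
have e : bilinear_form (fun i => y i 0) (fun i => x i 0) = l2 (fun i => y i 0) ^+ 2.
  rewrite sqr_sqrtr; last by rewrite sumr_ge0 // => i _; exact: sqr_ge0.
  apply: eq_bigr => i _; rewrite expr2 {3}/y mxE mulr_sumr.
  by apply: eq_bigr => j _; rewrite mulrA.
rewrite e expr2 mulrCA in h.
by rewrite ler_pM2l // in h.
Qed.

End CutNorm.

(** * Simultaneous bounds on the noise matrix *)

Section NoiseBounds.
Context {R : realType} {n k : nat} {d : measure_display} {Omega : measurableType d}.
Variables (mu : {measure set (measurableTypeR R) -> \bar R}) (p : R -> R -> R) (X : set R).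
Hypotheses (hp : density_family mu p) (hX : forall theta, [set x | 0 < p theta x] = X).
Hypothesis (hE1 : loglik_regular p X).
Variables (P : probability Omega R) (Ystar : 'M[R]_(n, k + 1)) (A : Omega -> 'M[R]_n).
Hypothesis hA : latent_space_model mu p P Ystar A.
Variables (b k1 K : R).
Hypotheses (b_gt0 : 0 < b) (hTheta : forall i j, `|Theta Ystar i j| <= b).
Hypothesis hK : forall x, X x ->
  curvature_bounds (loglik p ^~ x) (dloglik p 1 ^~ x) (b + 1) k1 K.
Hypothesis K_ge0 : 0 <= K.
Local Notation dot := frob_dot.
Local Notation nrm := frob_norm.
Local Notation E w := (score p (A w) Ystar).
Let symA w : (A w)^T = A w. Proof. by case: hA => h _ _ _; case: (h w). Qed.

Lemma score_dot_edge_sum (W : 'M[R]_n) w :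
  dot (E w) W = edge_sum p Ystar A (fun e => W e.1 e.2 + W e.2 e.1) w.
Proof.
have h : 2 * dot (E w) W = dot (E w) (W + W^T).
  by rewrite frob_dotDr -[X in _ + X]frob_dot_tr trmxK (score_sym p (symA w)); ring.
have : 2 * dot (E w) W = 2 * edge_sum p Ystar A (fun e => W e.1 e.2 + W e.2 e.1) w.
  rewrite h score_dot sum_upper_triangle.
    congr (2 * _); rewrite /edge_sum pair_big_dep; apply: eq_bigr => e _ /=.
    by rewrite !mxE mulrC.
  by move=> i j; rewrite (Theta_sym Ystar i j) (symAE (symA w)) !mxE; ring.
by apply: mulfI; rewrite pnatr_eq0.
Qed.

(** As E is symmetric, the edge coefficients of <E, W> are W_ij + W_ji; this explains the 1/2 on
    entries and the factor 4 on the squared norm. *)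
Lemma noise_matrix_event (T : finType) (W : T -> 'M[R]_n) (h t v : T -> R) :
  (forall x, 0 <= h x) -> (forall x i j, `|h x * W x i j| <= 1 / 2) ->
  (forall x, h x ^+ 2 * (4 * nrm (W x) ^+ 2) <= v x) ->
  exists Ev : set Omega, [/\ measurable Ev,
    ((1 - \sum_x expR (- (h x * t x) + K / 2 * v x))%:E <= P Ev)%E,
    forall w, Ev w -> forall x, dot (E w) (W x) <= t x
  & forall w, Ev w -> forall i j : 'I_n, (i < j)%N -> X (A w i j)].
Proof.
move=> h0 hW hv.
pose a x (e : 'I_n * 'I_n) := W x e.1 e.2 + W x e.2 e.1.
have ha x e : `|h x * a x e| <= 1.
  rewrite mulrDr; apply: le_trans (ler_normD _ _) _.
  by have := hW x e.1 e.2; have := hW x e.2 e.1; move: `|_| `|_| => c c'; lra.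
have hv' x : h x ^+ 2 * \sum_(e : 'I_n * 'I_n | (e.1 < e.2)%N) a x e ^+ 2 <= v x.
  apply: le_trans (hv x); apply: ler_wpM2l; first exact: sqr_ge0.
  have -> : 4 * nrm (W x) ^+ 2 = \sum_(e : 'I_n * 'I_n) 2 * (W x e.1 e.2 ^+ 2 + W x e.2 e.1 ^+ 2).
    rewrite -mulr_sumr (_ : 4 = 2 * 2) -1?mulrA; last by rewrite -natrM.
    congr (_ * _); rewrite big_split /= mulrDl !mul1r sqr_frob_norm /frob_dot.
    congr (_ + _); first by rewrite pair_big; apply: eq_bigr => e _; rewrite expr2.
    by rewrite exchange_big pair_big; apply: eq_bigr => e _; rewrite expr2.
  rewrite [X in _ <= X](bigID (fun e : 'I_n * 'I_n => (e.1 < e.2)%N)) /=.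
  rewrite -[X in X <= _]addr0; apply: lerD; last first.
    by apply: sumr_ge0 => e _; apply: mulr_ge0 => //; apply: addr_ge0; exact: sqr_ge0.
  apply: ler_sum => e _; rewrite /a; move: (W x e.1 e.2) (W x e.2 e.1) => y z.
  by have := sqr_ge0 (y - z); rewrite sqrrB sqrrD; move: (y ^+ 2) (z ^+ 2) (y * z) => u u' u''; lra.
have [Ev [h1 h2 h3 h4]] := noise_event hp hX hE1 hA b_gt0 hTheta hK K_ge0 t h0 ha hv'.
by exists Ev; split=> // w Ew x; rewrite score_dot_edge_sum; exact: h3.
Qed.

Variables (eps B : R).
Hypotheses (eps_gt0 : 0 < eps) (B_gt0 : 0 < B) (n_gt0 : (0 < n)%N).
Hypothesis designB : forall j l, `|design Ystar j l| <= B.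
Local Notation rtn := (Num.sqrt (n%:R : R)).
Local Notation logn := ((2 + eps) * ln (n%:R : R)).

Let nR : 0 < n%:R :> R. Proof. by rewrite ltr0n. Qed.
Let r_gt0 : 0 < rtn. Proof. by rewrite sqrtr_gt0. Qed.
Let r_ge1 : 1 <= rtn.
Proof. by rewrite -[X in X <= _]sqrtr1; apply: ler_wsqrtr; rewrite ler1n. Qed.

(* Bounds on these bilinear sums control the cut norm of the noise, its product with the
   design matrix and its entries, respectively. *)
Let test_index := ((({ffun 'I_n -> bool} * {ffun 'I_n -> bool}) +
  ((('I_n * 'I_(k + 1)) * bool) + (('I_n * 'I_n) * bool)))%type).

Let test_matrix (x : test_index) : 'M[R]_n :=
  match x with
  | inl (s, s') => \matrix_(i, j) ((-1) ^+ (s i) * (-1) ^+ (s' j))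
  | inr (inl (i, l, c)) => \matrix_(i', j) ((-1) ^+ c * (i' == i)%:R * design Ystar j l)
  | inr (inr (i, j, c)) => (-1) ^+ c *: delta_mx i j
  end.

(** The Chernoff parameters: of order n^(-1/2) for sign matrices and for design columns, of order 1
    for single entries. *)
Let scale (x : test_index) : R :=
  match x with inl _ => 1 / (2 * rtn) | inr (inl _) => 1 / (2 * (B * rtn)) | inr (inr _) => 1 / 2 end.

Let variance (x : test_index) : R := if x is inl _ then n%:R else 1.

(** Chosen so that the final exponent is -(4 + eps) n for the 4^n sign tests, and -(2 + eps) ln n up
    to a constant for the O(n^2) others. *)
Let threshold (x : test_index) : R :=
  match x with
  | inl _ => 2 * rtn * ((K / 2 + 2 + (2 + eps)) * n%:R)
  | inr (inl _) => 2 * (B * rtn) * logn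
  | inr (inr _) => 2 * logn end.

Let sgn_norm (c : bool) : `|(-1) ^+ c : R| = 1.
Proof. by rewrite normrX normrN1 expr1n. Qed.

Let scale_ge0 x : 0 <= scale x.
Proof.
have r0 := ltW r_gt0; have B0 := ltW B_gt0.
by case: x => [_|[_|_]] /=; apply: divr_ge0 => //; apply: mulr_ge0 => //; exact: mulr_ge0.
Qed.

Let scale_bound x i j : `|scale x * test_matrix x i j| <= 1 / 2.
Proof.
rewrite normrM ger0_norm //.
have half c : 1 <= c -> 1 / (2 * c) <= 1 / 2 :> R.
  move=> c1; have c0 : 0 < c by exact: lt_le_trans c1.
  by rewrite ler_pdivrMr ?mulr_gt0 // mulrA divfK ?mul1r ?pnatr_eq0 //; exact: ler_peMr.
case: x => [[s s']|[[[a l] c]|[[a a'] c]]] /=.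
- by rewrite mxE normrM !sgn_norm mulr1 mulr1; exact: half.
- rewrite mxE !normrM sgn_norm.
  apply: (@le_trans _ _ (1 / (2 * (B * rtn)) * B)).
    apply: ler_wpM2l; first exact: (scale_ge0 (inr (inl (a, l, c)))).
    rewrite mul1r -[X in _ <= X]mul1r.
    by apply: ler_pM => //; rewrite ger0_norm // lern1 leq_b1.
  have -> : 1 / (2 * (B * rtn)) * B = 1 / (2 * rtn) by field; rewrite !lt0r_neq0.
  exact: half.
- rewrite !mxE normrM sgn_norm -[X in _ <= X]mulr1; apply: ler_wpM2l => //.
  by rewrite mul1r ger0_norm // lern1 leq_b1.
Qed.

Let variance_bound x : scale x ^+ 2 * (4 * nrm (test_matrix x) ^+ 2) <= variance x.
Proof.
have r2 : rtn ^+ 2 = n%:R by exact: rtn_sqr.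
have rn := lt0r_neq0 r_gt0; have Bn := lt0r_neq0 B_gt0.
case: x => [[s s']|[[[a l] c]|[[a a'] c]]] /=.
- have -> : nrm (\matrix_(i, j) ((-1) ^+ s i * (-1) ^+ s' j) : 'M[R]_n) ^+ 2 = n%:R * n%:R.
    rewrite sqr_frob_norm /frob_dot.
    under eq_bigr => i _.
      under eq_bigr => j _ do rewrite !mxE -expr2 exprMn !sqrr_sign mulr1.
      rewrite sumr_const card_ord; over.
    by rewrite sumr_const card_ord mulr_natl.
  by rewrite le_eqVlt; apply/orP; left; apply/eqP; move: r2 rn; move: rtn => r <- rn; field.
- have h : nrm (\matrix_(i', j) ((-1) ^+ c * (i' == a)%:R * design Ystar j l) : 'M[R]_n) ^+ 2 <= n%:R * B ^+ 2.
    rewrite sqr_frob_norm /frob_dot (bigD1 a) //= [X in _ + X]big1 ?addr0; last first.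
      by move=> i ia; apply: big1 => j _; rewrite mxE (negbTE ia) mulr0 !mul0r.
    rewrite mulr_natl -[X in _ *+ X]card_ord -sumr_const; apply: ler_sum => j _.
    rewrite mxE eqxx mulr1 -expr2 exprMn sqrr_sign mul1r -real_normK ?num_real //.
    by apply: lerXn2r; rewrite ?nnegrE; [exact: normr_ge0|exact: ltW|exact: designB].
  apply: (@le_trans _ _ ((1 / (2 * (B * rtn))) ^+ 2 * (4 * (n%:R * B ^+ 2)))).
    by apply: ler_wpM2l; [exact: sqr_ge0|exact: ler_wpM2l].
  by rewrite le_eqVlt; apply/orP; left; apply/eqP; move: r2 rn; move: rtn => r <- rn; field; rewrite rn Bn.
- have -> : nrm ((-1) ^+ c *: delta_mx a a' : 'M[R]_n) ^+ 2 = 1.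
    rewrite frob_normZ sgn_norm mul1r sqr_frob_norm /frob_dot (bigD1 a) //= [X in _ + X]big1 ?addr0; last first.
      by move=> i ia; apply: big1 => j _; rewrite !mxE (negbTE ia) mul0r.
    rewrite (bigD1 a') //= big1 ?addr0; first by rewrite !mxE !eqxx mulr1.
    by move=> j ja; rewrite !mxE (negbTE ja) andbF mul0r.
  by rewrite le_eqVlt; apply/orP; left; apply/eqP; field.
Qed.

Let rate : R := n%:R `^ (- eps).

Let sqr_rate : n%:R ^+ 2 * expR (- logn) = rate.
Proof.
have -> : n%:R ^+ 2 = expR (2 * ln (n%:R : R)) by rewrite expRM_natl lnK // posrE.
rewrite /rate /powR gt_eqF // -expRD; congr expR.
by move: (ln _) => l; ring.
Qed.

Let exponent x : - (scale x * threshold x) + K / 2 * variance x =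
  if x is inl _ then - ((2 + (2 + eps)) * n%:R) else - logn + K / 2.
Proof.
have rn := lt0r_neq0 r_gt0; have Bn := lt0r_neq0 B_gt0.
by case: x => [_|[_|_]] /=; move: (ln (n%:R : R)) rn; move: rtn => r l rn; field; rewrite ?rn ?Bn.
Qed.

Let total : \sum_x expR (- (scale x * threshold x) + K / 2 * variance x) <=
  (1 + (2 * (k + 1)%:R + 2) * expR (K / 2)) * rate.
Proof.
under eq_bigr do rewrite exponent.
rewrite big_sumType big_sumType /= !sumr_const !card_prod card_ffun card_bool !card_ord.
have n1 : 1 <= n%:R :> R by rewrite ler1n.
rewrite -!sqr_rate; set x := expR (- logn); set y := expR (K / 2).
have x0 : 0 <= x by exact: expR_ge0.
have y0 : 0 <= y by exact: expR_ge0.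
have -> : expR (- logn + K / 2) = x * y by rewrite expRD.
have n2 : n%:R <= n%:R ^+ 2 :> R by rewrite expr2; apply: ler_peMl.
have n3 : 1 <= n%:R ^+ 2 :> R by exact: le_trans n2.
have t1 : expR (- ((2 + (2 + eps)) * n%:R)) *+ (2 ^ n * 2 ^ n) <= n%:R ^+ 2 * x.
  (* Since 4^n <= exp (2 n), the sign tests leave exp (-(2 + eps) n), which is below exp (-(2 + eps)
     ln n). *)
  have p2 : (2 ^ n)%:R <= expR n%:R :> R.
    rewrite natrX -[n%:R in X in _ <= X]mulr1 expRM_natl; apply: lerXn2r; rewrite ?nnegrE ?expR_ge0 //.
    by have := expR_ge1Dx (1 : R); rewrite -[1 + 1]/2.
  rewrite -[X in X <= _]mulr_natl natrM.
  apply: (@le_trans _ _ (expR n%:R * expR n%:R * expR (- ((2 + (2 + eps)) * n%:R)))).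
    by apply: ler_wpM2r; [exact: expR_ge0|apply: ler_pM].
  rewrite -!expRD; apply: (@le_trans _ _ x); last exact: ler_peMl.
  rewrite /x ler_expR.
  have -> : n%:R + n%:R + - ((2 + (2 + eps)) * n%:R) = - ((2 + eps) * n%:R) :> R by ring.
  rewrite lerN2; apply: ler_wpM2l; first by rewrite addr_ge0 // ltW.
  exact: ltW (ln_sublinear nR).
have t2 : x * y *+ (n * (k + 1) * 2) <= 2 * (k + 1)%:R * y * (n%:R ^+ 2 * x).
  rewrite -[X in X <= _]mulr_natl !natrM.
  have -> : 2 * (k + 1)%:R * y * (n%:R ^+ 2 * x) = n%:R ^+ 2 * ((k + 1)%:R * 2 * (x * y)) by ring.
  have -> : n%:R * (k + 1)%:R * 2 * (x * y) = n%:R * ((k + 1)%:R * 2 * (x * y)) by ring.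
  by apply: ler_wpM2r => //; apply: mulr_ge0; exact: mulr_ge0.
have t3 : x * y *+ (n * n * 2) = 2 * y * (n%:R ^+ 2 * x).
  by rewrite -[LHS]mulr_natl !natrM; ring.
rewrite t3.
have -> : (1 + (2 * (k + 1)%:R + 2) * y) * (n%:R ^+ 2 * x) =
  n%:R ^+ 2 * x + (2 * (k + 1)%:R * y * (n%:R ^+ 2 * x) + 2 * y * (n%:R ^+ 2 * x)) by ring.
by apply: lerD => //; apply: lerD.
Qed.

Lemma noise_bounds : exists Ev : set Omega, [/\ measurable Ev,
    ((1 - (1 + (2 * (k + 1)%:R + 2) * expR (K / 2)) * n%:R `^ (- eps))%:E <= P Ev)%E &
    forall w, Ev w ->
    [/\ forall s s' : {ffun 'I_n -> bool},
          \sum_i \sum_j (-1) ^+ (s i) * E w i j * (-1) ^+ (s' j) <= (K + 2 * (4 + eps)) * n%:R * rtn,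
        forall i l, `|(E w *m design Ystar) i l| <= 2 * B * rtn * logn,
        forall i j, `|E w i j| <= 2 * logn
      & forall i j : 'I_n, (i < j)%N -> X (A w i j)]].
Proof.
have [Ev [h1 h2 h3 h4]] := noise_matrix_event threshold scale_ge0 scale_bound variance_bound.
exists Ev; split=> //.
  by apply: le_trans h2; rewrite lee_fin lerD2l lerN2; exact: total.
move=> w Ew; have h := h3 w Ew; split; last exact: h4.
- move=> s s'; have := h (inl (s, s')) => /= h5.
  have -> : (K + 2 * (4 + eps)) * n%:R * rtn = 2 * rtn * ((K / 2 + 2 + (2 + eps)) * n%:R) by field.
  apply: le_trans h5; rewrite /frob_dot le_eqVlt; apply/orP; left; apply/eqP.
  apply: eq_bigr => i _; apply: eq_bigr => j _; rewrite [in RHS]mxE.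
  by rewrite mulrCA mulrA.
- move=> i l; have key (c : bool) : (-1) ^+ c * (E w *m design Ystar) i l <= 2 * B * rtn * logn.
    have := h (inr (inl (i, l, c))) => /= h5.
    rewrite -(mulrA 2 B) ; apply: le_trans h5; rewrite /frob_dot (bigD1 i) //= [X in _ + X]big1 ?addr0; last first.
      by move=> i' ii; apply: big1 => j _; rewrite [X in _ * X]mxE (negbTE ii) mulr0 mul0r mulr0.
    rewrite mxE mulr_sumr; apply: ler_sum => j _; rewrite [X in _ <= _ * X]mxE eqxx mulr1.
    by rewrite mulrCA.
  rewrite ler_norml; have := key true; have := key false; rewrite expr0 expr1 mul1r mulN1r.
  by move=> k1' k2'; rewrite k1' lerNl k2'.
- move=> i j; have key (c : bool) : (-1) ^+ c * E w i j <= 2 * logn.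
    have := h (inr (inr (i, j, c))) => /= h5.
    apply: le_trans h5; rewrite frob_dotZr.
    by rewrite le_eqVlt; apply/orP; left; apply/eqP; congr (_ * _); rewrite frob_dot_delta.
  rewrite ler_norml; have := key true; have := key false; rewrite expr0 expr1 mul1r mulN1r.
  by move=> k1' k2'; rewrite k1' lerNl k2'.
Qed.

End NoiseBounds.

(** * Smallness of the noise scales for large n *)

Section Asymptotics.
Context {R : realType}.

(** With a = nu / 4, ln n <= n^a / a bounds the squared logarithm by a multiple of n^(nu / 2). *)
Lemma log_power_small (nu C e : R) : 0 < nu -> 0 <= C -> 0 < e ->
  \forall n \near \oo, C * (1 + ln n%:R) ^+ 2 * n%:R `^ (- nu) <= e.
Proof.
move=> nu0 C0 e0; pose a := nu / 4; have a0 : 0 < a by rewrite divr_gt0.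
pose C' := C * (1 + 1 / a) ^+ 2.
have C'0 : 0 <= C' by apply: mulr_ge0 => //; exact: sqr_ge0.
have Ce : 0 <= C' / e by rewrite divr_ge0 // ltW.
near=> n.
have n1 : 1 <= n%:R :> R by near: n; exact: nbhs_infty_ger.
have n0 : 0 < n%:R :> R by exact: lt_le_trans n1.
have nn : n%:R != 0 :> R by rewrite gt_eqF.
have nbig : (C' / e) `^ (2 / nu) <= n%:R by near: n; exact: nbhs_infty_ger.
have ln0 : 0 <= ln (n%:R : R) by exact: ln_ge0.
set x := n%:R `^ a.
have x0 : 0 < x by exact: powR_gt0.
have x1 : 1 <= x by rewrite -[X in X <= _](powRr0 (n%:R : R)) /x; apply: ler_powR => //; exact: ltW.
have lx : ln (n%:R : R) <= x / a.
  have := ltW (ln_sublinear x0); rewrite ln_powR mulrC => h.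
  by rewrite ler_pdivlMr.
have h1 : 1 + ln n%:R <= (1 + 1 / a) * x.
  by rewrite mulrDl mul1r mulrAC mul1r; exact: lerD.
have h2 : (1 + ln n%:R) ^+ 2 <= ((1 + 1 / a) * x) ^+ 2.
  by apply: lerXn2r => //; rewrite nnegrE ?addr_ge0 // mulr_ge0 ?addr_ge0 ?divr_ge0 // ltW.
have h3 : x ^+ 2 * n%:R `^ (- nu) = (n%:R `^ (nu / 2))^-1.
  rewrite -powRN expr2 /x -!powRD ?nn ?implybT //; by congr (_ `^ _); rewrite /a; field.
have y0 : 0 < (n%:R : R) `^ (nu / 2) by exact: powR_gt0.
have h4 : C' / e <= n%:R `^ (nu / 2).
  have -> : C' / e = ((C' / e) `^ (2 / nu)) `^ (nu / 2).
    rewrite -powRrM (_ : 2 / nu * (nu / 2) = 1) ?powRr1 //; by field; exact: lt0r_neq0.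
  by apply: ge0_ler_powR => //; rewrite ?nnegrE ?powR_ge0 ?divr_ge0 // ltW.
apply: (@le_trans _ _ (C * ((1 + 1 / a) * x) ^+ 2 * n%:R `^ (- nu))).
  by apply: ler_wpM2r; [exact: powR_ge0|exact: ler_wpM2l].
rewrite exprMn mulrA -/C' -mulrA h3 ler_pdivrMr // mulrC -ler_pdivrMr //.
Unshelve. all: by end_near.
Qed.

Lemma power_small (nu C e : R) : 0 < nu -> 0 <= C -> 0 < e ->
  \forall n \near \oo, C * n%:R `^ (- nu) <= e.
Proof.
move=> nu0 C0 e0; near=> n.
have n1 : 1 <= n%:R :> R by near: n; exact: nbhs_infty_ger.
apply: le_trans (_ : C * (1 + ln n%:R) ^+ 2 * n%:R `^ (- nu) <= e); last first.
  by near: n; exact: log_power_small.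
apply: ler_wpM2r; first exact: powR_ge0.
by apply: ler_peMr => //; apply: exprn_ege1; rewrite lerDl ln_ge0.
Unshelve. all: by end_near.
Qed.

(* [w n] is the operator norm bound obtained from [cut_op_bounded] at the clipping level
   [n ^ (- 1 / 3)]. *)
Lemma noise_scales_small (lam Cc Cr c1 vs0 e : R) : 0 <= lam -> 0 <= Cc -> 0 <= Cr -> 0 <= c1 ->
  0 < vs0 -> 0 < e ->
  \forall n \near \oo,
    let L : R := 1 + 2 * (lam * ln n%:R) in
    let w : R := ((n%:R `^ (- (1 / 3))) ^+ 2 * (Cc * n%:R * Num.sqrt n%:R)
                  + 2 * L * Num.sqrt n%:R / (n%:R `^ (- (1 / 3)))) / n%:R in
    let tau : R := Cr * Num.sqrt n%:R * (lam * ln n%:R) / n%:R in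
    let t : R := Num.sqrt c1 * n%:R `^ (- (vs0 / 2)) in
    [/\ 0 <= w, 0 <= tau <= e, L * (t + w) <= e, 1 <= L & c1 * n%:R `^ (1 - vs0) <= (t * Num.sqrt n%:R) ^+ 2].
Proof.
move=> lam0 Cc0 Cr0 c10 vs00 e0.
pose CL := 1 + 2 * lam.
have CL0 : 0 <= CL by rewrite addr_ge0 // mulr_ge0.
have s0 : 0 <= Num.sqrt c1 by exact: sqrtr_ge0.
near=> n => /=.
have n1 : 1 <= n%:R :> R by near: n; exact: nbhs_infty_ger.
have n0 : 0 < n%:R :> R by exact: lt_le_trans n1.
have nn : n%:R != 0 :> R by rewrite gt_eqF.
have ln0 : 0 <= ln (n%:R : R) by exact: ln_ge0.
have a1 : Cr * lam * (1 + ln n%:R) ^+ 2 * n%:R `^ (- (1 / 2)) <= e.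
  by near: n; apply: log_power_small; rewrite ?divr_gt0 ?mulr_ge0.
have a2 : CL * Num.sqrt c1 * (1 + ln n%:R) ^+ 2 * n%:R `^ (- (vs0 / 2)) <= e / 2.
  by near: n; apply: log_power_small; rewrite ?divr_gt0 ?mulr_ge0.
have a3 : CL * (Cc + 2 * CL) * (1 + ln n%:R) ^+ 2 * n%:R `^ (- (1 / 6)) <= e / 2.
  by near: n; apply: log_power_small; rewrite ?divr_gt0 ?mulr_ge0 ?addr_ge0 ?mulr_ge0.
set l := ln (n%:R : R) in ln0 a1 a2 a3 *.
have l1 : 1 + l <= (1 + l) ^+ 2 by rewrite expr2 ler_peMl ?addr_ge0 // lerDl.
have l2 : 1 <= (1 + l) ^+ 2 by apply: exprn_ege1; rewrite lerDl.
set L := 1 + 2 * (lam * l).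
have L1 : 1 <= L by rewrite lerDl !mulr_ge0.
have LC : L <= CL * (1 + l).
  by rewrite /L /CL; have := mulr_ge0 lam0 ln0; have := lam0; have := ln0; lra.
have L0 : 0 <= L by exact: le_trans L1.
have rE : Num.sqrt n%:R = n%:R `^ (1 / 2) :> R by rewrite mul1r powR12_sqrt // ltW.
have nE : n%:R = n%:R `^ 1 :> R by rewrite powRr1 // ltW.
have nV : n%:R^-1 = n%:R `^ (- 1) :> R by rewrite powRN powRr1 // ltW.
have pD (x y : R) : n%:R `^ x * n%:R `^ y = n%:R `^ (x + y) :> R by rewrite powRD // nn implybT.
have pV (x : R) : (n%:R `^ x)^-1 = n%:R `^ (- x) :> R by rewrite powRN.
(* At the clipping level n^(-1/3) both terms of the operator norm bound scale as n^(5/6), up to the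
   logarithm in L. *)
have wE : ((n%:R `^ (- (1 / 3))) ^+ 2 * (Cc * n%:R * Num.sqrt n%:R)
                  + 2 * L * Num.sqrt n%:R / (n%:R `^ (- (1 / 3)))) / n%:R =
    (Cc + 2 * L) * n%:R `^ (- (1 / 6)).
  have e1 : (n%:R `^ (- (1 / 3))) ^+ 2 * Num.sqrt n%:R = n%:R `^ (- (1 / 6)) :> R.
    by rewrite expr2 rE !pD; congr (_ `^ _); field.
  have e2 : Num.sqrt n%:R / (n%:R `^ (- (1 / 3))) / n%:R = n%:R `^ (- (1 / 6)) :> R.
    by rewrite rE nV !pV !pD; congr (_ `^ _); field.
  rewrite mulrDl [RHS]mulrDl -{1}e1 -e2; congr (_ + _); last by rewrite !mulrA.
  by move: (_ ^+ 2) (Num.sqrt _) => u v; field.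
have tauE : Cr * Num.sqrt n%:R * (lam * l) / n%:R = Cr * lam * l * n%:R `^ (- (1 / 2)).
  have <- : Num.sqrt n%:R / n%:R = n%:R `^ (- (1 / 2)) :> R.
    by rewrite rE nV pD; congr (_ `^ _); field.
  by move: (Num.sqrt _) => u; field.
rewrite wE tauE; split=> //.
- by apply: mulr_ge0; [apply: addr_ge0 => //; exact: mulr_ge0|exact: powR_ge0].
- apply/andP; split; first by do 3![apply: mulr_ge0 => //]; exact: powR_ge0.
  apply: le_trans a1; apply: ler_wpM2r; first exact: powR_ge0.
  apply: ler_wpM2l; first exact: mulr_ge0.
  by apply: le_trans l1; rewrite lerDr.
- rewrite mulrDr [e]splitr; apply: lerD.
    apply: le_trans a2.
    have -> : L * (Num.sqrt c1 * n%:R `^ (- (vs0 / 2))) = L * Num.sqrt c1 * n%:R `^ (- (vs0 / 2)) by rewrite mulrA.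
    apply: ler_wpM2r; first exact: powR_ge0.
    rewrite (mulrAC CL); apply: ler_wpM2r => //; apply: le_trans LC _; exact: ler_wpM2l.
  apply: le_trans a3; rewrite mulrA; apply: ler_wpM2r; first exact: powR_ge0.
  have h : Cc + 2 * L <= (Cc + 2 * CL) * (1 + l).
    have := mulr_ge0 Cc0 ln0; move: LC; rewrite (mulrDl Cc (2 * CL)) (mulrDr Cc) mulr1 -(mulrA 2 CL).
    by move: (CL * (1 + l)) (Cc * l) => u v; lra.
  apply: (@le_trans _ _ (CL * (1 + l) * ((Cc + 2 * CL) * (1 + l)))).
    by apply: ler_pM => //; rewrite addr_ge0 // mulr_ge0.
  by rewrite le_eqVlt; apply/orP; left; apply/eqP; ring.
- rewrite !exprMn !sqr_sqrtr //.
  rewrite -mulrA expr2 pD [X in _ <= _ * (_ * X)]nE pD le_eqVlt; apply/orP; left; apply/eqP.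
  by congr (_ * _ `^ _); field.
Unshelve. all: by end_near.
Qed.

End Asymptotics.

(** * The norms and conditions of the statement in rowwise form *)

Section NormConversions.
Context {R : realType}.
Local Notation dot := frob_dot.
Local Notation nrm := frob_norm.

Lemma mx_norm_leP m q (X : 'M[R]_(m, q)) (c : R) : 0 <= c ->
  (forall i j, `|X i j| <= c) <-> `|X| <= c.
Proof.
move=> c0; have -> : `|X| = \big[Num.max/0]_ij `|X ij.1 ij.2| by exact: mx_normrE.
split=> h; first by apply: bigmax_le => // ij _; exact: h.
by move=> i j; apply: le_trans h; exact: (@le_bigmax_cond _ _ _ 0 (i, j) predT (fun ij : 'I_m * 'I_q => `|X ij.1 ij.2|)).
Qed.

Lemma mx_norm_le_frob m q (X : 'M[R]_(m, q)) : `|X| <= nrm X.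
Proof.
by apply/mx_norm_leP; [exact: frob_norm_ge0|move=> i j; exact: frob_norm_entry_le].
Qed.

Lemma mulmx_col_entry m q (X : 'M[R]_(m, q)) (v : 'cV[R]_q) i : (X *m v) i 0 = dot (row i X) v^T.
Proof. by rewrite mxE /frob_dot big_ord1; apply: eq_bigr => j _; rewrite !mxE. Qed.

(** Normalising a row gives the vector that attains its norm; q > 0 ensures that unit vectors exist,
    so that the supremum is over a nonempty set. *)
Lemma two_to_infP m q (X : 'M[R]_(m, q)) (c : R) : (0 < q)%N -> 0 <= c ->
  two_to_inf X <= c <-> rows_bounded c X.
Proof.
move=> q0 c0; rewrite /two_to_inf; set S := [set `|_| | _ in _].
have ubS : has_ubound S.
  exists (nrm X) => _ [v /= hv <-]; apply: le_trans (mx_norm_le_frob _) _.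
  by apply: le_trans (frob_norm_mulmx _ _) _; rewrite hv mulr1.
split=> h.
  move=> i; have [->|ni] := eqVneq (nrm (row i X)) 0; first exact: c0.
  have i0 : 0 < nrm (row i X) by rewrite lt_neqAle eq_sym ni frob_norm_ge0.
  pose v := (nrm (row i X))^-1 *: (row i X)^T.
  have v1 : nrm v = 1 by rewrite frob_normZ frob_norm_tr gtr0_norm ?invr_gt0 // mulVf.
  have h1 : `|X *m v| <= c by apply: le_trans h; apply: ub_le_sup => //; exists v.
  have h2 := (mx_norm_leP _ c0).2 h1 i 0.
  apply: le_trans h2; rewrite mulmx_col_entry linearZ /= trmxK frob_dotZr -sqr_frob_norm.
  by rewrite expr2 mulrA mulVf // mul1r ger0_norm // frob_norm_ge0.
apply: ge_sup.
  pose v : 'cV[R]_q := delta_mx (Ordinal q0) 0.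
  exists (`|X *m v|); exists v => //=.
  rewrite /frob_norm /frob_dot (bigD1 (Ordinal q0)) //= [X in _ + X]big1 ?addr0.
    by rewrite big_ord1 !mxE !eqxx mulr1 sqrtr1.
  by move=> i ni; rewrite big_ord1 !mxE (negbTE ni) mul0r.
move=> _ [v /= hv <-]; apply/mx_norm_leP => // i j; rewrite ord1 mulmx_col_entry.
apply: le_trans (frob_cauchy_schwarz _ _) _; rewrite frob_norm_tr hv mulr1; exact: h.
Qed.

Lemma rows_feasibleP n k (c : R) (Y : 'M[R]_(n, k + 1)) : (0 < k)%N -> 0 <= c ->
  (forall i, row_ok c (row i Y)) <-> (two_to_inf (positions Y) <= c /\ `|degrees Y| <= c).
Proof.
move=> k0 c0.
have e1 i : positions (row i Y) = row i (positions Y) by apply/rowP => j; rewrite !mxE.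
have e2 i : nrm (degrees (row i Y)) = `|degrees Y i 0|.
  by rewrite /frob_norm /frob_dot !big_ord1 -expr2 sqrtr_sqr !mxE.
split=> [h|[/(two_to_infP _ k0 c0) h1 /(mx_norm_leP _ c0) h2] i].
  split; first by apply/two_to_infP => // i; rewrite -e1; case: (h i).
  by apply/mx_norm_leP => // i j; rewrite ord1 -e2; case: (h i).
by split; [rewrite e1|rewrite e2].
Qed.

Lemma feasibleP n k (c : R) (Y : 'M[R]_(n, k + 1)) : (0 < k)%N -> 0 <= c ->
  feasible c Y <-> row_feasible c Y.
Proof.
move=> k0 c0; split=> [[h1 h2 h3]|[/(rows_feasibleP _ k0 c0) [h1 h2] h3]]; last by split.
by split => //; apply/rows_feasibleP.
Qed.

Lemma well_conditioned_sigma_min n k (c : R) (Y : 'M[R]_(n, k + 1)) : (0 < k)%N -> (0 < n)%N ->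
  c <= sigma_min (n%:R^-1 *: ((positions Y)^T *m positions Y)) -> well_conditioned c Y.
Proof.
move=> k0 n0 hc v; have nR : 0 < n%:R :> R by rewrite ltr0n.
have e (u : 'rV_k) : dot (u *m (n%:R^-1 *: ((positions Y)^T *m positions Y))) u =
    n%:R^-1 * dot (u *m (positions Y)^T) (u *m (positions Y)^T).
  by rewrite -scalemxAr frob_dotZl mulmxA frob_dot_mulmxr.
have sym : (n%:R^-1 *: ((positions Y)^T *m positions Y))^T = n%:R^-1 *: ((positions Y)^T *m positions Y).
  by rewrite linearZ /= trmx_mul trmxK.
have psd (u : 'rV_k) : 0 <= dot (u *m (n%:R^-1 *: ((positions Y)^T *m positions Y))) u.
  by rewrite e mulr_ge0 ?invr_ge0 ?frob_dot_ge0 // ltW.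
have := sigma_min_quad k0 sym psd hc v.
by rewrite e -(ler_pM2l nR) mulVKf ?lt0r_neq0 // mulrA (mulrC n%:R).
Qed.

End NormConversions.

Lemma support_data_regular (R : realType) (p : R -> R -> R) (X : set R) (K1 K2 : R -> R) n (A : 'M[R]_n) :
  loglik_regular p X ->
  (forall b, 0 < b -> forall x, X x ->
    curvature_bounds (loglik p ^~ x) (dloglik p 1 ^~ x) b (K1 b) (K2 b)) ->
  A^T = A -> (forall i j : 'I_n, (i < j)%N -> X (A i j)) -> data_regular p K1 K2 A.
Proof.
move=> [hd _] hK symA hX.
have XA i j : i != j -> X (A i j).
  move=> ij; case: (ltngtP i j) => h; first exact: hX.
    by rewrite -symA mxE; exact: hX.
  by move: ij; rewrite (ord_inj h) eqxx.
split=> // [i j ij theta|b b0 i j ij]; last exact: hK b0 _ (XA i j ij).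
rewrite [dloglik p 1 theta _]derive1E; apply: derivableP.
exact: (hd _ (XA i j ij) 0%N theta isT).
Qed.

Lemma frob_norm_row_entries (R : realType) q (v : 'rV[R]_q) (c : R) : 0 <= c ->
  (forall l, `|v 0 l| <= c) -> frob_norm v <= q%:R * c.
Proof.
move=> c0 hv.
have -> : v = \sum_l v 0 l *: delta_mx 0 l by rewrite [LHS]row_sum_delta.
apply: le_trans (frob_norm_sum _ _) _.
rewrite mulr_natl -[X in _ *+ X]card_ord -sumr_const; apply: ler_sum => l _.
rewrite frob_normZ; have -> : frob_norm (delta_mx 0 l : 'rV[R]_q) = 1.
  rewrite /frob_norm frob_dot_delta mxE !eqxx sqrtr1 //.
by rewrite mulr1.
Qed.

Theorem theorem2 (R : realType) (k : nat) (hk : (1 <= k)%N)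
  (* edge distributions: densities w.r.t. mu, with common support X *)
  (mu : {measure set (measurableTypeR R) -> \bar R}) (p : R -> R -> R)
  (hp : density_family mu p)
  (X : set R) (hX : forall theta, [set x | 0 < p theta x] = X)
  (* the latent space network model, for each n *)
  (d : nat -> measure_display) (Omega : forall n, measurableType (d n))
  (P : forall n, probability (Omega n) R)
  (Ystar : forall n, 'M[R]_(n, k + 1))
  (A : forall n, Omega n -> 'M[R]_n)
  (hA : forall n, latent_space_model mu p (P n) (Ystar n) (A n))
  (* (T1) *)
  (hT1 : \forall n \near \oo,
     (ones n)^T *m positions (Ystar n) = 0 /\
     is_diag_mx ((positions (Ystar n))^T *m positions (Ystar n)))
  (* (T2) *)
  (M1 : R) (hM1 : 0 < M1)
  (hT2 : \forall n \near \oo,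
     two_to_inf (positions (Ystar n)) <= M1 /\ `|degrees (Ystar n)| <= M1)
  (* (T3) *)
  (M2 : R) (hM2 : 0 < M2)
  (hT3 : \forall n \near \oo,
     M2 <= sigma_min
             (n%:R^-1 *: ((positions (Ystar n))^T *m positions (Ystar n))))
  (* (E1) *)
  (hE1 : loglik_regular p X)
  (* (E2) *)
  (K s : R) (hK : 0 < K) (hs : 0 < s)
  (hE2 : \forall n \near \oo, forall i j : 'I_n, (i < j)%N ->
     forall t : R, 0 <= t ->
     (P n [set w | (t < `|dloglik p 1 (Theta (Ystar n) i j) (A n w i j)|)%R]
        <= (2 * expR (- ((t / K) `^ s)))%:E)%E)
  (* inputs of the algorithm; the initial estimate may depend on the data *)
  (Y0 : forall n, Omega n -> 'M[R]_(n, k + 1))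
  (eta_init : nat -> R) (eta_init_gt0 : forall n, 0 < eta_init n)
  (beta : R) (hbeta : 0 < beta < 1)
  (C_ls : R) (hC_ls : 0 < C_ls)
  (R' : nat -> nat) (niter : nat -> nat)
  (* (I1) *)
  (c1 vs0 b0 : R) (hc1 : 0 < c1) (hvs0 : 0 < vs0 < 1 / 2) (hb0 : 0 < b0)
  (hI1 : \forall n \near \oo, forall w : Omega n,
     [/\ (ones n)^T *m positions (Y0 n w) = 0,
         dist2 (Y0 n w) (Ystar n) <= c1 * n%:R `^ (1 - vs0)
       & two_to_inf (Y0 n w) <= b0])
  (* (I2) *)
  (C_init : R) (hC_init : 1 < C_init)
  (hI2 : \forall n \near \oo, 1 / C_init <= n%:R * eta_init n <= C_init)
  (* (I3) *)
  (hI3 : R' @ \oo --> \oo)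
  (M : R) (hM : 2 * M1 <= M) :
  forall eps : R, 0 < eps ->
  exists (C c0 : R) (N : nat),
    [/\ 0 < C, 0 < c0 < 1 &
    (* with probability 1 - O(n ^ (- eps)) *)
    exists2 K' : R, 0 < K' & forall n : nat, (N <= n)%N ->
      exists E : set (Omega n),
        [/\ measurable E,
            ((1 - K' * n%:R `^ (- eps))%:E <= P n E)%E &
            forall w, E w ->
            forall Yhat : 'M[R]_(n, k + 1),
              constrained_mle p (A n w) M Yhat ->
            forall r : nat, (r <= niter n)%N ->
              dist2 (pgd_iterate p (A n w) C_ls beta (R' n) (eta_init n)
                       (Y0 n w) r) Yhat
              <= C * (1 - c0) ^+ r * dist2 (Y0 n w) Yhat]].

Proof.
move=> eps eps0.
have [K1 [K2 hK12]] := loglik_curvature hE1.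
have K1_gt0 b : 0 < b -> 0 < K1 b by move=> /hK12 [].
have K2_gt0 b : 0 < b -> 0 < K2 b by move=> /hK12 [].
have hc b (b_gt0 : 0 < b) x (Xx : X x) :
    curvature_bounds (loglik p ^~ x) (dloglik p 1 ^~ x) b (K1 b) (K2 b).
  by have [_ _ h] := hK12 b b_gt0; exact: h.
(* (T3) gives conditioning 8 m, of which 2 m survives at the estimator; the other bound ensures 2 m
   <= 1. *)
pose m := Num.min (1 / 2) (M2 / 8).
have m0 : 0 < m by rewrite lt_min !divr_gt0.
have m1 : 2 * m <= 1.
  by rewrite -ler_pdivlMl // mulr1 ge_min -[X in _ <= X]mul1r lexx.
have m2 : 8 * m <= M2 by rewrite mulrC -ler_pdivlMr // ge_min lexx orbT.
have [C [c0 [e1 [R0 [C0 hc0 e10 main]]]]] :=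
  @deterministic_convergence R k p K1 K2 K1_gt0 K2_gt0 M1 M m b0 C_ls C_init beta
    hM1 hM (ltW hb0) m0 m1 hC_ls hC_init hbeta.
pose bS := 2 * M1; have bS0 : 0 <= bS by rewrite mulr_ge0 // ltW.
pose bT := (1 + bS) ^+ 2.
have bT0 : 0 < bT by rewrite exprn_gt0 // ltr_wpDr.
pose KT := K2 (bT + 1).
have KT0 : 0 < KT by apply: K2_gt0; rewrite addr_gt0.
pose B := 1 + bS; have B0 : 0 < B by rewrite ltr_wpDr.
(* The constant in O(n^(-eps)), as produced by the union bound. *)
pose Kp := 1 + (2 * (k + 1)%:R + 2) * expR (KT / 2).
have Kp0 : 0 < Kp by rewrite ltr_wpDr // mulr_ge0 ?expR_ge0 // addr_ge0 // mulr_ge0.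
pose lam := 2 + eps; have lam0 : 0 <= lam by rewrite addr_ge0 // ltW.
pose Cc := KT + 2 * (4 + eps).
have Cc0 : 0 <= Cc.
  by apply: addr_ge0; [exact: ltW|apply: mulr_ge0 => //; apply: addr_ge0 => //; exact: ltW].
pose Cr := (k + 1)%:R * (2 * B).
have Cr0 : 0 <= Cr by apply: mulr_ge0 => //; apply: mulr_ge0 => //; exact: ltW.
have vs0_gt0 : 0 < vs0 by case/andP: hvs0.
have hR' : \forall n \near \oo, (R0 <= R' n)%N by exact: (hI3 _ (nbhs_infty_ge R0)).
have large : \forall n \near \oo, [/\ 1 <= n%:R :> R, 1 / e1 <= n%:R & (R0 <= R' n)%N].
  by near=> n; split; near: n => //; exact: nbhs_infty_ger.
(* All eventual conditions hold from one N on, including smallness of the noise scales relative to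
   [e1]. *)
have [N _ hN] := filterI hT1 (filterI hT2 (filterI hT3 (filterI hI1 (filterI hI2
  (filterI large (noise_scales_small lam0 Cc0 Cr0 (ltW hc1) vs0_gt0 e10)))))).
exists C, c0, N; split=> //; exists Kp => // n Nn.
have [[cYs _] [[z1 z2] [z3 [hy [het [[n1 ne hRn] /= [w0 htau hLt L1 ht]]]]]]] := hN n Nn.
have nR : 0 < n%:R :> R by exact: lt_le_trans n1.
have nN : (0 < n)%N by rewrite ltr0n in nR.
have fS : row_feasible M1 (Ystar n).
  by apply: (feasibleP _ hk (ltW hM1)).1; split.
have bYs : rows_bounded bS (Ystar n) by exact: row_feasible_bounded.
have hTh i j : `|Theta (Ystar n) i j| <= bT by exact: Theta_le.
have hdes j l : `|design (Ystar n) j l| <= B.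
  apply: le_trans (nrm_row_design j bS0 bYs).
  by have := frob_norm_entry_le (row j (design (Ystar n))) 0 l; rewrite mxE.
have bT1 : 0 < bT + 1 by exact: addr_gt0.
have [Ev [mE pE hEv]] := noise_bounds hp hX hE1 (hA n) bT0 hTh (hc _ bT1) (ltW KT0) eps0 B0 nN hdes.
exists Ev; split=> // w Ew Yhat hmle r _.
have [cut rowsE entE supE] := hEv w Ew.
have [ysc yd yb] := hy w.
have [symA _] := (let: And4 h _ _ _ := hA n in h) w.
have regA := support_data_regular hE1 hc symA supE.
have Mge : 0 <= M by apply: le_trans hM; rewrite mulr_ge0 // ltW.
have [fH hmin] := hmle.
have ln0 : 0 <= ln (n%:R : R) by exact: ln_ge0.
have lln0 : 0 <= lam * ln (n%:R : R) by exact: mulr_ge0.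
set L := 1 + 2 * (lam * ln n%:R) in L1 hLt w0.
have L0 : 0 <= L by exact: le_trans L1.
have entL i j : `|score p (A n w) (Ystar n) i j| <= L.
  by apply: le_trans (entE i j) _; rewrite /L lerDr.
have tau0 : 0 < n%:R `^ (- (1 / 3)) :> R by exact: powR_gt0.
have cut0 : 0 <= Cc * n%:R * Num.sqrt n%:R.
  by apply: mulr_ge0; [exact: mulr_ge0|exact: sqrtr_ge0].
(* Here the clipping level is n^(-1/3), and L has an added 1 so that 1 <= L. *)
have op := cut_op_bounded cut entL tau0 L0 cut0.
set wn := (_ / n%:R) in w0 hLt.
have op' : op_bounded (wn * n%:R) (score p (A n w) (Ystar n)).
  by rewrite /wn divfK ?gt_eqF.
set t := Num.sqrt c1 * _ in hLt ht; set tau := _ / n%:R in htau.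
have t0 : 0 <= t by apply: mulr_ge0; [exact: sqrtr_ge0|exact: powR_ge0].
apply: (main n (A n w) (Ystar n) Yhat (Y0 n w) tau wn L t (eta_init n) (R' n) r) => //.
- move=> v; apply: le_trans (well_conditioned_sigma_min hk nN z3 v).
  by apply: ler_wpM2r; [exact: frob_dot_ge0|apply: ler_wpM2r => //; exact: ltW].
- move=> i; rewrite /tau divfK ?gt_eqF //.
  have -> : Cr * Num.sqrt n%:R * (lam * ln n%:R) = (k + 1)%:R * (2 * B * Num.sqrt n%:R * (lam * ln n%:R)).
    by rewrite /Cr !mulrA.
  apply: frob_norm_row_entries => [|l].
    by apply: mulr_ge0 => //; apply: mulr_ge0; [apply: mulr_ge0 => //; exact: ltW|exact: sqrtr_ge0].
  by rewrite mxE; exact: rowsE.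
- exact: (feasibleP _ hk Mge).1.
- by move=> Y /(feasibleP _ hk Mge).2; exact: hmin.
- by apply/two_to_infP => //; [rewrite addn1|exact: ltW].
- exact: le_trans yd ht.
- by rewrite mulrC -ler_pdivrMr.
Unshelve. all: by end_near.
Qed.
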